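(* Let $a,p:\mathbb{Z}\to\mathbb{R}$ and $b,q:\mathbb{Z}\to\mathbb{C}$ satisfy $a(x)^2+|b(x)|^2=1$ and $p(x)^2+|q(x)|^2=1$ for all $x\in\mathbb{Z}$. Let $\theta:\mathbb{Z}\to\mathbb{R}$ satisfy $q(x)=|q(x)|e^{\mathrm{i}\theta(x)}$ for all $x\in\mathbb{Z}$, and let $Q_{\epsilon_0}$ be the bounded operator on $\ell^2(\mathbb{Z})$ given by $$Q_{\epsilon_0}=\frac{\mathrm{i}}{2}\left[\sqrt{1+p}\,e^{\mathrm{i}\theta}L\,b^{*}\sqrt{1+p}-\sqrt{1-p}\,b\,L^{*}e^{-\mathrm{i}\theta}\sqrt{1-p}-|q|\{a+a(\cdot+1)\}\right].$$ Assume that for each $\spadesuit\in\{a,b,p,q\}$ the two limits $\spadesuit_{\pm}:=\lim_{x\to\pm\infty}\spadesuit(x)$ exist and that $$\sum_{x\ge 0}\Bigl[|\spadesuit(x)-\spadesuit_{+}|+|\spadesuit(-x-1)-\spadesuit_{-}|\Bigr]<\infty .$$ Then the Witten index $w(Q_{\epsilon_0})$ exists and $$w(Q_{\epsilon_0})=W(a_+,p_+)-W(a_-,p_-),$$ where $W:[-1,1]\times[-1,1]\to\mathbb{R}$ is defined by $W(r,s):=0$ if $|r|=|s|=1$, and $W(r,s):=[\operatorname{sgn}(r+s)-\operatorname{sgn}(r-s)]/2$ otherwise.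
   Context: $L$ is the left-shift operator on $\ell^2(\mathbb{Z})$: $(L\psi)(x)=\psi(x+1)$. Bounded sequences are identified with the corresponding multiplication operators on $\ell^2(\mathbb{Z})$; $b^*$ denotes the complex conjugate of $b$, and $a(\cdot+1)$ is the sequence $x\mapsto a(x+1)$. The sign function is $\operatorname{sgn}x=+1,0,-1$ for $x>0$, $x=0$, $x<0$ respectively. Witten index: for a bounded operator $A$ on a Hilbert space such that $A^*A-AA^*$ is trace class, the operator $e^{-tA^*A}-e^{-tAA^*}$ is trace class for all $t>0$; set $\operatorname{ind}_t(A):=\operatorname{Tr}(e^{-tA^*A}-e^{-tAA^*})$ and $w(A):=\lim_{t\to\infty}\operatorname{ind}_t(A)$ whenever this limit exists. The assertion that $w(A)$ exists includes that $A^*A-AA^*$ is trace class. *)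

(* Defs.v *)
From HB Require Import structures.
From mathcomp Require Import all_boot all_order all_algebra.
From mathcomp Require Import all_classical all_reals all_analysis.
From mathcomp Require Import complex lra.

Set Implicit Arguments.
Unset Strict Implicit.
Unset Printing Implicit Defensive.

Import Order.TTheory GRing.Theory Num.Theory.
Import numFieldNormedType.Exports.
Import Normc.

Local Open Scope classical_set_scope.
Local Open Scope ring_scope.
Local Open Scope complex_scope.

Section SquareSummable.
Variable R : realType.
Local Notation C := R[i].

(* [normc z : R] is the modulus of [z : R[i]]; the library norm [`|z|] is the
   same number, but seen as an element of [R[i]]. *)
Definition square_summable (u : int -> C) : Prop :=
  summable [set: int] (fun x => (normc (u x) ^+ 2)%:E).

Lemma normc_ge0 (z : C) : 0 <= normc z.
Proof. by case: z => a b; exact: sqrtr_ge0. Qed.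

Lemma ler_normcD (z w : C) : normc (z + w) <= normc z + normc w.
Proof. exact: le_normcD. Qed.

Lemma summable_le (f g : int -> R) : (forall x, `|f x| <= `|g x|) ->
  summable [set: int] (EFin \o g) -> summable [set: int] (EFin \o f).
Proof.
move=> fg; apply: le_lt_trans; apply: le_esum => x _ /=.
by rewrite lee_fin.
Qed.

Lemma square_summableD (u v : int -> C) :
  square_summable u -> square_summable v -> square_summable (u + v).
Proof.
move=> us vs; have := summableD (summableD us us) (summableD vs vs).
apply: (@summable_le _ (fun x => normc (u x) ^+ 2 + normc (u x) ^+ 2 +
  (normc (v x) ^+ 2 + normc (v x) ^+ 2))) => x.
rewrite !ger0_norm ?addr_ge0 ?sqr_ge0//.
rewrite (@le_trans _ _ ((normc (u x) + normc (v x)) ^+ 2))//.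
  by rewrite ler_pXn2r ?nnegrE ?addr_ge0 ?normc_ge0// ler_normcD.
by have := sqr_ge0 (normc (u x) - normc (v x)); rewrite !expr2; lra.
Qed.

Lemma square_summable_dom (u v : int -> C) (M : R) :
  (forall x, normc (v x) <= M * normc (u x)) ->
  square_summable u -> square_summable v.
Proof.
move=> uv us.
have uns n : summable [set: int] (fun x => (n%:R * normc (u x) ^+ 2)%:E).
  elim: n => [|n IHn].
    by rewrite /summable esum1// => x _; rewrite mul0r abse0.
  have := summableD us IHn.
  congr summable; apply/funext => x /=.
  by rewrite -EFinD -[in RHS]natr1 mulrDl mul1r addrC.
have [n Mn] : exists n, M ^+ 2 <= n%:R.
  by exists (Num.trunc (M ^+ 2)).+1; rewrite ltW// truncnS_gt.
apply: summable_le (uns n) => x.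
rewrite ger0_norm ?sqr_ge0// ger0_norm; last by rewrite mulr_ge0// sqr_ge0.
apply: (@le_trans _ _ (M ^+ 2 * normc (u x) ^+ 2)).
  rewrite -exprMn ler_pXn2r ?nnegrE//; first exact: normc_ge0.
  exact: le_trans (normc_ge0 (v x)) (uv x).
by rewrite ler_wpM2r ?sqr_ge0.
Qed.

Definition l2_pred : {pred int -> C} := fun u => `[< square_summable u >].

Lemma l2_predP u : reflect (square_summable u) (u \in l2_pred).
Proof. exact: asboolP. Qed.

Lemma l2_submod_closed : submod_closed l2_pred.
Proof.
split=> [|k u v /l2_predP us /l2_predP vs]; apply/l2_predP.
  by rewrite /square_summable /summable esum1// => x _; rewrite normc0 expr0n/= normr0.
apply: square_summableD vs; apply: (square_summable_dom (M := normc k)) us => x.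
by rewrite -normcM.
Qed.

End SquareSummable.

HB.instance Definition _ (R : realType) :=
  GRing.isSubmodClosed.Build R[i] (int -> R[i]) (@l2_pred R) (@l2_submod_closed R).

Section L2Type.
Variable R : realType.

Record l2 := L2 { l2_val :> int -> R[i]; _ : l2_val \in @l2_pred R }.

HB.instance Definition _ := [isSub for l2_val].
HB.instance Definition _ := [Choice of l2 by <:].
HB.instance Definition _ := [SubChoice_isSubLmodule of l2 by <:].

End L2Type.

(* Only used for absolutely summable [f], where the order is immaterial. *)
Definition zsum (K : numFieldType) (f : int -> K) : K :=
  limn (fun n : nat => \sum_(k < n) (f k%:Z + f (- k.+1%:Z))).

Section Hilbert.
Variable R : realType.
Local Notation C := R[i].
Local Notation H := (l2 R).

Definition inner (u v : H) : C := zsum (fun x => (u x)^*%C * v x).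

Definition l2norm (u : H) : R := Num.sqrt (complex.Re (inner u u)).

Fact delta_subproof (x : int) : (fun y => (y == x)%:R) \in @l2_pred R.
Proof.
apply/l2_predP; rewrite /square_summable /summable.
rewrite (_ : esum _ _ = 1%E) ?ltry//.
rewrite -[RHS](@esum_set1 R _ x (fun=> 1%E))// [RHS]esum_mkcond.
apply: eq_esum => y _; case: eqVneq => [->|/eqP yx].
  by rewrite mem_set// normc1 expr1n /= normr1.
by rewrite memNset// normc0 expr0n /= normr0.
Qed.

Definition delta (x : int) : H := L2 (delta_subproof x).

(* The operator on l2 induced by a map [T] of sequences. It is given by [T] on
   every [u] such that [T u] is in l2, hence on the whole space if [T] preserves
   l2, which is the case of the uses below ([mul_opE] and [left_shiftE]). *)
Definition seq_op (T : (int -> C) -> (int -> C)) : H -> H :=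
  fun u => insubd 0 (T u).

Definition mul_op (w : int -> C) : H -> H := seq_op (fun u x => w x * u x).

Definition left_shift : H -> H := seq_op (fun u x => u (x + 1)).

Lemma mul_opE (w : int -> C) (M : R) : (forall x, normc (w x) <= M) ->
  forall u x, mul_op w u x = w x * u x.
Proof.
move=> wM u x; rewrite /mul_op /seq_op insubdK//.
apply/l2_predP/(square_summable_dom (M := M) (u := u)) => [y|].
  by rewrite normcM ler_wpM2r ?normc_ge0.
by apply/l2_predP; case: u.
Qed.

Lemma left_shiftE u x : left_shift u x = u (x + 1).
Proof.
rewrite /left_shift /seq_op insubdK//.
have /l2_predP us : l2_val u \in @l2_pred R by case: u.
apply/l2_predP; move: us; rewrite /square_summable /summable.
rewrite (@reindex_esum R _ _ setT setT (fun x : int => x + 1)) //.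
split=> //; first by move=> y z _ _ /addIr.
by move=> y _; exists (y - 1) => //; rewrite subrK.
Qed.

Definition bounded_op (A : H -> H) : Prop :=
  linear A /\ exists M : R, forall u, l2norm (A u) <= M * l2norm u.

(* [adjoint A] and [opexp A] below are the unique operators with their defining
   properties, which exist when [A] is bounded. *)
Definition adjoint (A : H -> H) : H -> H :=
  xget 0 [set B | forall u v, inner (B u) v = inner u (A v)].

(* sum of the power series of the exponential, in operator norm *)
Definition is_opexp (A E : H -> H) : Prop :=
  bounded_op E /\
  forall e : R, 0 < e -> \forall n \near \oo, forall u,
    l2norm (E u - \sum_(k < n) (k`!%:R)^-1 *: iter k A u) <= e * l2norm u.

Definition opexp (A : H -> H) : H -> H := xget 0 [set E | is_opexp A E].

(* [S] is the positive square root of T^* T, i.e. the modulus |T|; in [R[i]],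
   [0 <= z] says that [z] is real and nonnegative. *)
Definition is_modulus (T S : H -> H) : Prop :=
  [/\ bounded_op S, forall u, 0 <= inner u (S u) & S \o S = adjoint T \o T].

Definition trace_class (T : H -> H) : Prop :=
  bounded_op T /\ exists S, is_modulus T S /\
    summable [set: int] (fun x => (complex.Re (inner (delta x) (S (delta x))))%:E).

Definition trace (T : H -> H) : C := zsum (fun x => inner (delta x) (T (delta x))).

Definition commutator_defect (A : H -> H) : H -> H :=
  (adjoint A \o A) - (A \o adjoint A).

Definition heat_difference (A : H -> H) (t : R) : H -> H :=
  opexp ((- t)%:C *: (adjoint A \o A)) - opexp ((- t)%:C *: (A \o adjoint A)).

Definition witten_ind (A : H -> H) (t : R) : C := trace (heat_difference A t).

(* The trace class condition on the heat difference follows from the one on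
   A^* A - A A^*; it is what makes [trace] meaningful in [witten_ind]. *)
Definition has_witten_index (A : H -> H) (w : R) : Prop :=
  [/\ bounded_op A,
      trace_class (commutator_defect A),
      forall t : R, 0 < t -> trace_class (heat_difference A t) &
      (witten_ind A t : C^o) @[t --> +oo%R] --> (w%:C : C^o)].

Definition expi (t : R) : C := cos t +i* sin t.

Definition Q_eps0 (a p : int -> R) (b q : int -> C) (theta : int -> R) : H -> H :=
  let rp := mul_op (fun x => (Num.sqrt (1 + p x))%:C) in
  let rm := mul_op (fun x => (Num.sqrt (1 - p x))%:C) in
  ('i / 2) *:
  ((rp \o mul_op (fun x => expi (theta x)) \o left_shift
       \o mul_op (fun x => (b x)^*%C) \o rp)
   - (rm \o mul_op b \o adjoint left_shift
         \o mul_op (fun x => expi (- theta x)) \o rm)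
   - mul_op (fun x => `|q x| * (a x + a (x + 1))%:C)).

Definition W (r s : R) : R :=
  if (`|r| == 1) && (`|s| == 1) then 0
  else (Num.sg (r + s) - Num.sg (r - s)) / 2.

End Hilbert.

(* [f] has limits [l] at -oo and [r] at +oo, and the differences are summable. *)
Definition summable_limits (K : numFieldType) (f : int -> K) (l r : K) : Prop :=
  [/\ f (- n%:Z) @[n --> \oo] --> l,
      f n%:Z @[n --> \oo] --> r &
      cvgn (series (fun n : nat => `|f n%:Z - r| + `|f (- n%:Z - 1) - l|))].

(* Main.v *)
(** Write [A] for [Q_eps0]. Conjugating by a diagonal unitary removes all the
   phases, so that [A] becomes [i B] with [B] a real tridiagonal matrix whose
   coefficients converge summably at both ends. For [k >= 1],
   [(A^* A)^k - (A A^* )^k] is the commutator of [A^*] and [A (A^* A)^(k-1)]; as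
   [A] is tridiagonal, its diagonal is a discrete derivative, and its trace over
   [-N, N-1] is a difference of two boundary terms, whose limits only involve
   the limits of the coefficients. Summing the exponential series,
   [ind_t A = F_+ t - F_- t], where [F] is attached to a constant-coefficient
   operator with symbol [f]: its terms are means over the circle of
   [|f|^(2k-2) Im (conj f * f')]. Means are taken over the [N]-th roots of unity,
   which is exact on Laurent polynomials of degree less than [N]. With
   [h = p a + |b| |q| cos] one has [|f|^2 = 1 - h^2] and
   [F t = mean ((p - a h) (1 - exp (- t (1 - h^2))) / (1 - h^2))]. Since
   [p - a h = ((p - a) (1 + h) + (p + a) (1 - h)) / 2], partial fractions and the
   Poisson integral [mean (1 / (A - B cos)) = 1 / sqrt (A^2 - B^2)] give the limit
   [(sgn (p - a) + sgn (p + a)) / 2]; the same integral and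
   [exp (- x) <= 1 / (1 + x)] bound the remainder.

   As for trace class, the entries of [A^* A - A A^*] are absolutely summable,
   and telescoping [H^k - H'^k] carries this over to the heat difference. *)

Require Import Defs.
From mathcomp Require Import all_boot all_order all_algebra.
From mathcomp Require Import all_classical all_reals all_analysis.
From mathcomp Require Import complex zify ring lra.

Set Implicit Arguments.
Unset Strict Implicit.
Unset Printing Implicit Defensive.

Import Order.TTheory GRing.Theory Num.Theory.
Import numFieldNormedType.Exports.
Import Normc.

Local Open Scope classical_set_scope.
Local Open Scope ring_scope.
Local Open Scope complex_scope.

(** * Sums over windows *)

(** The obstacle is a symbol with zeros, since no Fredholm condition is assumed. The identity
    [(1 - p a)^2 - (|b| |q|)^2 = (p - a)^2], with its twin for [p + a], shows that [1 - h] can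
    vanish only when [p = a], and [1 + h] only when [p = - a]. In the partial fractions
    [1 / (1 - h)] carries the factor [p - a] and [1 / (1 + h)] the factor [p + a], so a singular
    term is always absent; this is where the value [sgn 0 = 0] comes from. The case [|a| = |p| = 1]
    is set apart: there the off-diagonal coefficients vanish in the limit. The order of limits
    matters: the window grows at fixed [t], with geometric bounds on the boundary terms, and only
    then does [t] grow. Trace class asks for an actual modulus. The operators concerned are
    self-adjoint, so a square root of [T^2] is enough, and it is built by a monotone iteration. In
    place of the trace norm the proof propagates the sum of the moduli of all matrix entries, which
    is stable under tridiagonal factors on either side and under entrywise limits, and which
    dominates the sum of the column norms. *)

Section Windows.

(* The sum over the window [-n, n - 1]; [zsum f] is the limit of [wsum f]. *)
Definition wsum (V : nmodType) (f : int -> V) (n : nat) : V :=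
  \sum_(k < n) (f k%:Z + f (- k.+1%:Z)).

Lemma wsumS (V : nmodType) (f : int -> V) n :
  wsum f n.+1 = wsum f n + (f n%:Z + f (- n.+1%:Z)).
Proof. by rewrite /wsum big_ord_recr. Qed.

Lemma eq_wsum (V : nmodType) (f g : int -> V) n :
  (forall x, f x = g x) -> wsum f n = wsum g n.
Proof. by move=> fg; apply: eq_bigr => k _; rewrite !fg. Qed.

Lemma wsumD (V : nmodType) (f g : int -> V) n :
  wsum (fun x => f x + g x) n = wsum f n + wsum g n.
Proof. by rewrite /wsum -big_split; apply: eq_bigr => k _; rewrite addrACA. Qed.

Lemma wsumN (V : zmodType) (f : int -> V) n :
  wsum (fun x => - f x) n = - wsum f n.
Proof. by rewrite /wsum -sumrN; apply: eq_bigr => k _; rewrite opprD. Qed.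

Lemma wsumB (V : zmodType) (f g : int -> V) n :
  wsum (fun x => f x - g x) n = wsum f n - wsum g n.
Proof. by rewrite wsumD wsumN. Qed.

Lemma wsumZ (K : pzRingType) (c : K) (f : int -> K) n :
  wsum (fun x => c * f x) n = c * wsum f n.
Proof. by rewrite /wsum mulr_sumr; apply: eq_bigr => k _; rewrite mulrDr. Qed.

Lemma wsum_sum (V : nmodType) (I : Type) (r : seq I) (P : pred I)
    (f : I -> int -> V) n :
  wsum (fun x => \sum_(i <- r | P i) f i x) n = \sum_(i <- r | P i) wsum (f i) n.
Proof.
by rewrite /wsum exchange_big; apply: eq_bigr => k _; rewrite big_split.
Qed.

Lemma wsum_exchange (V : nmodType) (f : int -> int -> V) m n :
  wsum (fun x => wsum (f x) m) n = wsum (fun y => wsum (f^~ y) n) m.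
Proof.
elim: n => [|n IHn].
  by rewrite /wsum big_ord0 big1// => k _; rewrite !big_ord0 addr0.
rewrite wsumS IHn -2!wsumD; apply: eq_wsum => y.
by rewrite wsumS.
Qed.

Lemma wsum_map (V W : zmodType) (phi : {additive V -> W}) (f : int -> V) n :
  phi (wsum f n) = wsum (fun x => phi (f x)) n.
Proof. by rewrite raddf_sum; apply: eq_bigr => k _; rewrite raddfD. Qed.

(** The window is asymmetric, so the surviving sites are [n - 1] and [- n - 1]; the boundary terms
    are evaluated there from now on. *)
Lemma wsum_telescope (V : zmodType) (f : int -> V) n :
  wsum (fun x => f x - f (x - 1)) n = f (n%:Z - 1) - f (- n%:Z - 1).
Proof.
elim: n => [|n IHn]; first by rewrite /wsum big_ord0 oppr0 subrr.
have -> : n.+1%:Z - 1 = n%:Z by lia.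
have -> : - n.+1%:Z - 1 = - n%:Z - 1 - 1 by lia.
rewrite wsumS IHn.
have -> : - n.+1%:Z = - n%:Z - 1 by lia.
by rewrite addrA [f (n%:Z - 1) - _ + _]addrC subrKA subrKA.
Qed.

(** * Absolute summability through bounded window sums *)

Section Order.
Variable R : realType.
Implicit Types f g : int -> R.

Lemma ler_wsum f g n : (forall x, f x <= g x) -> wsum f n <= wsum g n.
Proof. by move=> fg; apply: ler_sum => k _; rewrite lerD. Qed.

Lemma wsum_ge0 f n : (forall x, 0 <= f x) -> 0 <= wsum f n.
Proof. by move=> f0; apply: sumr_ge0 => k _; rewrite addr_ge0. Qed.

Lemma wsum_homo f : (forall x, 0 <= f x) ->
  {homo wsum f : m n / (m <= n)%N >-> m <= n}.
Proof.
move=> f0; apply: homo_leq => [//|m n p|n]; first exact: le_trans.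
by rewrite wsumS lerDl addr_ge0.
Qed.

(** The shifted window lies inside the next larger one, so bounds uniform in [n] survive shifts. *)
Lemma wsum_shiftr f n : (forall x, 0 <= f x) ->
  wsum (fun x => f (x + 1)) n <= wsum f n.+1.
Proof.
move=> f0; have := wsum_telescope (fun x => f (x + 1)) n.
have -> : n%:Z - 1 + 1 = n by lia.
have -> : - n%:Z - 1 + 1 = - n%:Z by lia.
rewrite wsumB (@eq_wsum _ (fun x => f (x - 1 + 1)) f) => [E|x]; last by rewrite subrK.
rewrite wsumS; move: E; have := f0 (- n%:Z); have := f0 (- n.+1%:Z); lra.
Qed.

Lemma wsum_shiftl f n : (forall x, 0 <= f x) ->
  wsum (fun x => f (x - 1)) n <= wsum f n.+1.
Proof.
move=> f0; have := wsum_telescope f n.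
rewrite wsumB wsumS; have := f0 n%:Z.
have -> : - n.+1%:Z = - n%:Z - 1 by lia.
have := f0 (n%:Z - 1); lra.
Qed.

Lemma le_wsum_at f x : (forall x, 0 <= f x) -> exists n, f x <= wsum f n.
Proof.
move=> f0; case: x => n; exists n.+1; rewrite wsumS; have := wsum_ge0 n f0.
  by have := f0 (- n.+1%:Z); lra.
by rewrite NegzE; have := f0 n%:Z; lra.
Qed.

(** Stands in for [summable] over [int], so that all estimates are made on finite sums;
    [absummableP] relates the two. *)
Definition absummable f := exists M : R, forall n, wsum (fun x => `|f x|) n <= M.

Lemma absummable_wsum_cvg f : (forall x, 0 <= f x) -> absummable f ->
  cvgn (wsum f).
Proof.
move=> f0 [M fM]; apply: nondecreasing_is_cvgn.
  by apply/nondecreasing_seqP => n; exact: wsum_homo.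
exists M => _ [n _ <-]; apply: le_trans (fM n).
by apply: ler_wsum => x; rewrite ler_norm.
Qed.

Lemma absummable_cvg0 f : absummable f ->
  (f n%:Z @[n --> \oo] --> 0) /\ (f (- n.+1%:Z) @[n --> \oo] --> 0).
Proof.
move=> fs; have fs' : absummable (fun x => `|f x|).
  by case: fs => M fM; exists M => n; under eq_wsum do rewrite normr_id.
have /cvg_series_cvg_0 c : cvgn (series (fun n => `|f n%:Z| + `|f (- n.+1%:Z)|)).
  rewrite (_ : series _ = wsum (fun x => `|f x|)).
    exact: absummable_wsum_cvg (fun=> normr_ge0 _) fs'.
  by apply/funext => n; rewrite /series/= big_mkord.
split; apply: norm_cvg0; apply: squeeze_cvgr c; [near=> n|exact: cvg_cst|
  near=> n|exact: cvg_cst]; rewrite normr_ge0/= ?lerDl ?lerDr//.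
Unshelve. all: by end_near. Qed.

Lemma absummable_boundary f : absummable f ->
  (f (n%:Z - 1) @[n --> \oo] --> 0) /\ (f (- n%:Z - 1) @[n --> \oo] --> 0).
Proof.
move=> /absummable_cvg0[f1 f2]; split.
  by rewrite -cvg_shiftS; apply: cvg_trans f1; apply: near_eq_cvg; near=> n;
    congr (f _); lia.
by apply: cvg_trans f2; apply: near_eq_cvg; near=> n; congr (f _); lia.
Unshelve. all: by end_near. Qed.

Lemma absummable_shiftr f : absummable f -> absummable (fun x => f (x + 1)).
Proof.
move=> [M fM]; exists M => n; apply: le_trans (fM n.+1).
exact: (@wsum_shiftr (fun x => `|f x|)).
Qed.

Lemma absummable_shiftl f : absummable f -> absummable (fun x => f (x - 1)).
Proof.
move=> [M fM]; exists M => n; apply: le_trans (fM n.+1).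
exact: (@wsum_shiftl (fun x => `|f x|)).
Qed.

Lemma absummable_dom f g : (forall x, `|f x| <= `|g x|) -> absummable g ->
  absummable f.
Proof.
by move=> fg [M gM]; exists M => n; apply: le_trans (gM n); apply: ler_wsum.
Qed.

Lemma absummableD f g : absummable f -> absummable g ->
  absummable (fun x => f x + g x).
Proof.
move=> [M fM] [N gN]; exists (M + N) => n.
apply: le_trans (lerD (fM n) (gN n)); rewrite -wsumD; apply: ler_wsum => x.
exact: ler_normD.
Qed.

Lemma absummableZ c f : absummable f -> absummable (fun x => c * f x).
Proof.
move=> [M fM]; exists (`|c| * M) => n.
rewrite (eq_wsum (g := fun x => `|c| * `|f x|)) => [|x]; last by rewrite normrM.
by rewrite wsumZ ler_wpM2l.
Qed.

Lemma absummableP f : absummable f <-> summable [set: int] (fun x => (f x)%:E).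
Proof.
pose w n := [seq k%:Z | k <- iota 0 n] ++ [seq - k.+1%:Z | k <- iota 0 n].
have wU n : uniq (w n).
  rewrite cat_uniq !map_inj_uniq ?iota_uniq/= => [|x y|x y]; try lia.
  by rewrite andbT; apply/hasPn => _ /mapP[k _ ->]; apply/mapP => -[j _]; lia.
have wE n : wsum (fun x => `|f x|) n = \sum_(x <- w n) `|f x|.
  rewrite big_cat/= !big_map -big_split/= -[X in iota _ X]subn0.
  by rewrite -/(index_iota 0 n) big_mkord.
split=> [[M fM]|fs].
  apply: (@le_lt_trans _ _ M%:E); last exact: ltry.
  apply: ub_ereal_sup => _ [X [finX _] <-].
  (* A finite set of integers lies in the window whose size exceeds its largest absolute value by
     one. *)
  have [n Xn] : exists n, X `<=` [set` w n].
    have /finite_seqP[s Xs] := finX; exists (\max_(x <- s) (absz x)).+1.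
    rewrite Xs => x /= xs; have := @leq_bigmax_seq _ s xpredT absz x xs isT.
    set m := \max_(_ <- _) _ => xm.
    rewrite mem_cat; apply/orP; case: x {xs} xm => k km; [left|right].
      by apply/mapP; exists k => //; rewrite mem_iota; lia.
    by apply/mapP; exists k; rewrite ?NegzE// mem_iota; lia.
  apply: (@le_trans _ _ (\sum_(x \in [set` w n]) `|(f x)%:E|)%E).
    apply: lee_fsum_nneg_subset => // [|x]; last by rewrite !inE; exact: Xn.
    exact: finite_seq.
  rewrite -fsbig_seq//= (_ : (\sum_(i <- w n) _)%E = (\sum_(x <- w n) `|f x|)%:E).
    by rewrite lee_fin -wE.
  by rewrite -sumEFin.
exists (fine (\esum_(x in setT) `|(f x)%:E|%E)) => n.
rewrite -lee_fin fineK; last by move: fs; rewrite summableE.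
apply: esum_ge; exists [set` w n]; first by split=> //; exact: finite_seq.
by rewrite -fsbig_seq//= wE -sumEFin.
Qed.

End Order.
End Windows.

(** * Convergence of complex sequences *)

Section ComplexSums.
Variable R : realType.
Local Notation C := R[i].
Implicit Types (z w : C) (f g : int -> C) (s t : nat -> C).

Lemma normc_sub0 z : (normc z == 0) = (z == 0).
Proof. by apply/eqP/eqP => [/eq0_normc|->]; rewrite ?normc0. Qed.

Lemma conjcD z w : (z + w)^*%C = z^*%C + w^*%C.
Proof. exact: rmorphD. Qed.

Lemma conjcM z w : (z * w)^*%C = z^*%C * w^*%C.
Proof. exact: rmorphM. Qed.

Lemma normc_conj z : normc z^*%C = normc z.
Proof. by case: z => a b /=; rewrite sqrrN. Qed.

Lemma normcB z w : normc (z - w) = normc (w - z).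
Proof. by rewrite -normcN opprB. Qed.

Lemma normcR (a : R) : normc a%:C = `|a|.
Proof. by rewrite /normc/= expr0n addr0 sqrtr_sqr. Qed.

Lemma normcX z n : normc (z ^+ n) = normc z ^+ n.
Proof.
by elim: n => [|n IHn]; rewrite ?expr0 ?normc1// !exprS normcM IHn.
Qed.

Lemma normcRE z : `|z| = (normc z)%:C.
Proof. by case: z. Qed.

Lemma normc_Re z : `|complex.Re z| <= normc z.
Proof. by rewrite -lecR -normcRE normc_ge_Re. Qed.

Lemma normc_Im z : `|complex.Im z| <= normc z.
Proof.
by case: z => a b /=; rewrite -sqrtr_sqr ler_sqrt ?lerDr ?addr_ge0 ?sqr_ge0.
Qed.

Lemma normc_le z : normc z <= `|complex.Re z| + `|complex.Im z|.
Proof.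
case: z => a b /=; rewrite -[leRHS]ger0_norm ?addr_ge0// -sqrtr_sqr ler_sqrt//.
  by rewrite sqrrD !real_normK ?num_real// lerD2r lerDl mulrn_wge0 ?mulr_ge0.
Qed.

Lemma conj_mulE z : z^*%C * z = (normc z ^+ 2)%:C.
Proof. by rewrite mulrC -sqr_normc normcRE rmorphXn. Qed.

Lemma ler_normc_sum (I : Type) (r : seq I) (P : pred I) (F : I -> C) :
  normc (\sum_(i <- r | P i) F i) <= \sum_(i <- r | P i) normc (F i).
Proof.
elim/big_ind2 : _ => [|x a y b xa yb|//]; first by rewrite normc0.
exact: le_trans (ler_normcD _ _) (lerD xa yb).
Qed.

Lemma normc_wsum f n : normc (wsum f n) <= wsum (fun x => normc (f x)) n.
Proof.
apply: le_trans (ler_normc_sum _ _ _) _.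
by apply: ler_sum => k _; exact: ler_normcD.
Qed.

(** Phrased with the real-valued modulus so that the squeeze lemmas for real sequences apply;
    [ccvg_dist] recovers the condition in which epsilon lives in [R[i]]. *)
Definition ccvg s z := (normc (s n - z) @[n --> \oo] --> (0 : R)).

Lemma ccvg_dist (T : Type) (F : set_system T) (s' : T -> C) z : Filter F ->
  (normc (s' n - z) @[n --> F] --> (0 : R)) ->
  forall e : C, 0 < e -> \forall n \near F, `|z - s' n| < e.
Proof.
(* A positive element of [R[i]] has zero imaginary part, so its real part serves as epsilon. *)
move=> FF /cvgrPdist_lt sz [e e']; rewrite ltcE/= => /andP[/eqP e'0 e0].
have := sz e e0; apply: filterS => n.
by rewrite normcRE ltcE/= e'0 eqxx/= sub0r normrN ger0_norm ?normc_ge0// normcB.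
Qed.

Lemma limn_dist (K : numFieldType) (s' : nat -> K) (z : K) :
  (forall e : K, 0 < e -> \forall n \near \oo, `|z - s' n| < e) -> limn s' = z.
Proof.
move=> sz; apply/cvg_lim; first exact: norm_hausdorff.
by apply/cvgrPdist_lt => e e0; exact: sz.
Qed.

Lemma ccvg_unique s z w : ccvg s z -> ccvg s w -> z = w.
Proof.
move=> sz sw; have Ez := limn_dist (@ccvg_dist _ _ s z _ sz).
by rewrite -Ez; exact: limn_dist (@ccvg_dist _ _ s w _ sw).
Qed.

Lemma ccvg_squeeze s z (e : nat -> R) : (forall n, normc (s n - z) <= e n) ->
  (e @ \oo --> 0) -> ccvg s z.
Proof.
move=> se e0; apply: squeeze_cvgr e0; [near=> n|exact: cvg_cst].
by rewrite normc_ge0 se.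
Unshelve. all: by end_near. Qed.

Lemma ccvg_cst z : ccvg (fun=> z) z.
Proof.
apply: (ccvg_squeeze (e := fun=> 0)); last exact: cvg_cst.
by move=> n; rewrite subrr normc0.
Qed.

Lemma ccvg_ext s t z : (forall n, s n = t n) -> ccvg s z -> ccvg t z.
Proof. by move=> /funext ->. Qed.

Lemma ccvgD s t z w : ccvg s z -> ccvg t w -> ccvg (fun n => s n + t n) (z + w).
Proof.
move=> sz tw; apply: (ccvg_squeeze (e := fun n => normc (s n - z) + normc (t n - w))).
  by move=> n; rewrite opprD addrACA ler_normcD.
by rewrite -[X in _ --> X](addr0 0); apply: cvgD.
Qed.

Lemma ccvgZ s z w : ccvg s z -> ccvg (fun n => w * s n) (w * z).
Proof.
move=> sz; apply: (ccvg_squeeze (e := fun n => normc w * normc (s n - z))).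
  by move=> n; rewrite -mulrBr normcM.
by rewrite -[X in _ --> X](mulr0 (normc w)); apply: cvgM => //; exact: cvg_cst.
Qed.

Lemma ccvgN s z : ccvg s z -> ccvg (fun n => - s n) (- z).
Proof.
move=> sz; rewrite -mulN1r; apply: ccvg_ext (ccvgZ (-1) sz) => n.
by rewrite mulN1r.
Qed.

Lemma ccvgB s t z w : ccvg s z -> ccvg t w -> ccvg (fun n => s n - t n) (z - w).
Proof. by move=> sz /ccvgN; exact: ccvgD. Qed.

Lemma ccvgJ s z : ccvg s z -> ccvg (fun n => (s n)^*%C) z^*%C.
Proof.
move=> sz; apply: (ccvg_squeeze (e := fun n => normc (s n - z))) => // n.
by rewrite -rmorphB normc_conj.
Qed.

Lemma ccvg_sum (I : Type) (r : seq I) (P : pred I) (F : I -> nat -> C) (l : I -> C) :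
  (forall i, P i -> ccvg (F i) (l i)) ->
  ccvg (fun n => \sum_(i <- r | P i) F i n) (\sum_(i <- r | P i) l i).
Proof.
move=> Fl; elim: r => [|i r IHr].
  by under [X in ccvg X]funext => n do rewrite big_nil; rewrite big_nil; exact: ccvg_cst.
rewrite big_cons; case: ifPn => Pi.
  by apply: ccvg_ext (ccvgD (Fl _ Pi) IHr) => n; rewrite big_cons Pi.
by apply: ccvg_ext IHr => n; rewrite big_cons (negbTE Pi).
Qed.

Lemma cvg_distP (T : Type) (F : set_system T) (FF : ProperFilter F) (h : T -> R) (l : R) :
  (h x @[x --> F] --> l) <-> (`|h x - l| @[x --> F] --> 0).
Proof.
split=> [hl|/norm_cvg0P hl].
  by apply/norm_cvg0P; rewrite -(subrr l); apply: cvgB => //; exact: cvg_cst.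
rewrite -[l]add0r (_ : (fun x => h x) = (fun x => h x - l + l)).
  by apply: cvgD => //; exact: cvg_cst.
by apply/funext => x; rewrite subrK.
Qed.

Lemma ccvg_ReIm s z : (complex.Re (s n) @[n --> \oo] --> complex.Re z) ->
  (complex.Im (s n) @[n --> \oo] --> complex.Im z) -> ccvg s z.
Proof.
move=> rs is_; apply: (ccvg_squeeze (e := fun n =>
  `|complex.Re (s n) - complex.Re z| + `|complex.Im (s n) - complex.Im z|)).
  by move=> n; apply: le_trans (normc_le _) _; rewrite !raddfB.
rewrite -[X in _ --> X](addr0 0); by apply: cvgD; exact: (cvg_distP _ _ _).1.
Qed.

Lemma ccvg_normc s z : ccvg s z -> (normc (s n) @[n --> \oo] --> normc z).
Proof.
move=> sz; apply/cvg_distP; apply: squeeze_cvgr sz; last exact: cvg_cst.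
near=> n; rewrite normr_ge0/= ler_norml.
have := ler_normcD (s n - z) z; rewrite subrK.
have := ler_normcD (z - s n) (s n); rewrite subrK (normcB z).
by move=> *; apply/andP; split; lra.
Unshelve. all: by end_near. Qed.

Lemma absummable_cvg (h : int -> R) : absummable h -> cvgn (wsum h).
Proof.
move=> hs; have nh : absummable (fun x => `|h x|).
  by apply: absummable_dom hs => x; rewrite normr_id.
(* Written as a difference of two nonnegative sequences, whose window sums are monotone and
   bounded. *)
rewrite (_ : wsum h = (fun n => wsum (fun x => h x + `|h x|) n - wsum (fun x => `|h x|) n)).
  apply: is_cvgB; apply: absummable_wsum_cvg => //.
    by move=> x; rewrite -lerBlDr sub0r lerNl -normrN ler_norm.
  exact: absummableD.
by apply/funext => n; rewrite -wsumB; apply: eq_wsum => x; rewrite addrK.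
Qed.

Lemma zsumE f z : ccvg (wsum f) z -> zsum f = z.
Proof. by move=> fz; apply: limn_dist; exact: ccvg_dist fz. Qed.

Lemma ccvg_zsum f : absummable (fun x => normc (f x)) -> ccvg (wsum f) (zsum f).
Proof.
move=> fs.
have rs : cvgn (wsum (fun x => complex.Re (f x))).
  apply: absummable_cvg; apply: absummable_dom fs => x.
  by rewrite [leRHS]ger0_norm ?normc_ge0 ?normc_Re.
have is_ : cvgn (wsum (fun x => complex.Im (f x))).
  apply: absummable_cvg; apply: absummable_dom fs => x.
  by rewrite [leRHS]ger0_norm ?normc_ge0 ?normc_Im.
suff H : ccvg (wsum f) (limn (wsum (fun x => complex.Re (f x))) +i*
    limn (wsum (fun x => complex.Im (f x)))) by rewrite (zsumE H).
have rE : (fun n => complex.Re (wsum f n)) = wsum (fun x => complex.Re (f x)).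
  by apply/funext => n; exact: (wsum_map (@complex.Re R)).
have iE : (fun n => complex.Im (wsum f n)) = wsum (fun x => complex.Im (f x)).
  by apply/funext => n; exact: (wsum_map (@complex.Im R)).
by apply: ccvg_ReIm; [rewrite rE|rewrite iE].
Qed.

Lemma ccvg_real (s : nat -> R) (a : R) : (s @ \oo --> a) -> ccvg (fun n => (s n)%:C) a%:C.
Proof. by move=> sa; apply: ccvg_ReIm => //=; exact: cvg_cst. Qed.

Lemma ccvg_cauchy s (e : nat -> R) : (e @ \oo --> 0) ->
  (forall m n, (n <= m)%N -> normc (s m - s n) <= e n) -> exists z, ccvg s z.
Proof.
move=> e0 se.
have aux (phi : {additive C -> R}) : (forall z, `|phi z| <= normc z) ->
    cvgn (fun n => phi (s n)).
  move=> phil; apply: cauchy_cvg; apply: cauchy_exP => d d0.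
  move/cvgrPdist_lt : (e0) => /(_ d d0)[N _ NP].
  exists (phi (s N)); exists N => // m /= Nm; rewrite /ball/= -raddfB.
  apply: le_lt_trans (phil _) _; rewrite normcB; apply: le_lt_trans (se _ _ Nm) _.
  by have := NP N (leqnn N); rewrite sub0r normrN; apply: le_lt_trans; exact: ler_norm.
exists (limn (fun n => complex.Re (s n)) +i* limn (fun n => complex.Im (s n))).
by apply: ccvg_ReIm => /=; [apply: (aux (@complex.Re R)); exact: normc_Re|
  apply: (aux (@complex.Im R)); exact: normc_Im].
Qed.

End ComplexSums.

(** * The Hilbert space l2 *)

Section L2Theory.
Variable R : realType.
Local Notation C := R[i].
Local Notation H := (l2 R).
Implicit Types (u v w : H) (z : C).

Lemma l2_memP (f : int -> C) :
  reflect (absummable (fun x => normc (f x) ^+ 2)) (f \in @l2_pred R).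
Proof. by apply: (iffP (l2_predP f)) => /absummableP. Qed.

Lemma l2_absummable u : absummable (fun x => normc (u x) ^+ 2).
Proof. by apply/l2_memP; case: u. Qed.

Lemma l2P u v : (forall x, u x = v x) -> u = v.
Proof. by move=> uv; apply/val_inj/funext. Qed.

Lemma l2D u v x : (u + v) x = u x + v x. Proof. by []. Qed.
Lemma l2N u x : (- u) x = - u x. Proof. by []. Qed.
Lemma l2B u v x : (u - v) x = u x - v x. Proof. by []. Qed.
Lemma l2Z z u x : (z *: u) x = z * u x. Proof. by []. Qed.
Lemma l20 x : (0 : H) x = 0. Proof. by []. Qed.

Lemma l2_sum (I : Type) (r : seq I) (P : pred I) (F : I -> H) x :
  (\sum_(i <- r | P i) F i) x = \sum_(i <- r | P i) F i x.
Proof.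
elim: r => [|i r IHr]; first by rewrite !big_nil.
by rewrite !big_cons; case: ifP => _ //; rewrite l2D IHr.
Qed.

Lemma absummable_inner u v : absummable (fun x => normc ((u x)^*%C * v x)).
Proof.
apply: absummable_dom (absummableD (l2_absummable u) (l2_absummable v)) => x.
rewrite !ger0_norm ?addr_ge0 ?sqr_ge0 ?normc_ge0// normcM normc_conj.
have := sqr_ge0 (normc (u x) - normc (v x)).
have := sqr_ge0 (normc (u x)); have := sqr_ge0 (normc (v x)).
rewrite sqrrB; lra.
Qed.

Lemma ccvg_inner u v : ccvg (wsum (fun x => (u x)^*%C * v x)) (inner u v).
Proof. exact: ccvg_zsum (absummable_inner u v). Qed.

Lemma innerC u v : inner v u = (inner u v)^*%C.
Proof.
apply: zsumE; apply: ccvg_ext (ccvgJ (ccvg_inner u v)) => n.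
rewrite (wsum_map (@conjc R)); apply: eq_wsum => x.
by rewrite /= rmorphM/= conjcK mulrC.
Qed.

Lemma innerDr u v w : inner u (v + w) = inner u v + inner u w.
Proof.
apply: zsumE; apply: ccvg_ext (ccvgD (ccvg_inner u v) (ccvg_inner u w)) => n.
by rewrite -wsumD; apply: eq_wsum => x; rewrite mulrDr.
Qed.

Lemma innerZr z u v : inner u (z *: v) = z * inner u v.
Proof.
apply: zsumE; apply: ccvg_ext (ccvgZ z (ccvg_inner u v)) => n.
by rewrite -wsumZ; apply: eq_wsum => x; rewrite mulrCA.
Qed.

Lemma innerNr u v : inner u (- v) = - inner u v.
Proof. by rewrite -scaleN1r innerZr mulN1r. Qed.

Lemma innerBr u v w : inner u (v - w) = inner u v - inner u w.
Proof. by rewrite innerDr innerNr. Qed.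

Lemma innerDl u v w : inner (v + w) u = inner v u + inner w u.
Proof. by rewrite innerC innerDr rmorphD/= -!innerC. Qed.

Lemma innerNl u v : inner (- v) u = - inner v u.
Proof. by rewrite innerC innerNr rmorphN/= -!innerC. Qed.

Lemma innerBl u v w : inner (v - w) u = inner v u - inner w u.
Proof. by rewrite innerDl innerNl. Qed.

Lemma innerZl z u v : inner (z *: v) u = z^*%C * inner v u.
Proof. by rewrite innerC innerZr rmorphM/= -innerC. Qed.

Lemma l2norm_ge0 u : 0 <= l2norm u. Proof. exact: sqrtr_ge0. Qed.

(** [l2norm] is defined through the complex [zsum]; this brings it back to monotone real window
    sums, on which the norm bounds are proved. *)
Lemma wsum_sq_cvg u : wsum (fun x => normc (u x) ^+ 2) @ \oo --> l2norm u ^+ 2.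
Proof.
have /cvg_ex[/= l sl] := absummable_wsum_cvg (fun=> sqr_ge0 _) (l2_absummable u).
have uE : inner u u = l%:C.
  apply: zsumE; apply: ccvg_ext (ccvg_real sl) => n.
  rewrite (wsum_map (real_complex R)); apply: eq_wsum => x.
  by rewrite conj_mulE.
rewrite /l2norm uE/= sqr_sqrtr//; apply: cvgr_to_ge sl _; apply: nearW => n.
by apply: wsum_ge0 => x; exact: sqr_ge0.
Qed.

Lemma inner_norm u : inner u u = (l2norm u ^+ 2)%:C.
Proof.
apply: zsumE; apply: ccvg_ext (ccvg_real (@wsum_sq_cvg u)) => n.
rewrite (wsum_map (real_complex R)); apply: eq_wsum => x.
by rewrite conj_mulE.
Qed.

Lemma wsum_sq_le u n : wsum (fun x => normc (u x) ^+ 2) n <= l2norm u ^+ 2.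
Proof.
rewrite -(cvg_lim _ (@wsum_sq_cvg u))//; apply: nondecreasing_cvgn_le.
  by apply/nondecreasing_seqP => k; apply: wsum_homo => // x; exact: sqr_ge0.
by apply: cvgP; exact: (@wsum_sq_cvg u).
Qed.

Lemma l2norm_le u (M : R) : 0 <= M ->
  (forall n, wsum (fun x => normc (u x) ^+ 2) n <= M ^+ 2) -> l2norm u <= M.
Proof.
move=> M0 uM; rewrite -ler_sqr ?nnegrE ?l2norm_ge0//.
by apply: (cvgr_to_le (@wsum_sq_cvg u)); apply: nearW => n; exact: uM.
Qed.

Lemma normc_le_l2norm u x : normc (u x) <= l2norm u.
Proof.
rewrite -ler_sqr ?nnegrE ?l2norm_ge0 ?normc_ge0//.
have [n] := @le_wsum_at _ (fun x => normc (u x) ^+ 2) x (fun=> sqr_ge0 _).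
by move/le_trans; apply; exact: wsum_sq_le.
Qed.

Lemma l2norm0P u : l2norm u <= 0 -> u = 0.
Proof.
move=> u0; apply: l2P => x; rewrite l20; apply: eq0_normc; apply/eqP.
by rewrite eq_le normc_ge0 andbT; apply: le_trans (normc_le_l2norm u x) u0.
Qed.

Lemma l2norm0 : l2norm (0 : H) = 0.
Proof.
apply/eqP; rewrite eq_le l2norm_ge0 andbT; apply: l2norm_le => // n.
rewrite expr0n; under eq_wsum do rewrite l20 normc0 expr0n.
by rewrite /wsum big1// => k _; rewrite addr0.
Qed.

Lemma l2normZ z u : l2norm (z *: u) = normc z * l2norm u.
Proof.
apply/eqP; rewrite -(@eqrXn2 _ 2%N) ?mulr_ge0 ?l2norm_ge0 ?normc_ge0//.
apply/eqP/complexI; rewrite -inner_norm innerZl innerZr mulrA conj_mulE.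
by rewrite inner_norm -rmorphM/= exprMn.
Qed.

Lemma l2normN u : l2norm (- u) = l2norm u.
Proof. by rewrite -scaleN1r l2normZ normcN normc1 mul1r. Qed.

Lemma l2normB u v : l2norm (u - v) = l2norm (v - u).
Proof. by rewrite -l2normN opprB. Qed.

Lemma normc_inner_le u v : normc (inner u v) <= l2norm u * l2norm v.
Proof.
have [u0|u0] := leP (l2norm u) 0.
  have -> : inner u v = 0.
    by rewrite (l2norm0P u0) innerC -(scale0r (0 : H)) innerZr mul0r rmorph0.
  by rewrite normc0 mulr_ge0 ?l2norm_ge0.
have [v0|v0] := leP (l2norm v) 0.
  rewrite (l2norm0P v0) -(scale0r (0 : H)) innerZr mul0r normc0.
  by rewrite mulr_ge0 ?l2norm_ge0.
apply: (cvgr_to_le (ccvg_normc (ccvg_inner u v))); near=> n; apply: le_trans (normc_wsum _ _) _.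
(* AM-GM with the weight [l2norm v / l2norm u] *)
pose s := l2norm v / l2norm u; have s0 : 0 < s by rewrite divr_gt0.
apply: (@le_trans _ _ (wsum (fun x => s / 2 * normc (u x) ^+ 2 +
    s^-1 / 2 * normc (v x) ^+ 2) n)).
  apply: ler_wsum => x; rewrite normcM normc_conj.
  rewrite -subr_ge0 (_ : _ - _ =
    (s * normc (u x) - normc (v x)) ^+ 2 / (2 * s)); last first.
    by field; exact: lt0r_neq0.
  by rewrite divr_ge0 ?sqr_ge0// mulr_ge0// ltW.
rewrite wsumD !wsumZ.
apply: (@le_trans _ _ (s / 2 * l2norm u ^+ 2 + s^-1 / 2 * l2norm v ^+ 2)).
  by apply: lerD; apply: ler_wpM2l; rewrite ?wsum_sq_le// divr_ge0 ?invr_ge0 ?(ltW s0).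
rewrite le_eqVlt; apply/orP; left; apply/eqP.
by rewrite /s; field; rewrite !lt0r_neq0.
Unshelve. all: by end_near. Qed.

Lemma ler_l2normD u v : l2norm (u + v) <= l2norm u + l2norm v.
Proof.
rewrite -ler_sqr ?nnegrE ?addr_ge0 ?l2norm_ge0// -lecR -inner_norm.
rewrite innerDl !innerDr (innerC u v) -addrA [inner u v + _]addrA addcJ.
rewrite !inner_norm.
have := normc_inner_le u v; have := normc_Re (inner u v).
set a := complex.Re _; rewrite ler_norml => /andP[_ ar rl].
rewrite -(rmorph_nat (real_complex R)) -rmorphM -!rmorphD lecR/=.
by rewrite sqrrD mulr2n; lra.
Qed.

Lemma ler_l2normB u v w : l2norm (u - v) <= l2norm (u - w) + l2norm (w - v).
Proof. by rewrite -[u - v](subrKA w) ler_l2normD. Qed.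

Lemma ler_l2norm_sum (I : Type) (r : seq I) (P : pred I) (F : I -> H) :
  l2norm (\sum_(i <- r | P i) F i) <= \sum_(i <- r | P i) l2norm (F i).
Proof.
elim/big_ind2 : _ => [|x a y b xa yb|//]; first by rewrite l2norm0.
exact: le_trans (ler_l2normD _ _) (lerD xa yb).
Qed.

Lemma wsum_delta (V : pzRingType) (f : int -> V) (x : int) n :
  wsum (fun y => (y == x)%:R * f y) n =
  if (- n%:Z <= x) && (x < n%:Z) then f x else 0.
Proof.
elim: n => [|n IHn].
  by rewrite /wsum big_ord0; case: ifP => //; lia.
rewrite wsumS IHn; case: (boolP (- n%:Z <= x < n%:Z)) => c /=.
  have -> : (n%:Z == x) = false by lia.
  have -> : (- n.+1%:Z == x) = false by lia.
  by rewrite ifT ?mul0r ?addr0//; lia.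
rewrite add0r; case: (eqVneq n%:Z x) => [<-|n1].
  have -> : (- n.+1%:Z == n%:Z) = false by lia.
  by rewrite ifT ?mul1r ?mul0r ?addr0//; lia.
rewrite mul0r add0r; case: (eqVneq (- n.+1%:Z) x) => [<-|n2].
  by rewrite ifT ?mul1r//; lia.
by rewrite ifF ?mul0r//; lia.
Qed.

Lemma ccvg_near_cst (s : nat -> C) z : (\forall n \near \oo, s n = z) -> ccvg s z.
Proof.
move=> sz; apply/cvgrPdist_lt => e e0; apply: filterS sz => n ->.
by rewrite subrr normc0 subrr normr0.
Qed.

Lemma inner_delta x v : inner (delta R x) v = v x.
Proof.
apply: zsumE; apply: ccvg_near_cst; near=> n.
rewrite (@eq_wsum _ _ (fun y => (y == x)%:R * v y)) => [|y]; last first.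
  by rewrite /= rmorph_nat.
rewrite wsum_delta ifT//.
have : (absz x < n)%N by near: n; exact: nbhs_infty_gt.
by lia.
Unshelve. all: by end_near. Qed.

Lemma wsum_cvg (F : nat -> int -> R) (l : int -> R) k :
  (forall x, F m x @[m --> \oo] --> l x) -> wsum (F m) k @[m --> \oo] --> wsum l k.
Proof.
move=> Fl; elim: k => [|k IHk].
  by rewrite /wsum; under eq_cvg do rewrite big_ord0; rewrite big_ord0; exact: cvg_cst.
under eq_cvg do rewrite wsumS; rewrite wsumS.
by apply: cvgD => //; exact: cvgD.
Qed.

(** Fatou's argument: the pointwise limit exists, and on every finite window the bound on
    [s m - s n] passes to the limit in [m]. The rate [e] is unchanged, so it can be carried over to
    operators. *)
Lemma l2_complete (s : nat -> H) (e : nat -> R) : (e @ \oo --> 0) ->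
  (forall m n, (n <= m)%N -> l2norm (s m - s n) <= e n) ->
  exists u, forall n, l2norm (u - s n) <= e n.
Proof.
move=> e0 se.
have en0 n : 0 <= e n by have := se n n (leqnn n); rewrite subrr l2norm0.
have /choice[f sf] : forall x, exists z, ccvg (fun n => s n x) z.
  move=> x; apply: ccvg_cauchy e0 _ => m n nm.
  by apply: le_trans (se _ _ nm); rewrite -l2B normc_le_l2norm.
have fs n k : wsum (fun x => normc (f x - s n x) ^+ 2) k <= e n ^+ 2.
  apply: cvgr_to_le (@wsum_cvg (fun m x => normc (s m x - s n x) ^+ 2) _ _ _) _.
    move=> x; have c := ccvg_normc (ccvgB (sf x) (ccvg_cst (s n x))).
    exact: (cvgM c c).
  near=> m; apply: le_trans (wsum_sq_le (s m - s n) k) _.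
  rewrite ler_sqr ?nnegrE ?l2norm_ge0//; apply: se.
  by near: m; exact: nbhs_infty_ge.
have gl2 n : (fun x => f x - s n x) \in @l2_pred R.
  apply/l2_memP; exists (e n ^+ 2) => k; apply: le_trans (fs n k).
  by apply: ler_wsum => x; rewrite ger0_norm ?sqr_ge0.
(* The limit [f] is not known to be in l2 beforehand, but [f - s 0] is, and adding [s 0] back gives
   an element of the space. *)
exists (L2 (gl2 0%N) + s 0%N) => n; apply: l2norm_le => // k.
by under eq_wsum do rewrite l2B l2D subrK; exact: fs.
Unshelve. all: by end_near. Qed.

End L2Theory.

(** * Bounded operators and the modulus *)

Section Operators.
Variable R : realType.
Local Notation C := R[i].
Local Notation H := (l2 R).

Section Linear.
Variables (K : pzRingType) (V U : lmodType K) (A : V -> U) (lA : linear A).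
Implicit Types (u v : V) (z : K).

Lemma linD u v : A (u + v) = A u + A v.
Proof. by have := lA 1 u v; rewrite !scale1r. Qed.

Lemma lin0 : A 0 = 0.
Proof. by apply: (addrI (A 0)); rewrite -linD !addr0. Qed.

Lemma linZ z u : A (z *: u) = z *: A u.
Proof. by have := lA z u 0; rewrite lin0 !addr0. Qed.

Lemma linN u : A (- u) = - A u.
Proof. by rewrite -scaleN1r linZ scaleN1r. Qed.

Lemma linB u v : A (u - v) = A u - A v.
Proof. by rewrite linD linN. Qed.

End Linear.

Lemma lin_comp (K : pzRingType) (V U X : lmodType K) (S : U -> X) (T : V -> U) :
  linear S -> linear T -> linear (S \o T).
Proof. by move=> lS lT z u v; rewrite /= lT lS. Qed.

Lemma lin_iter (K : pzRingType) (V : lmodType K) (A : V -> V) k :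
  linear A -> linear (iter k A).
Proof. by move=> lA; elim: k => // k IHk; exact: lin_comp lA IHk. Qed.

Implicit Types (u v w : H) (z : C) (A B S T : H -> H) (M e : R).

(** Keeps the norm bound explicit, because it becomes the argument of the scalar exponential in the
    error estimates. *)
Definition op_le A M :=
  [/\ linear A, 0 <= M & forall u, l2norm (A u) <= M * l2norm u].

Lemma op_le_bounded A M : op_le A M -> bounded_op A.
Proof. by case=> lA _ AM; split=> //; exists M. Qed.

Lemma op_le_comp A B M N : op_le A M -> op_le B N -> op_le (A \o B) (M * N).
Proof.
move=> [lA M0 AM] [lB N0 BN]; split=> [z u v||u] /=.
- by rewrite lB lA.
- exact: mulr_ge0.
- by apply: le_trans (AM _) _; rewrite -mulrA ler_wpM2l.
Qed.

Lemma op_leD A B M N : op_le A M -> op_le B N -> op_le (A + B) (M + N).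
Proof.
move=> [lA M0 AM] [lB N0 BN]; split=> [z u v||u] /=.
- rewrite -[LHS]/(A (z *: u + v) + B (z *: u + v)) lA lB.
  by rewrite -[RHS]/(z *: (A u + B u) + (A v + B v)) scalerDr addrACA.
- exact: addr_ge0.
- by rewrite mulrDl; apply: le_trans (ler_l2normD _ _) (lerD (AM u) (BN u)).
Qed.

Lemma op_leZ z A M : op_le A M -> op_le (z *: A) (normc z * M).
Proof.
move=> [lA M0 AM]; split=> [y u v||u] /=.
- rewrite -[LHS]/(z *: A (y *: u + v)) -[RHS]/(y *: (z *: A u) + z *: A v).
  by rewrite lA scalerDr !scalerA mulrC.
- by rewrite mulr_ge0 ?normc_ge0.
- by rewrite l2normZ -mulrA ler_wpM2l ?normc_ge0.
Qed.

Lemma op_leB A B M N : op_le A M -> op_le B N -> op_le (A - B) (M + N).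
Proof.
move=> AM BN; have := op_leD AM (op_leZ (-1) BN).
by rewrite scaleN1r normcN normc1 mul1r.
Qed.

Lemma op_le_id : op_le id 1.
Proof. by split=> // u; rewrite mul1r. Qed.

Lemma op_le0 : op_le (fun=> 0) 0.
Proof. by split=> [z u v|//|u]; rewrite ?scaler0 ?addr0 ?l2norm0 ?mul0r. Qed.

Lemma op_le_iter A M k : op_le A M -> op_le (iter k A) (M ^+ k).
Proof.
move=> AM; elim: k => [|k IHk]; first by rewrite expr0; exact: op_le_id.
by rewrite exprS; exact: op_le_comp AM IHk.
Qed.

Lemma le_cvg0_eq0 z (c : R) (e : nat -> R) : (e @ \oo --> 0) ->
  (forall n, normc z <= c * e n) -> z = 0.
Proof.
move=> e0 ze; apply: eq0_normc; apply/eqP; rewrite eq_le normc_ge0 andbT.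
rewrite -(mulr0 c); apply: (cvgr_to_ge (cvgM (cvg_cst c) e0)).
by apply: nearW => n; exact: ze.
Qed.

Lemma l2norm_cvg0_eq u v (c : R) (e : nat -> R) : (e @ \oo --> 0) ->
  (forall n, l2norm (u - v) <= c * e n) -> u = v.
Proof.
move=> e0 uv; apply/subr0_eq/l2norm0P.
rewrite -(mulr0 c); apply: (cvgr_to_ge (cvgM (cvg_cst c) e0)).
by apply: nearW => n; exact: uv.
Qed.

(** [l2_complete] is applied vector by vector with the rate [e n * l2norm u]; linearity survives
    because it holds up to a fixed multiple of [e n] for every [n]. *)
Lemma op_complete (s : nat -> H -> H) (e : nat -> R) : (e @ \oo --> 0) ->
  (forall n, linear (s n)) ->
  (forall m n u, (n <= m)%N -> l2norm (s m u - s n u) <= e n * l2norm u) ->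
  exists T, linear T /\ forall n u, l2norm (T u - s n u) <= e n * l2norm u.
Proof.
move=> e0 ls se.
have /choice[T sT] : forall u, exists v, forall n, l2norm (v - s n u) <= e n * l2norm u.
  move=> u; apply: l2_complete => [|m n nm]; last exact: se.
  by rewrite -[X in _ --> X](mul0r (l2norm u)); apply: cvgM => //; exact: cvg_cst.
exists T; split=> // z u v.
apply: (l2norm_cvg0_eq (c := l2norm (z *: u + v) + normc z * l2norm u + l2norm v) e0).
move=> n; apply: le_trans (ler_l2normB _ _ (s n (z *: u + v))) _.
rewrite !mulrDl -addrA; apply: lerD; first by rewrite mulrC.
rewrite ls opprD addrACA -scalerBr; apply: le_trans (ler_l2normD _ _) _.
rewrite l2normZ; apply: lerD; last by rewrite l2normB mulrC.
by rewrite -mulrA ler_wpM2l ?normc_ge0// l2normB mulrC.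
Qed.

Definition selfadj A := forall u v, inner (A u) v = inner u (A v).

Lemma selfadj_lim (s : nat -> H -> H) T (e : nat -> R) : (e @ \oo --> 0) ->
  (forall n, selfadj (s n)) ->
  (forall n u, l2norm (T u - s n u) <= e n * l2norm u) -> selfadj T.
Proof.
move=> e0 ss sT u v; apply/subr0_eq.
apply: (le_cvg0_eq0 (c := 2 * (l2norm u * l2norm v)) e0) => n.
rewrite (_ : _ - _ = inner (T u - s n u) v - inner u (T v - s n v)); last first.
  by rewrite innerBl innerBr ss opprB addrA subrK.
apply: le_trans (ler_normcD _ _) _; rewrite normcN.
apply: le_trans (lerD (normc_inner_le _ _) (normc_inner_le _ _)) _.
rewrite (_ : 2 * _ * _ = e n * l2norm u * l2norm v + l2norm u * (e n * l2norm v)).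
  by rewrite lerD ?ler_wpM2r ?ler_wpM2l ?l2norm_ge0.
by ring.
Qed.

Lemma inner_inj u v : (forall w, inner u w = inner v w) -> u = v.
Proof.
move=> uv; apply: l2P => x; have := uv (delta R x).
by rewrite innerC inner_delta (innerC _ v) inner_delta => /(can_inj (@conjcK R)).
Qed.

Lemma adjointE A B : (forall u v, inner (B u) v = inner u (A v)) -> adjoint A = B.
Proof.
move=> BA; have : [set B' | forall u v, inner (B' u) v = inner u (A v)] (adjoint A).
  by apply: (xgetPex 0); exists B.
by move=> /= aA; apply/funext => u; apply: inner_inj => v; rewrite aA BA.
Qed.

Lemma selfadjE A : selfadj A -> adjoint A = A.
Proof. exact: adjointE. Qed.

Lemma selfadj_inner_real A u : selfadj A -> complex.Im (inner u (A u)) = 0.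
Proof.
move=> sA; have := innerC u (A u); rewrite sA.
case: (inner u (A u)) => a b [] /=; lra.
Qed.

Lemma selfadjB S T : selfadj S -> selfadj T -> selfadj (S - T).
Proof.
move=> sS sT u v; rewrite -[LHS]/(inner (S u - T u) v) -[RHS]/(inner u (S v - T v)).
by rewrite innerBl innerBr sS sT.
Qed.

Lemma selfadjZ (s : R) T : selfadj T -> selfadj (s%:C *: T).
Proof.
move=> sT u v; rewrite -[LHS]/(inner (s%:C *: T u) v) -[RHS]/(inner u (s%:C *: T v)).
by rewrite innerZl innerZr conjc_real sT.
Qed.

(** * Square root of [T^2] for a bounded self-adjoint [T] *)

Section Modulus.
Variables (T : H -> H) (M : R) (TM : op_le T M) (sT : selfadj T).

(** [c] dominates the squared norm of [T], so [X = 1 - T^2 / c] is a contraction; the [+ 1] keeps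
    [c] invertible when [M] is zero. *)
Let c := M ^+ 2 + 1.
Let X u := u - (c^-1)%:C *: T (T u).

Let c_gt0 : 0 < c. Proof. by have := sqr_ge0 M; rewrite /c; lra. Qed.

(** In the expansion of [||X u||^2] the term [||T (T u)||^2 / c^2] is at most [||T u||^2 / c], half
    of what the cross terms subtract. *)
Let X_le : op_le X 1.
Proof.
have [lT M0 leT] := TM; split=> // [z u v|u].
  by rewrite /X !lT scalerBr !scalerDr !scalerA (mulrC _ z) opprD addrACA.
rewrite mul1r -ler_sqr ?nnegrE ?l2norm_ge0// -lecR -inner_norm.
rewrite innerBl !innerBr !innerZl !innerZr sT !inner_norm conjc_real.
rewrite -sT inner_norm -!rmorphM -!rmorphB lecR/=.
have TT : l2norm (T (T u)) ^+ 2 <= c * l2norm (T u) ^+ 2.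
  apply: (@le_trans _ _ (M ^+ 2 * l2norm (T u) ^+ 2)).
    by rewrite -exprMn ler_sqr ?nnegrE ?mulr_ge0 ?l2norm_ge0.
  by rewrite ler_wpM2r ?sqr_ge0// /c lerDl.
have : c^-1 * (c^-1 * l2norm (T (T u)) ^+ 2) <= c^-1 * l2norm (T u) ^+ 2.
  by rewrite ler_wpM2l ?invr_ge0 ?(ltW c_gt0)// mulrC ler_pdivrMr// mulrC.
have : 0 <= c^-1 * l2norm (T u) ^+ 2.
  by rewrite mulr_ge0 ?sqr_ge0 ?invr_ge0 ?(ltW c_gt0).
lra.
Qed.

Let X_sa : selfadj X.
Proof. by move=> u v; rewrite /X innerBl innerBr innerZl innerZr conjc_real !sT. Qed.

(* [Y n] below converges to the solution of [Y = (X + Y^2) / 2], that is of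
   [(1 - Y)^2 = 1 - X], with increments dominated by those of [sqrt_iter_scal]
   (the case [X = 1]). *)
Fixpoint sqrt_iter_scal (n : nat) : R :=
  if n is m.+1 then (1 + sqrt_iter_scal m ^+ 2) / 2 else 0.
Local Notation y := sqrt_iter_scal.

(** For [d n = 1 - y n] the recursion is [d (n + 1) = d n - (d n)^2 / 2], increasing in [d n] on
    [[0, 1]]; at [d n = 2 / m] its value [2 (m - 1) / m^2] is below [2 / (m + 1)]. *)
Lemma sqrt_iter_scal_bound n : 0 <= 1 - y n <= 2 / n.+2%:R.
Proof.
elim: n => [|n /andP[d0 dn]]; first by rewrite /= subr0 ler01 divff// lexx.
have -> : 1 - y n.+1 = (1 - y n) - (1 - y n) ^+ 2 / 2 by rewrite /=; field.
set d := 1 - y n in d0 dn *; set m := n.+2%:R in dn *.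
have m2 : 2 <= m by rewrite ler_nat.
have m0 : m != 0 by rewrite gt_eqF//; lra.
have m1 : m + 1 != 0 by rewrite gt_eqF//; lra.
have -> : n.+3%:R = m + 1 :> R by rewrite -natr1.
have d1 : d <= 1 by apply: le_trans dn _; rewrite ler_pdivrMr; lra.
clearbody m d; apply/andP; split; first by nra.
apply: (@le_trans _ _ (2 / m - (2 / m) ^+ 2 / 2)).
  rewrite -subr_ge0 (_ : _ - _ = (2 / m - d) * (2 - (2 / m + d)) / 2); last by field; rewrite ?m0 ?m1.
  have m21 : 2 / m <= 1 by rewrite ler_pdivrMr; lra.
  by rewrite divr_ge0 ?mulr_ge0 ?subr_ge0//; move: dn m21; set f := 2 / m; lra.
rewrite -subr_ge0 (_ : _ - _ = 2 / (m ^+ 2 * (m + 1))); last first.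
  by field; rewrite m0 m1.
by rewrite divr_ge0// mulr_ge0 ?sqr_ge0//; lra.
Qed.

Lemma sqrt_iter_scal_cvg : 1 - y n @[n --> \oo] --> (0 : R).
Proof.
have c0 : 2 * (n.+2%:R : R)^-1 @[n --> \oo] --> (0 : R).
  rewrite -[X in _ --> X](mulr0 2); apply: cvgM; first exact: cvg_cst.
  by have := @cvg_harmonic R; rewrite -cvg_shiftS.
by apply: squeeze_cvgr c0; [near=> n; exact: sqrt_iter_scal_bound|exact: cvg_cst].
Unshelve. all: by end_near. Qed.

Lemma sqrt_iter_scal_ge0 n : 0 <= y n.
Proof.
by case: n => //= n; rewrite divr_ge0// addr_ge0// sqr_ge0.
Qed.

Let Y := fix Y (n : nat) : H -> H :=
  if n is m.+1 then fun u => (2^-1)%:C *: (X u + Y m (Y m u)) else fun=> 0.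

Let Y_le n : op_le (Y n) (y n).
Proof.
elim: n => [|n IHn]; first exact: op_le0.
have := op_leZ (2^-1)%:C (op_leD X_le (op_le_comp IHn IHn)).
by rewrite normcR ger0_norm ?invr_ge0// mulrC -expr2.
Qed.

Let Y_sa n : selfadj (Y n).
Proof.
elim: n => [|n IHn] u v /=.
  by rewrite -(scale0r (0 : H)) innerZr innerZl rmorph0 !mul0r.
by rewrite innerZl innerZr conjc_real innerDl innerDr X_sa !IHn.
Qed.

Let Y_step n u : l2norm (Y n.+1 u - Y n u) <= (y n.+1 - y n) * l2norm u.
Proof.
elim: n u => [|n IHn] u.
  rewrite /= !subr0 expr0n addr0 addr0 mul1r l2normZ normcR ger0_norm ?invr_ge0//.
  by rewrite ler_wpM2l ?invr_ge0//; have [_ _ /(_ u)] := X_le; rewrite mul1r.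
(* A difference of squares split without commuting the factors; the scalar recursion satisfies the
   same identity, so the bounds match term by term. *)
have -> : Y n.+2 u - Y n.+1 u = (2^-1)%:C *: (Y n.+1 (Y n.+1 u - Y n u) +
    (Y n.+1 (Y n u) - Y n (Y n u))).
  have [lY _ _] := Y_le n.+1.
  rewrite (linB lY) addrA subrK [LHS]/= -scalerBr; congr (_ *: _).
  by rewrite opprD addrACA subrr add0r.
rewrite l2normZ normcR ger0_norm ?invr_ge0//.
have -> : y n.+2 - y n.+1 = 2^-1 * ((y n.+1 + y n) * (y n.+1 - y n)).
  rewrite -[LHS]/((1 + y n.+1 ^+ 2) / 2 - (1 + y n ^+ 2) / 2).
  by move: (y n.+1) => yS; field.
rewrite -mulrA ler_wpM2l ?invr_ge0//.
apply: le_trans (ler_l2normD _ _) _; rewrite mulrDl mulrDl; apply: lerD.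
  have [_ _ leY] := Y_le n.+1; apply: le_trans (leY _) _.
  by rewrite -mulrA ler_wpM2l ?sqrt_iter_scal_ge0.
apply: le_trans (IHn _) _.
have y1 : 0 <= y n.+1 - y n.
  have /andP[d0 d2] := sqrt_iter_scal_bound n.
  by rewrite (_ : _ - _ = (1 - y n) ^+ 2 / 2) ?divr_ge0 ?sqr_ge0//=; field.
rewrite [leRHS](_ : _ = (y n.+1 - y n) * (y n * l2norm u)); last by ring.
by rewrite ler_wpM2l//; have [_ _] := Y_le n.
Qed.

Let Y_dist m n u : (n <= m)%N -> l2norm (Y m u - Y n u) <= (1 - y n) * l2norm u.
Proof.
move=> nm; apply: (@le_trans _ _ ((y m - y n) * l2norm u)); last first.
  rewrite ler_wpM2r ?l2norm_ge0// lerB//.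
  by have /andP[] := sqrt_iter_scal_bound m; lra.
elim: m nm => [|m IHm].
  by rewrite leqn0 => /eqP ->; rewrite !subrr l2norm0 mul0r.
rewrite leq_eqVlt => /predU1P[->|nm]; first by rewrite !subrr l2norm0 mul0r.
apply: le_trans (ler_l2normB _ _ (Y m u)) _.
apply: le_trans (lerD (Y_step _ _) (IHm nm)) _.
by rewrite -mulrDl addrA subrK.
Qed.

Lemma modulus_exists : exists S, is_modulus T S /\ forall u, l2norm (S u) = l2norm (T u).
Proof.
have [Z [lZ ZY]] := op_complete sqrt_iter_scal_cvg (fun n => let: And3 l _ _ := Y_le n in l) Y_dist.
have sZ := selfadj_lim sqrt_iter_scal_cvg Y_sa ZY.
have Z_le u : l2norm (Z u) <= l2norm u.
  have := ler_l2normD (Z u - Y 0 u) (Y 0 u); rewrite subrK => /le_trans; apply.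
  by apply: le_trans (lerD (ZY 0%N u) (lexx _)) _; rewrite /= l2norm0 addr0 subr0 mul1r.
(* The recursion in the limit: [Z] is compared with [Y n.+1], and [Z Z] with [Y n Y n] by changing
   one factor at a time. *)
have ZE u : Z u = (2^-1)%:C *: (X u + Z (Z u)).
  apply: (l2norm_cvg0_eq (c := 4 * l2norm u) sqrt_iter_scal_cvg) => n.
  have /andP[d0 d1] := sqrt_iter_scal_bound n.
  have y01 := sqrt_iter_scal_ge0 n.
  apply: le_trans (ler_l2normB _ _ (Y n.+1 u)) _.
  have dS : 1 - y n.+1 <= 1 - y n.
    rewrite -subr_ge0 (_ : _ - _ = (1 - y n) ^+ 2 / 2) ?divr_ge0 ?sqr_ge0//=.
    by field.
  apply: (@le_trans _ _ ((1 - y n) * l2norm u + 2^-1 * ((1 - y n) * l2norm u + (1 - y n) * l2norm u))).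
    apply: lerD.
      by apply: le_trans (ZY _ _) _; rewrite ler_wpM2r ?l2norm_ge0.
    rewrite [X in l2norm X](_ : _ = (2^-1)%:C *: (Y n (Y n u - Z u) + (Y n (Z u) - Z (Z u)))).
      rewrite l2normZ normcR ger0_norm ?invr_ge0// ler_wpM2l ?invr_ge0//.
      apply: le_trans (ler_l2normD _ _) _; apply: lerD.
        have [_ _ leY] := Y_le n; apply: le_trans (leY _) _.
        rewrite l2normB; apply: le_trans (ler_wpM2l y01 (ZY _ _)) _.
        rewrite ler_piMl ?mulr_ge0 ?l2norm_ge0//; lra.
      rewrite l2normB; apply: le_trans (ZY _ _) _.
      by rewrite ler_wpM2l.
    have [lY _ _] := Y_le n; rewrite (linB lY) addrA subrK [LHS]/= -scalerBr.
    by congr (_ *: _); rewrite opprD addrACA subrr add0r.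
  have := l2norm_ge0 u; nra.
(* The fixed point equation says [(1 - Z)^2 = 1 - X = T^2 / c], whence the factor [sqrt c]. *)
pose r := Num.sqrt c; pose S u := r%:C *: (u - Z u).
have sS : selfadj S.
  by move=> u v; rewrite /S innerZl innerZr conjc_real innerBl innerBr sZ.
have lS : linear S.
  move=> z u v; rewrite /S lZ opprD addrACA -scalerBr scalerDr !scalerA.
  by rewrite (mulrC z).
have SS : S \o S = T \o T.
  apply/funext => u; rewrite /S/= (linZ lZ) -scalerBr scalerA.
  rewrite -rmorphM -expr2 sqr_sqrtr ?(ltW c_gt0)// (linB lZ).
  have ZZ : Z (Z u) = 2 *: Z u - X u.
    rewrite [in 2 *: Z u]ZE scalerA (_ : 2 * _ = 1) ?scale1r ?[X u + _]addrC ?addrK//.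
    by rewrite -(rmorph_nat (real_complex R)) -rmorphM mulfV.
  rewrite ZZ /X scaler_nat mulr2n.
  rewrite (_ : _ - _ = (c^-1)%:C *: T (T u)); last first.
    by rewrite !opprB; apply: l2P => x; rewrite !(l2D, l2N, l2B, l2Z); ring.
  by rewrite scalerA -rmorphM mulfV ?scale1r ?gt_eqF.
exists S; split; last first.
  move=> u; apply/eqP; rewrite -(@eqrXn2 _ 2%N) ?l2norm_ge0//.
  apply/eqP/complexI; rewrite -!inner_norm sS sT.
  by have := congr1 (fun f => inner u (f u)) SS; rewrite /= => ->.
split; last by rewrite SS selfadjE.
  split=> //; exists (r * 2) => u; rewrite /S l2normZ normcR ger0_norm ?sqrtr_ge0//.
  rewrite -mulrA ler_wpM2l ?sqrtr_ge0//; apply: le_trans (ler_l2normD _ _) _.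
  by rewrite l2normN; have := Z_le u; lra.
(* Positivity: [<u, Z u>] is real, and at most [||u||^2] because [Z] is a contraction. *)
move=> u; rewrite lecE selfadj_inner_real// eqxx/= /S innerZr innerBr inner_norm.
have := selfadj_inner_real u sZ; have := normc_Re (inner u (Z u)).
have := normc_inner_le u (Z u); case: (inner u (Z u)) => s i /= sle sn i0.
rewrite i0 mul0r subr0 mulr_ge0 ?sqrtr_ge0// subr_ge0.
apply: le_trans (ler_norm _) _; apply: le_trans sn _; apply: le_trans sle _.
by rewrite expr2 ler_wpM2l ?l2norm_ge0.
Qed.

End Modulus.

(* [<d, |T| d> <= || |T| d || = || T d ||] for a unit vector [d] *)
Lemma trace_classP T M : op_le T M -> selfadj T ->
  absummable (fun x => l2norm (T (delta R x))) -> trace_class T.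
Proof.
move=> TM sT Ts; split; first exact: op_le_bounded TM.
have [S [mS ST]] := modulus_exists TM sT; exists S; split=> //.
apply/absummableP; apply: absummable_dom Ts => x.
rewrite inner_delta; apply: le_trans (normc_Re _) _.
rewrite -ST ger0_norm ?l2norm_ge0//; exact: normc_le_l2norm.
Qed.

End Operators.

(** * The operator exponential *)

Section Exponential.
Variable R : realType.
Local Notation C := R[i].
Local Notation H := (l2 R).
Implicit Types (u v w : H) (A : H -> H) (M : R).

Definition exp_sum A n u : H := \sum_(k < n) ((k`!%:R)^-1 : C) *: iter k A u.

(** The remainder of the scalar series, used as the common rate of convergence of truncations,
    uniformly in the vector and later in the window. *)
Definition exp_tail M n : R := expR M - series (exp_coeff M) n.

Lemma exp_tail_cvg M : exp_tail M n @[n --> \oo] --> 0.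
Proof.
rewrite -(subrr (expR M)); apply: cvgB; first exact: cvg_cst.
exact: is_cvg_series_exp_coeff.
Qed.

Lemma exp_tail_dist M m n : 0 <= M -> (n <= m)%N ->
  \sum_(n <= k < m) M ^+ k / k`!%:R <= exp_tail M n.
Proof.
move=> M0 nm.
have nd : {homo series (exp_coeff M) : i j / (i <= j)%N >-> i <= j}.
  apply/nondecreasing_seqP => k; rewrite seriesSr lerDl.
  by rewrite divr_ge0 ?exprn_ge0.
have := nondecreasing_cvgn_le nd (is_cvg_series_exp_coeff M) m.
have := sub_series_geq (exp_coeff M) nm; rewrite /exp_tail -/(expR M) /expR.
by move=> <- ?; rewrite lerB.
Qed.

Lemma op_leM A M u : op_le A M -> l2norm (A u) <= M * l2norm u.
Proof. by case. Qed.

Lemma linear_exp_sum A n : linear A -> linear (exp_sum A n).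
Proof.
move=> lA z u v; rewrite /exp_sum scaler_sumr -big_split; apply: eq_bigr => k _.
rewrite /= (_ : iter k A (z *: u + v) = z *: iter k A u + iter k A v).
  by rewrite scalerDr !scalerA mulrC.
by elim: (nat_of_ord k) => //= j ->; rewrite lA.
Qed.

Lemma exp_sum_dist A M m n u : op_le A M -> (n <= m)%N ->
  l2norm (exp_sum A m u - exp_sum A n u) <= exp_tail M n * l2norm u.
Proof.
move=> AM nm; have [lA M0 _] := AM.
apply: (@le_trans _ _ ((\sum_(n <= k < m) M ^+ k / k`!%:R) * l2norm u)).
  rewrite /exp_sum -!(big_mkord xpredT (fun k => (k`!%:R^-1 : C) *: iter k A u)).
  rewrite (@big_cat_nat _ _ _ n 0 m)//= addrAC subrr add0r.
  apply: le_trans (ler_l2norm_sum _ _ _) _; rewrite mulr_suml.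
  apply: ler_sum => k _; rewrite l2normZ normcV -(rmorph_nat (real_complex R)).
  rewrite normcR normr_nat mulrC mulrAC ler_wpM2r ?invr_ge0//.
  exact: op_leM (op_le_iter k AM).
by rewrite ler_wpM2r ?l2norm_ge0// exp_tail_dist.
Qed.

Lemma opexpP A M : op_le A M -> linear (opexp A) /\
  forall n u, l2norm (opexp A u - exp_sum A n u) <= exp_tail M n * l2norm u.
Proof.
move=> AM; have [lA M0 _] := AM.
have [E [lE EA]] := op_complete (@exp_tail_cvg M) (fun n => linear_exp_sum n lA)
  (fun m n u nm => exp_sum_dist u AM nm).
have bE : is_opexp A E.
  split=> [|e e0].
    split=> //; exists (exp_tail M 0) => u.
    by have := EA 0%N u; rewrite /exp_sum big_ord0 subr0.
  have /cvgrPdist_le/(_ e e0) := @exp_tail_cvg M; apply: filterS => n en u.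
  apply: le_trans (EA n u) _; rewrite ler_wpM2r ?l2norm_ge0//.
  by apply: le_trans en; rewrite sub0r normrN ler_norm.
have [[lE' _] E'A] : is_opexp A (opexp A) by apply: (xgetPex 0); exists E.
suff -> : opexp A = E by [].
(* [opexp] is a chosen operator; it is identified with [E] because both are close to one and the
   same partial sum. *)
apply/funext => u; apply: (l2norm_cvg0_eq (c := 2 * l2norm u) (@cvg_harmonic R)).
move=> n; have e0 : 0 < harmonic n :> R by rewrite invr_gt0.
have [N _ NE] := filterI (E'A _ e0) (bE.2 _ e0).
have [/(_ u) a /(_ u) b] := NE N (leqnn N).
apply: le_trans (ler_l2normB _ _ (exp_sum A N u)) _.
rewrite [X in _ + X]l2normB; apply: le_trans (lerD a b) _.
by rewrite le_eqVlt; apply/orP; left; apply/eqP; ring.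
Qed.

(** At truncation [0] the partial sum is empty, so the bound is [expR M]. *)
Lemma opexp_le A M : op_le A M -> op_le (opexp A) (exp_tail M 0).
Proof.
move=> AM; have [lE EA] := opexpP AM; split=> // [|u].
  have [_ M0 _] := AM; have := exp_tail_dist M0 (leqnn 0).
  by rewrite big_geq.
by have := EA 0%N u; rewrite /exp_sum big_ord0 subr0.
Qed.

Lemma selfadj_iter A k : selfadj A -> selfadj (iter k A).
Proof. by move=> sA; elim: k => // k IHk u v; rewrite /= sA IHk -iterSr. Qed.

Lemma selfadj_opexp A M : op_le A M -> selfadj A -> selfadj (opexp A).
Proof.
move=> AM sA; have [lE EA] := opexpP AM.
apply: (selfadj_lim (@exp_tail_cvg M)) EA => n u v; rewrite /exp_sum.
have aux (w : H) (F : 'I_n -> H) : inner w (\sum_(k < n) F k) = \sum_(k < n) inner w (F k).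
  elim/big_ind2 : _ => [|a x b y <- <-|//]; last by rewrite innerDr.
  by rewrite -(scale0r (0 : H)) innerZr mul0r.
rewrite (innerC v) !aux rmorph_sum/=; apply: eq_bigr => k _.
rewrite -innerC innerZl innerZr (selfadj_iter _ sA); congr (_ * _).
by rewrite conjc_inv conjc_nat.
Qed.

Lemma ccvg_opexp A M u x : op_le A M -> ccvg (fun n => exp_sum A n u x) (opexp A u x).
Proof.
move=> AM; have [_ EA] := opexpP AM.
apply: (ccvg_squeeze (e := fun n => exp_tail M n * l2norm u)).
  move=> n; rewrite normcB -l2B; apply: le_trans (normc_le_l2norm _ x) (EA n u).
rewrite -[X in _ --> X](mul0r (l2norm u)).
by apply: cvgM; [exact: exp_tail_cvg|exact: cvg_cst].
Qed.

End Exponential.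

(** * Tridiagonal operators *)

Section Tridiagonal.

(** Generic in the ring: it describes both the complex operators and the real matrices left once the
    phases are removed. *)
Definition tri (K : pzRingType) (a b c : int -> K) (u : int -> K) (x : int) : K :=
  a x * u (x + 1) + b x * u x + c x * u (x - 1).

Variable R : realType.
Local Notation C := R[i].
Local Notation H := (l2 R).
Implicit Types (u v w : H) (A T : H -> H) (a b c : int -> C).

Definition triop a b c : H -> H := seq_op (tri a b c).

Definition coef_le (k : R) a b c :=
  forall x, [/\ normc (a x) <= k, normc (b x) <= k & normc (c x) <= k].

Lemma normc_tri k a b c (f : int -> C) x : coef_le k a b c ->
  normc (tri a b c f x) <= k * (normc (f (x + 1)) + normc (f x) + normc (f (x - 1))).
Proof.
move=> /(_ x)[ka kb kc]; rewrite /tri !mulrDr.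
apply: le_trans (ler_normcD _ _) _; apply: lerD.
  by apply: le_trans (ler_normcD _ _) _; apply: lerD; rewrite normcM ler_wpM2r ?normc_ge0.
by rewrite normcM ler_wpM2r ?normc_ge0.
Qed.

Lemma coef_le_ge0 k a b c : coef_le k a b c -> 0 <= k.
Proof. by move=> /(_ 0)[ka _ _]; exact: le_trans (normc_ge0 _) ka. Qed.

Lemma wsum_tri k a b c (f : int -> C) n : coef_le k a b c ->
  wsum (fun x => normc (tri a b c f x)) n <= 3 * k * wsum (fun x => normc (f x)) n.+1.
Proof.
move=> abc; have k0 := coef_le_ge0 abc.
pose F x := normc (f x); have F0 x : 0 <= F x by exact: normc_ge0.
apply: (@le_trans _ _ (wsum (fun x => k * (F (x + 1) + F x + F (x - 1))) n)).
  by apply: ler_wsum => x; exact: normc_tri.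
rewrite wsumZ !wsumD (mulrC 3) -mulrA ler_wpM2l//.
have := wsum_shiftr n F0; have := wsum_shiftl n F0; have := wsum_homo F0 (leqnSn n).
by rewrite -/F; lra.
Qed.

Lemma wsum_tri_sq k a b c u n : coef_le k a b c ->
  wsum (fun x => normc (tri a b c u x) ^+ 2) n <= (3 * k * l2norm u) ^+ 2.
Proof.
move=> abc; have k0 := coef_le_ge0 abc.
pose F x := normc (u x) ^+ 2; have F0 x : 0 <= F x by exact: sqr_ge0.
apply: (@le_trans _ _ (wsum (fun x => 3 * k ^+ 2 * (F (x + 1) + F x + F (x - 1))) n)).
  apply: ler_wsum => x.
  apply: (@le_trans _ _ ((k * (normc (u (x + 1)) + normc (u x) + normc (u (x - 1)))) ^+ 2)).
    by rewrite ler_sqr ?nnegrE ?mulr_ge0 ?addr_ge0 ?normc_ge0// normc_tri.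
  rewrite exprMn [leRHS](_ : _ = k ^+ 2 * (3 * (F (x + 1) + F x + F (x - 1)))); last by ring.
  rewrite ler_wpM2l ?sqr_ge0// /F.
  move: (normc _) (normc _) (normc _) => p q r.
  have := sqr_ge0 (p - q); have := sqr_ge0 (q - r); have := sqr_ge0 (p - r).
  rewrite !sqrrB !sqrrD mulrDl; lra.
rewrite wsumZ !wsumD (_ : (3 * k * _) ^+ 2 = 3 * k ^+ 2 * (3 * l2norm u ^+ 2)); last by ring.
rewrite ler_wpM2l ?mulr_ge0 ?sqr_ge0//.
have := wsum_shiftr n F0; have := wsum_shiftl n F0; have := wsum_sq_le u n.
by have := wsum_sq_le u n.+1; rewrite -/F; lra.
Qed.

Lemma triopE k a b c u x : coef_le k a b c -> triop a b c u x = tri a b c u x.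
Proof.
move=> abc; rewrite /triop /seq_op insubdK//; apply/l2_memP.
exists ((3 * k * l2norm u) ^+ 2) => n; apply: le_trans (wsum_tri_sq u n abc).
by apply: ler_wsum => y; rewrite ger0_norm ?sqr_ge0.
Qed.

Lemma triop_le k a b c : coef_le k a b c -> op_le (triop a b c) (3 * k).
Proof.
move=> abc; have k0 := coef_le_ge0 abc; split=> [z u v||u].
- apply: l2P => x; rewrite l2D l2Z (triopE _ x abc) (triopE u x abc) (triopE v x abc).
  by rewrite /tri !l2D !l2Z; ring.
- by rewrite mulr_ge0.
- apply: l2norm_le => [|n]; first by rewrite !mulr_ge0 ?l2norm_ge0.
  by under eq_wsum do rewrite (triopE _ _ abc); exact: wsum_tri_sq.
Qed.

Lemma triop_adj k a b c a' b' c' : coef_le k a b c -> coef_le k a' b' c' ->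
  (forall x, [/\ a' x = (c (x + 1))^*%C, b' x = (b x)^*%C & c' (x + 1) = (a x)^*%C]) ->
  forall u v, inner (triop a' b' c' u) v = inner u (triop a b c v).
Proof.
move=> abc abc' E u v; apply/esym/subr0_eq.
apply: ccvg_unique (ccvgB (ccvg_inner _ _) (ccvg_inner _ _)) _.
(* Summation by parts: the two integrands differ by [F x - F (x - 1)], and [F] is summable, so its
   boundary values tend to zero. *)
pose F x := a x * (u x)^*%C * v (x + 1) - c (x + 1) * (u (x + 1))^*%C * v x.
apply: (@ccvg_ext _ (fun n => F (n%:Z - 1) - F (- n%:Z - 1))).
  move=> n; rewrite -wsum_telescope -wsumB; apply: eq_wsum => x.
  rewrite (triopE v x abc) (triopE u x abc') /F /tri subrK.
  have [-> -> _] := E x; have [_ _] := E (x - 1); rewrite subrK => ->.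
  by rewrite !rmorphD !rmorphM/= !conjcK; ring.
have k0 := coef_le_ge0 abc.
have Fs : absummable (fun x => normc (F x)).
  pose G x := normc (u x) ^+ 2 + normc (v x) ^+ 2.
  have Gs : absummable G by apply: absummableD; exact: l2_absummable.
  apply: (@absummable_dom _ _ (fun x => k * (G x + G (x + 1)))) => [x|]; last first.
    apply: absummableZ; apply: absummableD => //; exact: absummable_shiftr.
  rewrite !ger0_norm ?normc_ge0 ?mulr_ge0 ?addr_ge0 ?sqr_ge0//.
  have [ka _ _] := abc x; have [_ _ kc] := abc (x + 1).
  apply: le_trans (ler_normcD _ _) _; rewrite normcN !normcM !normc_conj.
  apply: (@le_trans _ _ (k * (normc (u x) * normc (v (x + 1))) + k * (normc (u (x + 1)) * normc (v x)))).
    by rewrite -!mulrA lerD// ler_wpM2r ?mulr_ge0 ?normc_ge0.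
  rewrite -mulrDr ler_wpM2l// /G; move: (normc _) (normc _) (normc _) (normc _) => p q r s.
  have := sqr_ge0 (p - q); have := sqr_ge0 (r - s).
  have := sqr_ge0 p; have := sqr_ge0 q; have := sqr_ge0 r; have := sqr_ge0 s.
  rewrite !sqrrB; lra.
have [F1 F2] := absummable_boundary Fs.
rewrite -(subrr 0); apply: ccvgB; rewrite /ccvg.
  by under eq_cvg do rewrite subr0.
by under eq_cvg do rewrite subr0.
Qed.

End Tridiagonal.

(** * Summable entries and trace class *)

Section Entries.
Variable R : realType.
Local Notation C := R[i].
Local Notation H := (l2 R).
Implicit Types (u v w : H) (A T : H -> H) (a b c : int -> C).

(** The l1 size of the matrix of [T]. The row and column windows are independent because a
    tridiagonal factor on the left enlarges the first and one on the right enlarges the second. *)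
Definition entry_le T (m : R) := forall k n,
  wsum (fun y => wsum (fun x => normc (T (delta R y) x)) k) n <= m.

Lemma entry_le_ge0 T m : entry_le T m -> 0 <= m.
Proof. by move=> /(_ 0%N 0%N); rewrite /wsum big_ord0. Qed.

Lemma entry_leW T m m' : m <= m' -> entry_le T m -> entry_le T m'.
Proof. by move=> mm Tm k n; exact: le_trans (Tm k n) mm. Qed.

Lemma entry_leD S T m m' : entry_le S m -> entry_le T m' -> entry_le (S + T) (m + m').
Proof.
move=> Sm Tm k n; apply: le_trans (lerD (Sm k n) (Tm k n)).
rewrite -wsumD; apply: ler_wsum => y; rewrite -wsumD; apply: ler_wsum => x.
exact: ler_normcD.
Qed.

Lemma entry_leZ z T m : entry_le T m -> entry_le (z *: T) (normc z * m).
Proof.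
move=> Tm k n; under eq_wsum => y.
  rewrite (@eq_wsum _ _ (fun x => normc z * normc (T (delta R y) x))).
    rewrite wsumZ; over.
  by move=> x; rewrite -normcM.
by rewrite wsumZ ler_wpM2l ?normc_ge0.
Qed.

Lemma entry_le0 : entry_le (0 : H -> H) 0.
Proof.
have w0 j : wsum (fun=> 0 : R) j = 0.
  by rewrite /wsum big1// => i _; rewrite addr0.
move=> k n; rewrite (@eq_wsum _ _ (fun=> 0)) ?w0// => y.
rewrite (@eq_wsum _ _ (fun=> 0)) ?w0// => x.
exact: normc0.
Qed.

Lemma entry_le_sum (n : nat) (F : nat -> H -> H) (m : nat -> R) :
  (forall k, entry_le (F k) (m k)) ->
  entry_le (\sum_(k < n) F k) (\sum_(k < n) m k).
Proof.
move=> Fm; elim: n => [|n IHn]; first by rewrite !big_ord0; exact: entry_le0.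
by rewrite !big_ord_recr; exact: entry_leD.
Qed.

Lemma entry_le_compl k a b c T m : coef_le k a b c ->
  entry_le T m -> entry_le (triop a b c \o T) (3 * k * m).
Proof.
move=> abc Tm i n; have k0 := coef_le_ge0 abc.
apply: (@le_trans _ _ (wsum (fun y => 3 * k * wsum (fun x => normc (T (delta R y) x)) i.+1) n)).
  apply: ler_wsum => y /=; under eq_wsum do rewrite (triopE _ _ abc).
  exact: wsum_tri.
by rewrite wsumZ ler_wpM2l ?mulr_ge0.
Qed.

Lemma triop_delta k a b c y : coef_le k a b c ->
  triop a b c (delta R y) = a (y - 1) *: delta R (y - 1) + b y *: delta R y +
    c (y + 1) *: delta R (y + 1).
Proof.
move=> abc; apply: l2P => x; rewrite (triopE _ x abc) /tri !l2D !l2Z /=.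
have -> : (x == y - 1) = (x + 1 == y) by apply/eqP/eqP; lia.
have -> : (x == y + 1) = (x - 1 == y) by apply/eqP/eqP; lia.
congr (_ + _ + _).
- by case: eqP => [<-|_]; rewrite ?addrK ?mulr0.
- by case: eqP => [<-|_]; rewrite ?mulr0.
- by case: eqP => [<-|_]; rewrite ?subrK ?mulr0.
Qed.

Lemma entry_le_compr k a b c T m : coef_le k a b c -> linear T ->
  entry_le T m -> entry_le (T \o triop a b c) (3 * k * m).
Proof.
move=> abc lT Tm i n; have k0 := coef_le_ge0 abc.
pose F y := wsum (fun x => normc (T (delta R y) x)) i.
have F0 y : 0 <= F y by apply: wsum_ge0 => x; exact: normc_ge0.
apply: (@le_trans _ _ (wsum (fun y => k * (F (y - 1) + F y + F (y + 1))) n)).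
  apply: ler_wsum => y; rewrite /F -!wsumD -wsumZ; apply: ler_wsum => x /=.
  rewrite (triop_delta y abc) !(linD lT) !(linZ lT) !l2D !l2Z.
  rewrite !mulrDr; apply: le_trans (ler_normcD _ _) _; apply: lerD.
    by apply: le_trans (ler_normcD _ _) _; apply: lerD; rewrite normcM ler_wpM2r ?normc_ge0//;
      [have [] := abc (y - 1)|have [] := abc y].
  by rewrite normcM ler_wpM2r ?normc_ge0//; have [] := abc (y + 1).
rewrite wsumZ !wsumD (mulrC 3) -mulrA ler_wpM2l//.
have := wsum_shiftr n F0; have := wsum_shiftl n F0.
by have := Tm i n; have := Tm i n.+1; rewrite -/F; lra.
Qed.

Lemma entry_le_lim (s : nat -> H -> H) T m : (forall n, entry_le (s n) m) ->
  (forall x y, ccvg (fun n => s n (delta R y) x) (T (delta R y) x)) -> entry_le T m.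
Proof.
move=> sm sT k n.
have H1 : wsum (fun y => wsum (fun x => normc (s j (delta R y) x)) k) n @[j --> \oo]
   --> wsum (fun y => wsum (fun x => normc (T (delta R y) x)) k) n.
  apply: (@wsum_cvg _ (fun j y => wsum (fun x => normc (s j (delta R y) x)) k)) => y.
  apply: (@wsum_cvg _ (fun j x => normc (s j (delta R y) x))) => x.
  exact: ccvg_normc.
by apply: (cvgr_to_le H1); apply: nearW => j; exact: sm.
Qed.

Lemma wsum_sqr_le (f : int -> R) n : (forall x, 0 <= f x) ->
  wsum (fun x => f x ^+ 2) n <= wsum f n ^+ 2.
Proof.
move=> f0; elim: n => [|n IHn]; first by rewrite /wsum !big_ord0 expr0n.
rewrite !wsumS; have := wsum_ge0 n f0; move: (wsum f n) IHn => S IHn S0.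
have := f0 n%:Z; have := f0 (- n.+1%:Z); move: (f _) (f _) => p q p0 q0.
have := mulr_ge0 S0 p0; have := mulr_ge0 S0 q0; have := mulr_ge0 p0 q0.
rewrite !sqrrD; nra.
Qed.

(** The l2 norm of a column is at most its l1 norm, and the l1 norms add up to at most [m]. The row
    window is sent to infinity first, which defines [l]; the bound on the sum over columns then
    passes to that limit. *)
Lemma entry_le_absummable T m : entry_le T m ->
  absummable (fun y => l2norm (T (delta R y))).
Proof.
move=> Tm.
pose F k y := wsum (fun x => normc (T (delta R y) x)) k.
have F0 k y : 0 <= F k y by apply: wsum_ge0 => x; exact: normc_ge0.
have lP : forall y, exists l : R, F k y @[k --> \oo] --> l.
  move=> y; apply/cvg_ex; apply: nondecreasing_is_cvgn.
    by apply/nondecreasing_seqP => k; apply: wsum_homo => // x; exact: normc_ge0.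
  exists m => _ [k _ <-]; have [n] := le_wsum_at y (F0 k).
  by move/le_trans; apply; exact: Tm.
have [l Fl] := choice lP.
have lF y k : F k y <= l y.
  rewrite -(cvg_lim _ (Fl y))//; apply: nondecreasing_cvgn_le.
    by apply/nondecreasing_seqP => j; apply: wsum_homo => // x; exact: normc_ge0.
  by apply: cvgP; exact: Fl.
have l0 y : 0 <= l y by exact: le_trans (F0 0%N y) (lF y 0%N).
exists m => n; apply: (@le_trans _ _ (wsum l n)).
  apply: ler_wsum => y; rewrite ger0_norm ?l2norm_ge0//.
  apply: l2norm_le => // k; apply: (@le_trans _ _ (F k y ^+ 2)).
    by apply: wsum_sqr_le => x; exact: normc_ge0.
  by rewrite ler_sqr ?nnegrE.
have H1 : wsum (F k) n @[k --> \oo] --> wsum l n by exact: wsum_cvg.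
by apply: (cvgr_to_le H1); apply: nearW => k; exact: Tm.
Qed.

(** Once the sums are exchanged, each row meets each diagonal in at most one column, so the total is
    controlled by the sums of the [e d]. *)
Lemma entry_le_band (ds : seq int) (e : int -> int -> R) T :
  (forall d x, 0 <= e d x) -> (forall d, absummable (e d)) ->
  (forall x y, normc (T (delta R y) x) <= \sum_(d <- ds) (y == x + d)%:R * e d x) ->
  exists m, entry_le T m.
Proof.
move=> e0 es Te.
have [m em] := choice es.
exists (\sum_(d <- ds) m d) => k n; rewrite wsum_exchange.
apply: (@le_trans _ _ (\sum_(d <- ds) wsum (e d) k)); last first.
  apply: ler_sum => d _; apply: le_trans (em d k).
  by apply: ler_wsum => x; exact: ler_norm.
rewrite -wsum_sum; apply: ler_wsum => x.
apply: (@le_trans _ _ (wsum (fun y => \sum_(d <- ds) (y == x + d)%:R * e d x) n)).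
  by apply: ler_wsum => y; exact: Te.
rewrite wsum_sum; apply: ler_sum => d _.
by rewrite wsum_delta; case: ifP.
Qed.

(** Composition on the right recombines the columns of [T], which is why it asks for linearity. *)
Definition schur_le A (k : R) := [/\ op_le A k,
  forall T m, entry_le T m -> entry_le (A \o T) (k * m) &
  forall T m, linear T -> entry_le T m -> entry_le (T \o A) (k * m)].

Lemma triop_schur k a b c : coef_le k a b c -> schur_le (triop a b c) (3 * k).
Proof.
move=> abc; split=> [|T m Tm|T m lT Tm]; first exact: triop_le.
  exact: entry_le_compl.
exact: entry_le_compr.
Qed.

(** * From summable entries of the commutator to those of the heat difference *)

Section Heat.
Variables (A A' : H -> H) (k : R).
Hypotheses (k1 : 1 <= k) (sA : schur_le A k) (sA' : schur_le A' k).
Let P := A' \o A.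
Let P' := A \o A'.
Variable m : R.
Hypothesis Dm : entry_le (P - P') m.
Let N := k * k.

Let N1 : 1 <= N.
Proof. by apply: (@le_trans _ _ (1 * 1)); [rewrite mulr1|apply: ler_pM]. Qed.

Let P_le : op_le P N.
Proof. by have [[Ak _ _] [A'k _ _]] := (sA, sA'); exact: op_le_comp. Qed.
Let P'_le : op_le P' N.
Proof. by have [[Ak _ _] [A'k _ _]] := (sA, sA'); exact: op_le_comp. Qed.

Lemma entry_le_iterB j : entry_le (iter j P - iter j P') (j%:R * N ^+ j * m).
Proof.
have m0 := entry_le_ge0 Dm; have lD : linear (P - P') by case: (op_leB P_le P'_le).
have [[[lA _ _] lsA rsA] [[lA' _ _] lsA' rsA']] := (sA, sA').
have Dj i : entry_le ((P - P') \o iter i P') (N ^+ i * m) /\ linear ((P - P') \o iter i P').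
  elim: i => [|i [IHi lI]]; first by rewrite expr0 mul1r.
  have E : (P - P') \o iter i.+1 P' = (((P - P') \o iter i P') \o A) \o A'.
    by apply/funext => u; rewrite /comp iterSr.
  have lIA : linear (((P - P') \o iter i P') \o A).
    exact: lin_comp lI lA.
  rewrite E; split; last exact: lin_comp lIA lA'.
  rewrite exprS [X in entry_le _ X](_ : _ = k * (k * (N ^+ i * m))); last by rewrite /N; ring.
  by apply: rsA' => //; apply: rsA.
elim: j => [|j IHj].
  by rewrite !mul0r (_ : _ - _ = 0); [exact: entry_le0|rewrite subrr].
have -> : iter j.+1 P - iter j.+1 P' = A' \o (A \o (iter j P - iter j P')) + ((P - P') \o iter j P').
  apply/funext => u; rewrite -[LHS]/(P (iter j P u) - P' (iter j P' u)).
  rewrite -[RHS]/(P (iter j P u - iter j P' u) + (P (iter j P' u) - P' (iter j P' u))).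
  by have [lP _ _] := P_le; rewrite (linB lP) addrA subrK.
(* The two summands cost [N * (j N^j m)] and [N^j m]; as [1 <= N], the second is at most
   [N^(j+1) m], which turns [j] into [j + 1]. *)
apply: (entry_leW (m := k * (k * (j%:R * N ^+ j * m)) + N ^+ j * m)).
  have Nm : 0 <= N ^+ j * m by rewrite mulr_ge0// exprn_ge0// (le_trans ler01 N1).
  rewrite -natr1 exprS.
  rewrite [leRHS](_ : _ = N * (j%:R * N ^+ j * m) + N * (N ^+ j * m)); last by ring.
  rewrite [in leLHS](_ : k * (k * (j%:R * N ^+ j * m)) = N * (j%:R * N ^+ j * m)); last by rewrite /N; ring.
  by rewrite lerD2l ler_peMl.
apply: entry_leD; last by have [] := Dj j.
by apply: lsA'; apply: lsA.
Qed.

Lemma iter_scale (z : C) (T : H -> H) j u : linear T ->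
  iter j (z *: T) u = z ^+ j *: iter j T u.
Proof.
move=> lT; elim: j => [|j IHj]; first by rewrite expr0 scale1r.
rewrite iterS IHj; rewrite -[LHS]/(z *: T (z ^+ j *: iter j T u)).
by rewrite (linZ lT) scalerA -exprS.
Qed.

Lemma entry_le_heat (t : R) : exists m',
  entry_le (opexp ((- t)%:C *: P) - opexp ((- t)%:C *: P')) m'.
Proof.
have m0 := entry_le_ge0 Dm.
have [[lP _ _] [lP' _ _]] := (P_le, P'_le).
(* The factor [j] from [entry_le_iterB] is absorbed by [j <= 2^j], whence the [2] in the
   exponent. *)
exists (expR (2 * `|t| * N) * m).
apply: (@entry_le_lim (fun n => \sum_(j < n)
   ((j`!%:R^-1 : C) * (- t)%:C ^+ j) *: (iter j P - iter j P'))).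
  move=> n; apply: entry_leW (@entry_le_sum n
    (fun j => ((j`!%:R^-1 : C) * (- t)%:C ^+ j) *: (iter j P - iter j P')) _
    (fun j => entry_leZ ((j`!%:R^-1 : C) * (- t)%:C ^+ j) (entry_le_iterB j))).
  apply: (@le_trans _ _ ((\sum_(0 <= j < n) (2 * `|t| * N) ^+ j / j`!%:R) * m)).
    rewrite big_mkord mulr_suml; apply: ler_sum => j _.
    rewrite normcM normcX normcR normrN normcV -(rmorph_nat (real_complex R)).
    rewrite normcR normr_nat mulrA ler_wpM2r// (exprMn _ _ N) (exprMn _ 2).
    rewrite [leRHS](_ : _ = j`!%:R^-1 * `|t| ^+ j * (2 ^+ j * N ^+ j)); last first.
      move: (2 ^+ j) (N ^+ j) (`|t| ^+ j) (j`!%:R^-1) => *; ring.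
    rewrite ler_wpM2l ?mulr_ge0 ?invr_ge0 ?exprn_ge0//.
    rewrite ler_wpM2r ?exprn_ge0 ?(le_trans ler01 N1)//.
    by rewrite -natrX ler_nat ltnW// ltn_expl.
  rewrite ler_wpM2r//; have := @exp_tail_dist R (2 * `|t| * N) n 0 _ (leq0n n).
  have -> : exp_tail (2 * `|t| * N) 0 = expR (2 * `|t| * N).
    by rewrite /exp_tail /series/= big_geq// subr0.
  apply.
  by apply: mulr_ge0; [rewrite mulr_ge0|exact: le_trans ler01 N1].
move=> x y; rewrite -[X in ccvg _ X]/(opexp _ _ _ - opexp _ _ _).
have H1 := ccvg_opexp (delta R y) x (op_leZ (- t)%:C P_le).
have H2 := ccvg_opexp (delta R y) x (op_leZ (- t)%:C P'_le).
apply: ccvg_ext (ccvgB H1 H2) => n.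
rewrite /exp_sum -l2B -sumrB.
rewrite (_ : (\sum_(j < n) _ *: (iter j P - iter j P')) (delta R y) =
  \sum_(j < n) ((j`!%:R^-1 : C) * (- t)%:C ^+ j) *: (iter j P (delta R y) - iter j P' (delta R y))).
  congr (l2_val _ x); apply: eq_bigr => j _.
  by rewrite !iter_scale// scalerBr !scalerA.
by elim/big_ind2 : _ => // f u g v <- <-.
Qed.

End Heat.

End Entries.

(** * Boundary terms *)

Section Flux.
Variable R : realType.
Implicit Types (a b c u v : int -> R) (x y d : int) (K : R).

Definition dirac_seq y : int -> R := fun x => (x == y)%:R.

(** Entry [(x, x + 1)] of the transpose is entry [(x + 1, x)] of the matrix, whence the shifts. *)
Definition trit (a b c : int -> R) : (int -> R) -> int -> R :=
  tri (fun x => c (x + 1)) b (fun x => a (x - 1)).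

Lemma tri_linear a b c : linear (tri a b c : (int -> R) -> int -> R).
Proof.
move=> z u v; apply/funext => x; rewrite -[RHS]/(z * tri a b c u x + tri a b c v x).
by rewrite /tri -![(z *: u + v) _]/(z * u _ + v _); ring.
Qed.

Lemma trit_linear a b c : linear (trit a b c).
Proof. exact: tri_linear. Qed.

Definition odd_pow a b c k := tri a b c \o iter k (trit a b c \o tri a b c).

(** The current across the bond between [x] and [x + 1]: products of the entries of [B^T] and of
    [B (B^T B)^k] on that bond. The diagonal entry of their commutator at [x] is the current on the
    right bond minus the one on the left. *)
Definition flux a b c k x : R :=
  c (x + 1) * odd_pow a b c k (dirac_seq x) (x + 1) -
  a x * odd_pow a b c k (dirac_seq (x + 1)) x.

Lemma trit_dirac a b c x : trit a b c (dirac_seq x) =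
  c x *: dirac_seq (x - 1) + (b x *: dirac_seq x + a x *: dirac_seq (x + 1)).
Proof.
apply/funext => y; rewrite -[RHS]/(c x * _ + (b x * _ + a x * _)) /trit /tri /dirac_seq.
have -> : (y == x - 1) = (y + 1 == x) by apply/eqP/eqP; lia.
have -> : (y == x + 1) = (y - 1 == x) by apply/eqP/eqP; lia.
rewrite -addrA; congr (_ + (_ + _)).
- by case: eqP => [<-|_]; rewrite ?mulr0.
- by case: eqP => [<-|_]; rewrite ?mulr0.
- by case: eqP => [<-|_]; rewrite ?mulr0.
Qed.

(* The diagonal of [B^T, G] with [G = B (B^T B)^k] telescopes, because [B] is
   tridiagonal: only the entries next to the diagonal survive. *)
Lemma flux_telescope a b c k x :
  iter k.+1 (trit a b c \o tri a b c) (dirac_seq x) x -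
  iter k.+1 (tri a b c \o trit a b c) (dirac_seq x) x =
  flux a b c k x - flux a b c k (x - 1).
Proof.
have -> : iter k.+1 (tri a b c \o trit a b c) (dirac_seq x) =
    odd_pow a b c k (trit a b c (dirac_seq x)).
  rewrite iterSr /odd_pow; move: (dirac_seq x) => u.
  rewrite -[(_ \o _) u]/(tri a b c (trit a b c u)); move: (trit a b c u) => {}u.
  by elim: k => //= k ->.
have lG : linear (odd_pow a b c k).
  exact: lin_comp (@tri_linear a b c) (lin_iter k (lin_comp (@trit_linear a b c) (@tri_linear a b c))).
rewrite trit_dirac !(linD lG) !(linZ lG).
rewrite -[iter k.+1 _ _ _]/(trit a b c (odd_pow a b c k (dirac_seq x)) x).
rewrite -[X in _ - X]/(c x * _ + (b x * _ + a x * _)) {1}/trit /tri /flux subrK; ring.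
Qed.

Lemma tri_bound K M a b c u : (forall x, [/\ `|a x| <= K, `|b x| <= K & `|c x| <= K]) ->
  (forall x, `|u x| <= M) -> forall x, `|tri a b c u x| <= 3 * K * M.
Proof.
move=> abc uM x; have [ka kb kc] := abc x; rewrite /tri.
have -> : 3 * K * M = K * M + K * M + K * M by ring.
apply: le_trans (ler_normD _ _) _; apply: lerD.
  by apply: le_trans (ler_normD _ _) _; apply: lerD; rewrite normrM ler_pM.
by rewrite normrM ler_pM.
Qed.

Lemma trit_coef_bound K a b c : (forall x, [/\ `|a x| <= K, `|b x| <= K & `|c x| <= K]) ->
  forall x, [/\ `|c (x + 1)| <= K, `|b x| <= K & `|a (x - 1)| <= K].
Proof.
move=> abc x; have [_ kb _] := abc x; have [ka _ _] := abc (x - 1).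
by have [_ _ kc] := abc (x + 1).
Qed.

Lemma flux_bound K a b c k x : (forall x, [/\ `|a x| <= K, `|b x| <= K & `|c x| <= K]) ->
  `|flux a b c k x| <= (3 * K * (3 * K)) ^+ k.+1.
Proof.
move=> abc; have K0 : 0 <= K by have [ka _ _] := abc 0; exact: le_trans ka.
have G y z : `|odd_pow a b c k (dirac_seq y) z| <= 3 * K * (3 * K * (3 * K)) ^+ k.
  rewrite /odd_pow /comp; apply: tri_bound => // {}z.
  elim: k z => [|k IHk] z; first by rewrite /= expr0 /dirac_seq normr_nat lern1 leq_b1.
  rewrite exprS -mulrA; apply: (tri_bound (trit_coef_bound abc)) => w.
  exact: tri_bound.
have [ka _ _] := abc x; have [_ _ kc] := abc (x + 1).
rewrite /flux; apply: le_trans (ler_normB _ _) _; rewrite !normrM.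
apply: le_trans (lerD (ler_pM _ _ kc (G _ _)) (ler_pM _ _ ka (G _ _))) _ => //.
have : 0 <= (3 * K * (3 * K)) ^+ k by rewrite exprn_ge0 ?mulr_ge0.
rewrite exprS; move: (_ ^+ k) => T T0.
have : 0 <= K * K * T by rewrite !mulr_ge0.
lra.
Qed.

(** All offsets [d] are included because a flux of order [k] reads the coefficients up to a distance
    growing with [k]. *)
Definition cvg_along (s : nat -> int) a (l : R) :=
  forall d, a (s n + d) @[n --> \oo] --> l.

Lemma tri_cvg (s : nat -> int) a b c (a1 b1 c1 : R) (u : nat -> int -> R) v :
  cvg_along s a a1 -> cvg_along s b b1 -> cvg_along s c c1 ->
  (forall d, u n (s n + d) @[n --> \oo] --> v d) ->
  forall d, tri a b c (u n) (s n + d) @[n --> \oo] -->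
    tri (fun=> a1) (fun=> b1) (fun=> c1) v d.
Proof.
move=> sa sb sc uv d; rewrite /tri; apply: cvgD; last first.
  by apply: cvgM; [exact: sc|under eq_cvg do rewrite -addrA; exact: uv].
apply: cvgD; last by apply: cvgM; [exact: sb|exact: uv].
by apply: cvgM; [exact: sa|under eq_cvg do rewrite -addrA; exact: uv].
Qed.

Lemma cvg_along_shift s a l e : cvg_along s a l -> cvg_along s (fun x => a (x + e)) l.
Proof. by move=> sa d; under eq_cvg do rewrite -addrA; exact: sa. Qed.

(** A flux of given order is a polynomial in finitely many coefficients near [s n]; after recentring
    at [s n] each of them tends to its constant. *)
Lemma flux_cvg (s : nat -> int) a b c (a1 b1 c1 : R) k :
  cvg_along s a a1 -> cvg_along s b b1 -> cvg_along s c c1 ->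
  flux a b c k (s n) @[n --> \oo] --> flux (fun=> a1) (fun=> b1) (fun=> c1) k 0.
Proof.
move=> sa sb sc.
have G e d : odd_pow a b c k (dirac_seq (s n + e)) (s n + d) @[n --> \oo] -->
    odd_pow (fun=> a1) (fun=> b1) (fun=> c1) k (dirac_seq e) d.
  rewrite /odd_pow /comp; apply: tri_cvg => // {}d.
  elim: k d => [|k IHk] d /=.
    under eq_cvg do rewrite /dirac_seq (inj_eq (addrI _)).
    exact: cvg_cst.
  apply: tri_cvg => //; [exact: cvg_along_shift|exact: cvg_along_shift|].
  exact: tri_cvg.
rewrite /flux add0r; apply: cvgB; apply: cvgM.
- exact: sc.
- by have := G 0 1; under eq_cvg do rewrite addr0.
- by have := sa 0; under eq_cvg do rewrite addr0.
- by have := G 1 0; under eq_cvg do rewrite addr0.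
Qed.

End Flux.

(** * Exponential series of scalar sequences, and exchange of limits *)

Section ExpSums.
Variable R : realType.
Implicit Types (x y : nat -> R) (t L c : R).

Definition exp_psum t x n : R := \sum_(j < n) (- t) ^+ j / j`!%:R * x j.

Lemma normc_realB (x y : R) : normc (x%:C - y%:C) = `|x - y|.
Proof. by rewrite -rmorphB normcR. Qed.

Lemma real_cauchy (s e : nat -> R) : (e @ \oo --> 0) ->
  (forall m n, (n <= m)%N -> `|s m - s n| <= e n) ->
  exists l, forall n, `|l - s n| <= e n.
Proof.
move=> e0 se; have [z sz] : exists z, ccvg (fun n => (s n)%:C) z.
  apply: ccvg_cauchy e0 _ => m n nm.
  by rewrite [normc _](normc_realB (s m) (s n)); exact: se.
exists (complex.Re z) => n.
have c : normc ((s m)%:C - (s n)%:C) @[m --> \oo] --> normc (z - (s n)%:C).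
  exact: ccvg_normc (ccvgB sz (ccvg_cst _)).
apply: le_trans (_ : _ <= normc (z - (s n)%:C)) _.
  by apply: le_trans (normc_Re _); rewrite raddfB/=.
apply: (cvgr_to_le c); exists n => // m nm.
by rewrite [normc _](normc_realB (s m) (s n)) se.
Qed.

(** The truncation error [e n] is uniform in [N], so one fixed truncation reduces the limit to that
    of a finite sum. *)
Lemma tannery (f : nat -> nat -> R) (l e F : nat -> R) (P : R) : (e @ \oo --> 0) ->
  (forall j, f j n @[n --> \oo] --> l j) ->
  (forall N n, `|F N - \sum_(j < n) f j N| <= e n) ->
  (forall n, `|P - \sum_(j < n) l j| <= e n) ->
  F @ \oo --> P.
Proof.
move=> e0 fl Ff Pl; apply/cvgrPdist_le => d d0.
have d3 : 0 < d / 3 by rewrite divr_gt0.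
move/cvgrPdist_le : (e0) => /(_ _ d3)[n _ /(_ n (leqnn n))].
rewrite sub0r normrN => en.
have : \sum_(j < n) f j N @[N --> \oo] --> \sum_(j < n) l j.
  by elim: n {en} => [|n IHn]; [under eq_cvg do rewrite big_ord0; rewrite big_ord0; exact: cvg_cst|
   under eq_cvg do rewrite big_ord_recr; rewrite big_ord_recr; exact: cvgD].
move=> /cvgrPdist_le/(_ _ d3); apply: filterS => N HN.
have := Ff N n; have := Pl n; move: HN; have := le_trans (ler_norm _) en.
move: (\sum_(j < n) f j N) (\sum_(j < n) l j) => S S' e3.
rewrite !ler_norml => /andP[? ?] /andP[? ?] /andP[? ?].
by apply/andP; split; lra.
Qed.

Lemma exp_psum_dist t x c L m n : 0 <= L -> (forall j, `|x j| <= c * L ^+ j) -> (n <= m)%N ->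
  `|exp_psum t x m - exp_psum t x n| <= c * exp_tail (`|t| * L) n.
Proof.
move=> L0 xL nm; rewrite /exp_psum -!(big_mkord xpredT (fun j => (- t) ^+ j / j`!%:R * x j)).
rewrite (@big_cat_nat _ _ _ n 0 m)//= addrAC subrr add0r.
have c0 : 0 <= c by have := xL 0%N; rewrite expr0 mulr1; exact: le_trans.
apply: le_trans (ler_norm_sum _ _ _) _.
apply: le_trans (_ : _ <= c * \sum_(n <= k < m) (`|t| * L) ^+ k / k`!%:R) _; last first.
  by rewrite ler_wpM2l// exp_tail_dist// mulr_ge0.
rewrite mulr_sumr; apply: ler_sum => j _.
rewrite !normrM normfV normr_nat normrX normrN.
apply: le_trans (ler_wpM2l _ (xL j)) _; first by rewrite mulr_ge0 ?invr_ge0 ?exprn_ge0.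
rewrite exprMn le_eqVlt; apply/orP; left; apply/eqP.
by move: (`|t| ^+ j) (L ^+ j) (j`!%:R^-1) => *; ring.
Qed.

Definition exp_series t x : R := limn (exp_psum t x).

Lemma exp_series_dist t x c L n : 0 <= L -> (forall j, `|x j| <= c * L ^+ j) ->
  `|exp_series t x - exp_psum t x n| <= c * exp_tail (`|t| * L) n.
Proof.
move=> L0 xL.
have e0 : c * exp_tail (`|t| * L) n @[n --> \oo] --> 0.
  rewrite -[X in _ --> X](mulr0 c); apply: cvgM; [exact: cvg_cst|exact: exp_tail_cvg].
have [l ls] := real_cauchy e0 (fun m n nm => @exp_psum_dist t x c L m n L0 xL nm).
suff -> : exp_series t x = l by [].
apply/cvg_lim => //; apply/cvg_distP; apply: squeeze_cvgr e0; last exact: cvg_cst.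
by near=> k; rewrite normr_ge0/= distrC ls.
Unshelve. all: by end_near. Qed.

End ExpSums.

(** * Operators that are real up to a gauge *)

Lemma exp_sum_scale_entry (R : realType) (s : R) (T : l2 R -> l2 R) n u x : linear T ->
  exp_sum (s%:C *: T) n u x = \sum_(j < n) (s ^+ j / j`!%:R)%:C * iter j T u x.
Proof.
move=> lT; rewrite /exp_sum l2_sum; apply: eq_bigr => j _.
rewrite l2Z iter_scale// l2Z mulrA; congr (_ * _).
by rewrite mulrC rmorphM rmorphXn fmorphV rmorph_nat.
Qed.

Section Gauge.
Variable R : realType.
Local Notation C := R[i].
Local Notation H := (l2 R).
Variables (g : int -> C) (g1 : forall x, normc (g x) = 1).

Let gK x : (g x)^*%C * g x = 1.
Proof. by rewrite conj_mulE g1 expr1n. Qed.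

(** The operator [w g^* B g] with [B] real tridiagonal; on the diagonal the two unimodular factors
    cancel. *)
Definition gauged (w : C) (a b c : int -> R) : H -> H :=
  triop (fun x => w * (g x)^*%C * (a x)%:C * g (x + 1)) (fun x => w * (b x)%:C)
    (fun x => w * (g x)^*%C * (c x)%:C * g (x - 1)).

Definition seq_le (K : R) (a b c : int -> R) :=
  forall x, [/\ `|a x| <= K, `|b x| <= K & `|c x| <= K].

Lemma gauged_coef_le w K a b c : normc w = 1 -> seq_le K a b c ->
  coef_le K (fun x => w * (g x)^*%C * (a x)%:C * g (x + 1)) (fun x => w * (b x)%:C)
    (fun x => w * (g x)^*%C * (c x)%:C * g (x - 1)).
Proof.
move=> w1 abc x; have [ka kb kc] := abc x.
by rewrite !normcM !normc_conj !normcR !g1 w1 !mul1r !mulr1.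
Qed.

(** Vectors [g^* z r] with [r] real keep this form, so the entries of products of the operator and
    its adjoint follow a real recursion. *)
Lemma gauged_step w K a b c (u : H) (z : C) (r : int -> R) :
  normc w = 1 -> seq_le K a b c ->
  (forall x, u x = (g x)^*%C * z * (r x)%:C) ->
  forall x, gauged w a b c u x = (g x)^*%C * (w * z) * (tri a b c r x)%:C.
Proof.
move=> w1 abc ur x; rewrite /gauged (triopE u x (gauged_coef_le w1 abc)) /tri !ur.
rewrite !rmorphD !rmorphM/=.
transitivity (w * (g x)^*%C * (a x)%:C * ((g (x + 1))^*%C * g (x + 1)) * z * (r (x + 1))%:C +
   w * (b x)%:C * (g x)^*%C * z * (r x)%:C +
   w * (g x)^*%C * (c x)%:C * ((g (x - 1))^*%C * g (x - 1)) * z * (r (x - 1))%:C).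
  by ring.
by rewrite !gK; ring.
Qed.

Variables (a b c : int -> R) (K : R).
Hypotheses (K1 : 1 <= K) (abc : seq_le K a b c).

Let abct : seq_le K (fun x => c (x + 1)) b (fun x => a (x - 1)).
Proof. exact: trit_coef_bound. Qed.

Let i1 : normc ('i : C) = 1.
Proof. by rewrite /normc/= expr0n add0r expr1n sqrtr1. Qed.

Let Ni1 : normc (- 'i : C) = 1.
Proof. by rewrite normcN. Qed.

Definition gauged_op : H -> H := gauged 'i a b c.
Definition gauged_opt : H -> H := gauged (- 'i) (fun x => c (x + 1)) b (fun x => a (x - 1)).
Local Notation A := gauged_op.
Local Notation A' := gauged_opt.

Lemma gauged_adj u v : inner (A' u) v = inner u (A v).
Proof.
apply: triop_adj (gauged_coef_le i1 abc) (gauged_coef_le Ni1 abct) _ u v => x.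
have ci : ('i : C)^*%C = - 'i by apply/eqP; rewrite eq_complex /= oppr0 !eqxx.
by rewrite !conjcM !conjcK ci !conjc_real !addrK; split; ring.
Qed.

Lemma gauged_adj' u v : inner (A u) v = inner u (A' v).
Proof. by rewrite innerC -gauged_adj -innerC. Qed.

Lemma gauged_adjoint : adjoint A = A'.
Proof. exact/adjointE/gauged_adj. Qed.

Lemma gauged_op_le : op_le A (3 * K).
Proof. exact: triop_le (gauged_coef_le i1 abc). Qed.

Let A_le : op_le A (3 * K) := gauged_op_le.
Let A'_le : op_le A' (3 * K). Proof. exact: triop_le (gauged_coef_le Ni1 abct). Qed.

Let P_le : op_le (A' \o A) (3 * K * (3 * K)). Proof. exact: op_le_comp. Qed.
Let P'_le : op_le (A \o A') (3 * K * (3 * K)). Proof. exact: op_le_comp. Qed.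

Let P_sa : selfadj (A' \o A).
Proof. by move=> u v; rewrite /= gauged_adj gauged_adj'. Qed.

Let P'_sa : selfadj (A \o A').
Proof. by move=> u v; rewrite /= gauged_adj' gauged_adj. Qed.

Let delta_dirac x y : delta R y x = (g x)^*%C * g y * (dirac_seq R y x)%:C.
Proof.
rewrite /= /dirac_seq; case: eqP => [->|_]; last by rewrite mulr0.
by rewrite gK mul1r.
Qed.

Let iiN1 : - 'i * 'i = 1 :> C.
Proof. by rewrite mulNr -expr2 sqr_i opprK. Qed.

Lemma gauged_iter k x y : iter k (A' \o A) (delta R y) x =
  (g x)^*%C * g y * (iter k (trit a b c \o tri a b c) (dirac_seq R y) x)%:C.
Proof.
elim: k x => [|k IHk] x; first exact: delta_dirac.
rewrite !iterS [LHS](gauged_step Ni1 abct (gauged_step i1 abc IHk)).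
by rewrite [- 'i * _]mulrA iiN1 mul1r.
Qed.

Lemma gauged_iter' k x y : iter k (A \o A') (delta R y) x =
  (g x)^*%C * g y * (iter k (tri a b c \o trit a b c) (dirac_seq R y) x)%:C.
Proof.
elim: k x => [|k IHk] x; first exact: delta_dirac.
rewrite !iterS [LHS](gauged_step i1 abc (gauged_step Ni1 abct IHk)).
by rewrite ['i * _]mulrA (mulrC 'i) iiN1 mul1r.
Qed.

(* [B] being the real matrix, [self_commutator d x] is the entry [(x, x + d)] of [B^T B - B B^T]. *)
Definition self_commutator (d x : int) : R :=
  if d == 2 then c (x + 1) * a (x + 1) - a x * c (x + 2)
  else if d == 1 then c (x + 1) * b (x + 1) + b x * a x - a x * b (x + 1) - b x * c (x + 1)
  else if d == 0 then c (x + 1) ^+ 2 + a (x - 1) ^+ 2 - a x ^+ 2 - c x ^+ 2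
  else if d == - 1 then b x * c x + a (x - 1) * b (x - 1) - b x * a (x - 1) - c x * b (x - 1)
  else if d == - 2 then a (x - 1) * c (x - 1) - c x * a (x - 2)
  else 0.

Hypothesis ss : forall d, absummable (self_commutator d).

Lemma entry_le_self_commutator : exists m, entry_le ((A' \o A) - (A \o A')) m.
Proof.
(* A product of two tridiagonal matrices has five diagonals, listed by their offsets. *)
apply: (@entry_le_band _ [:: 2; 1; 0; -1; -2] (fun d x => `|self_commutator d x|)) => //.
  by move=> d; apply: absummable_dom (ss d) => x; rewrite normr_id.
move=> x y.
have -> : ((A' \o A) - (A \o A')) (delta R y) x = (g x)^*%C * g y *
    (iter 1 (trit a b c \o tri a b c) (dirac_seq R y) x -
     iter 1 (tri a b c \o trit a b c) (dirac_seq R y) x)%:C.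
  apply: etrans (congr2 (fun z w => z - w) (gauged_iter 1 x y) (gauged_iter' 1 x y)) _.
  by rewrite -mulrBr -rmorphB.
rewrite !normcM normc_conj !g1 !mul1r normcR.
rewrite (_ : _ - _ = \sum_(d <- [:: 2; 1; 0; -1; -2]) (y == x + d)%:R * self_commutator d x).
  apply: le_trans (ler_norm_sum _ _ _) _; apply: ler_sum => d _.
  by rewrite normrM normr_nat.
rewrite !big_cons big_nil /self_commutator /= /trit /tri /dirac_seq.
have e2 : x + 1 + 1 = x + 2 by lia.
have e3 : x - 1 - 1 = x - 2 by lia.
rewrite !(subrK, addrK) e2 e3 addr0 ![_ == y]eq_sym; ring.
Qed.

Let K3 : 1 <= 3 * K. Proof. by move: K1; lra. Qed.

Lemma gauged_commutator_trace_class : trace_class (commutator_defect A).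
Proof.
rewrite /commutator_defect gauged_adjoint.
have [m Dm] := entry_le_self_commutator.
exact: trace_classP (op_leB P_le P'_le) (selfadjB P_sa P'_sa) (entry_le_absummable Dm).
Qed.

(** * Trace of the heat difference at a fixed time *)

Section Time.
Variable t : R.
Local Notation X := ((- t)%:C *: (A' \o A) : H -> H).
Local Notation X' := ((- t)%:C *: (A \o A') : H -> H).

Lemma gauged_heat_trace_class : trace_class (heat_difference A t).
Proof.
rewrite /heat_difference gauged_adjoint.
have [m Dm] := entry_le_self_commutator.
have [m' hm] := entry_le_heat K3 (triop_schur (gauged_coef_le i1 abc))
  (triop_schur (gauged_coef_le Ni1 abct)) Dm t.
have Xt := op_leZ (- t)%:C P_le; have X't := op_leZ (- t)%:C P'_le.
have s1 := selfadj_opexp Xt (selfadjZ (- t) P_sa).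
have s2 := selfadj_opexp X't (selfadjZ (- t) P'_sa).
exact: trace_classP (op_leB (opexp_le Xt) (opexp_le X't)) (selfadjB s1 s2) (entry_le_absummable hm).
Qed.

(** The difference of [j]-th powers traced over the window. At [j = 0] both powers are the identity,
    and power [k + 1] corresponds to the flux of order [k]. *)
Definition window_flux (j N : nat) : R := if j is k.+1
  then flux a b c k (N%:Z - 1) - flux a b c k (- N%:Z - 1) else 0.

Let L := 3 * K * (3 * K).

Let L0 : 0 <= L. Proof. by rewrite mulr_ge0//; exact: le_trans K3. Qed.

Lemma window_flux_le j N : `|window_flux j N| <= 2 * L ^+ j.
Proof.
case: j => [|k]; first by rewrite normr0 mulr1.
have f x : `|flux a b c k x| <= L ^+ k.+1 by exact: flux_bound.
by apply: le_trans (ler_normB _ _) _; have := f (N%:Z - 1); have := f (- N%:Z - 1); lra.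
Qed.

(** The window is finite, so its sum commutes with the exponential series: both sides are limits of
    the same partial sums. *)
Lemma gauged_heat_window N :
  wsum (fun x => inner (delta R x) (heat_difference A t (delta R x))) N =
  (exp_series t (window_flux^~ N))%:C.
Proof.
rewrite /heat_difference gauged_adjoint.
have Xt := op_leZ (- t)%:C P_le; have X't := op_leZ (- t)%:C P'_le.
apply: (@ccvg_unique _ (fun n => wsum (fun x => exp_sum X n (delta R x) x -
   exp_sum X' n (delta R x) x) N)).
  have cx x : ccvg (fun n => exp_sum X n (delta R x) x - exp_sum X' n (delta R x) x)
      (inner (delta R x) ((opexp X - opexp X') (delta R x))).
    rewrite inner_delta.
    exact: (ccvgB (ccvg_opexp (delta R x) x Xt) (ccvg_opexp (delta R x) x X't)).
  by rewrite /wsum; apply: ccvg_sum => k _; exact: ccvgD (cx _) (cx _).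
have e0 : 2 * exp_tail (`|t| * L) n @[n --> \oo] --> 0.
  by rewrite -[X in _ --> X](mulr0 2); apply: cvgM; [exact: cvg_cst|exact: exp_tail_cvg].
apply: ccvg_squeeze e0 => n.
suff -> : wsum (fun x => exp_sum X n (delta R x) x - exp_sum X' n (delta R x) x) N =
    (exp_psum t (window_flux^~ N) n)%:C.
  by rewrite normc_realB distrC; apply: exp_series_dist => // j; exact: window_flux_le.
have [lP _ _] := P_le; have [lP' _ _] := P'_le.
have E x : exp_sum X n (delta R x) x - exp_sum X' n (delta R x) x = \sum_(j < n)
    ((- t) ^+ j / j`!%:R * (iter j (trit a b c \o tri a b c) (dirac_seq R x) x -
     iter j (tri a b c \o trit a b c) (dirac_seq R x) x))%:C.
  apply: etrans (congr2 (fun z w => z - w) (exp_sum_scale_entry (- t) n (delta R x) x lP)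
    (exp_sum_scale_entry (- t) n (delta R x) x lP')) _.
  rewrite -sumrB; apply: eq_bigr => j _; rewrite -mulrBr [RHS]rmorphM; congr (_ * _); rewrite rmorphB.
  apply: etrans (congr2 (fun z w => z - w) (gauged_iter j x x) (gauged_iter' j x x)) _.
  by rewrite gK !mul1r.
under eq_wsum do rewrite E.
rewrite wsum_sum /exp_psum rmorph_sum; apply: eq_bigr => j _.
rewrite -(wsum_map (real_complex R)) wsumZ; congr (_ * _)%:C.
case: (nat_of_ord j) => [|k].
  by rewrite /wsum big1// => i _; rewrite !subrr addr0.
under eq_wsum do rewrite flux_telescope.
exact: wsum_telescope.
Qed.

Definition flux_limit (a1 b1 c1 : R) (j : nat) : R :=
  if j is k.+1 then flux (fun=> a1) (fun=> b1) (fun=> c1) k 0 else 0.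

Lemma gauged_witten_ind (al bl cl ar br cr : R) :
  cvg_along (fun n => - n%:Z - 1) a al -> cvg_along (fun n => - n%:Z - 1) b bl ->
  cvg_along (fun n => - n%:Z - 1) c cl ->
  cvg_along (fun n => n%:Z - 1) a ar -> cvg_along (fun n => n%:Z - 1) b br ->
  cvg_along (fun n => n%:Z - 1) c cr ->
  witten_ind A t = (exp_series t (fun j => flux_limit ar br cr j - flux_limit al bl cl j))%:C.
Proof.
move=> sal sbl scl sar sbr scr; apply: zsumE.
apply: ccvg_ext (ccvg_real (_ : (fun N => exp_series t (window_flux^~ N)) @ \oo --> _)).
  by move=> N; rewrite gauged_heat_window.
have e0 : 2 * exp_tail (`|t| * L) n @[n --> \oo] --> 0.
  by rewrite -[X in _ --> X](mulr0 2); apply: cvgM; [exact: cvg_cst|exact: exp_tail_cvg].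
have wl j : window_flux j N @[N --> \oo] --> flux_limit ar br cr j - flux_limit al bl cl j.
  case: j => [|k] /=; first by rewrite subr0; exact: cvg_cst.
  by apply: cvgB; exact: flux_cvg.
apply: (tannery (f := fun j N => (- t) ^+ j / j`!%:R * window_flux j N)
  (l := fun j => (- t) ^+ j / j`!%:R * (flux_limit ar br cr j - flux_limit al bl cl j)) e0).
- by move=> j; apply: cvgM; [exact: cvg_cst|exact: wl].
- by move=> N n; apply: exp_series_dist => // j; exact: window_flux_le.
(* The limits of the fluxes inherit the geometric bound that holds on every window. *)
- move=> n; apply: exp_series_dist => // j.
  by apply: (cvgr_to_le (cvg_norm (wl j))); apply: nearW => N; exact: window_flux_le.
Qed.

End Time.

End Gauge.

(** * Means over roots of unity *)

Section RootsOfUnity.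
Variable R : realType.
Local Notation C := R[i].
Implicit Types (x y t : R).

Lemma expiD x y : expi (x + y) = expi x * expi y.
Proof.
by apply/eqP; rewrite eq_complex /= sinD cosD; apply/andP; split; apply/eqP; ring.
Qed.

Lemma expi0 : expi (0 : R) = 1.
Proof. by rewrite /expi cos0 sin0. Qed.

Lemma expiN x : expi (- x) = (expi x)^*%C.
Proof. by rewrite /expi cosN sinN. Qed.

Lemma normc_expi x : normc (expi x) = 1.
Proof. by rewrite /= cos2Dsin2 sqrtr1. Qed.

Lemma expiX x n : expi x ^+ n = expi (n%:R * x).
Proof.
elim: n => [|n IHn]; first by rewrite mul0r expi0.
by rewrite exprS IHn -expiD -natr1 mulrDl mul1r addrC.
Qed.

Definition angle (N j : nat) : R := 2 * pi * j%:R / N%:R.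

Definition zmean (N : nat) (F : nat -> C) : C := (N%:R)^-1 * \sum_(j < N) F j.

Lemma zmean_expi_nat N n : (0 < n < N)%N ->
  zmean N (fun j => expi (n%:R * angle N j)) = 0.
Proof.
move=> /andP[n0 nN]; have N0 : (N%:R : R) != 0 by rewrite pnatr_eq0; lia.
set w : C := expi (2 * pi * n%:R / N%:R).
have wj j : expi (n%:R * angle N j) = w ^+ j.
  by rewrite expiX; congr expi; rewrite /angle; ring.
have wN : w ^+ N = 1.
  rewrite expiX (_ : _ * _ = n%:R * (2 * pi)); last by field.
  by rewrite -expiX (_ : expi _ = 1) ?expr1n// mulr_natl /expi cos2pi sin2pi.
(* [w = 1] would give [cos (2 y) = 1], hence [sin y = 0], which is impossible for [0 < y < pi]. *)
have w1 : w - 1 != 0.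
  rewrite subr_eq0; apply/eqP => /(congr1 (@complex.Re R)) /=.
  pose y : R := pi * n%:R / N%:R.
  rewrite (_ : 2 * pi * _ / _ = y *+ 2); last by rewrite /y -mulr_natl; ring.
  rewrite cos_mulr2n => c1.
  have s0 : 0 < sin y.
    have Np : (0 : R) < N%:R by rewrite ltr0n; lia.
    apply: sin_gt0_pi; apply/andP; split.
      by rewrite /y divr_gt0 ?mulr_gt0 ?pi_gt0 ?ltr0n//; lia.
    by rewrite /y ltr_pdivrMr// ltr_pM2l ?pi_gt0// ltr_nat.
  have := cos2Dsin2 y; have : 0 < sin y ^+ 2 by rewrite exprn_gt0.
  by move: c1; rewrite -mulr_natr; lra.
rewrite /zmean; under eq_bigr do rewrite wj.
have /eqP : (w - 1) * \sum_(j < N) w ^+ j = 0 by rewrite -subrX1 wN subrr.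
by rewrite mulf_eq0 (negbTE w1) => /eqP ->; rewrite mulr0.
Qed.

Lemma zmeanD N F G : zmean N (fun j => F j + G j) = zmean N F + zmean N G.
Proof. by rewrite /zmean big_split mulrDr. Qed.

Lemma zmeanZ N z F : zmean N (fun j => z * F j) = z * zmean N F.
Proof. by rewrite /zmean -mulr_sumr mulrCA. Qed.

Lemma zmean_sum N n (F : 'I_n -> nat -> C) :
  zmean N (fun j => \sum_(i < n) F i j) = \sum_(i < n) zmean N (F i).
Proof. by rewrite /zmean exchange_big mulr_sumr. Qed.

Lemma eq_zmean N F G : (forall j, F j = G j) -> zmean N F = zmean N G.
Proof. by move=> FG; congr (_ * _); apply: eq_bigr. Qed.

Lemma zmean1 N : (0 < N)%N -> zmean N (fun=> 1) = 1.
Proof.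
move=> N0; rewrite /zmean sumr_const card_ord mulVf// pnatr_eq0; lia.
Qed.

Lemma zmean_expi N (d : int) : (absz d < N)%N ->
  zmean N (fun j => expi (d%:~R * angle N j)) = (d == 0)%:R.
Proof.
move=> dN; case: (intP d) dN => [|n|n] dN.
- by rewrite eqxx -(@zmean1 N)//; apply: eq_zmean => j; rewrite mul0r expi0.
- by rewrite zmean_expi_nat//; lia.
rewrite (_ : (_ == 0) = false)//.
transitivity ((zmean N (fun j => expi (n.+1%:R * angle N j)))^*%C); last first.
  by rewrite zmean_expi_nat ?conjc0//; lia.
rewrite /zmean rmorphM rmorph_sum/= conjc_inv conjc_nat; congr (_ * _).
apply: eq_bigr => j _; rewrite -[RHS]/((expi (n.+1%:R * angle N j))^*%C).
by rewrite -expiN -mulNr mulrNz.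
Qed.

(** Functions of the cosine are enough, because the real parts of the integrands that occur are even
    in the angle. *)
Definition mean (N : nat) (phi : R -> R) : R :=
  N%:R^-1 * \sum_(j < N) phi (cos (angle N j)).

Lemma zmean_Re N F phi : (forall j, complex.Re (F j) = phi (cos (angle N j))) ->
  complex.Re (zmean N F) = mean N phi.
Proof.
move=> Fphi; rewrite /zmean /mean.
rewrite -(rmorph_nat (real_complex R)) -fmorphV.
rewrite (_ : complex.Re _ = N%:R^-1 * complex.Re (\sum_(j < N) F j)); last first.
  by case: (\sum_(j < N) F j) => u v /=; rewrite mul0r subr0.
by rewrite raddf_sum; congr (_ * _); apply: eq_bigr => j _; exact: Fphi.
Qed.

Lemma meanD N phi psi : mean N (fun x => phi x + psi x) = mean N phi + mean N psi.
Proof. by rewrite /mean big_split mulrDr. Qed.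

Lemma meanZ N c phi : mean N (fun x => c * phi x) = c * mean N phi.
Proof. by rewrite /mean -mulr_sumr mulrCA. Qed.

Lemma meanN N phi : mean N (fun x => - phi x) = - mean N phi.
Proof. by rewrite -mulN1r -meanZ; congr (_ * _); apply: eq_bigr => j _; rewrite mulN1r. Qed.

Lemma meanB N phi psi : mean N (fun x => phi x - psi x) = mean N phi - mean N psi.
Proof. by rewrite meanD meanN. Qed.

Lemma mean_sum N n (F : 'I_n -> R -> R) :
  mean N (fun x => \sum_(i < n) F i x) = \sum_(i < n) mean N (F i).
Proof. by rewrite /mean exchange_big mulr_sumr. Qed.

Lemma ler_mean N phi psi : (forall c, -1 <= c <= 1 -> phi c <= psi c) ->
  mean N phi <= mean N psi.
Proof.
move=> le; rewrite ler_wpM2l ?invr_ge0//; apply: ler_sum => j _; apply: le.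
by rewrite cos_geN1 cos_le1.
Qed.

Lemma eq_mean N phi psi : (forall c, -1 <= c <= 1 -> phi c = psi c) ->
  mean N phi = mean N psi.
Proof.
by move=> e; congr (_ * _); apply: eq_bigr => j _; apply: e; rewrite cos_geN1 cos_le1.
Qed.

Lemma mean_norm_le N phi M : 0 <= M -> (forall c, -1 <= c <= 1 -> `|phi c| <= M) ->
  `|mean N phi| <= M.
Proof.
move=> M0 phiM; rewrite normrM ger0_norm ?invr_ge0//.
have [->|N0] := posnP N; first by rewrite invr0 mul0r.
rewrite ler_pdivrMl ?ltr0n//; apply: le_trans (ler_norm_sum _ _ _) _.
apply: le_trans (_ : _ <= \sum_(j < N) M) _.
  by apply: ler_sum => j _; apply: phiM; rewrite cos_geN1 cos_le1.
by rewrite sumr_const card_ord mulr_natl.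
Qed.

(* Poisson kernel: [(1 + r z) / (1 - r z)] is a finite geometric sum up to the
   factor [1 / (1 - r^N)] when [z^N = 1]. *)
Lemma mean_poisson_rho N (r : R) : (0 < N)%N -> `|r| < 1 ->
  mean N (fun c => (1 - r ^+ 2) / (1 - 2 * r * c + r ^+ 2)) = (1 + r ^+ N) / (1 - r ^+ N).
Proof.
move=> N0 r1.
have rN1 : 1 - r ^+ N != 0.
  apply/eqP => /subr0_eq/esym rN; have : `|r| ^+ N < 1 by rewrite exprn_ilt1// -lt0n.
  by rewrite -normrX rN normr1 ltxx.
pose z j := expi (angle N j).
pose T j : C := (1 + r%:C * z j) * \sum_(i < N) (r%:C * z j) ^+ i.
have zX j n : z j ^+ n = expi (n%:R * angle N j) by rewrite expiX.
have zN j : z j ^+ N = 1.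
  rewrite zX (_ : _ * _ = j%:R * (2 * pi)); last first.
    by rewrite /angle; field; rewrite pnatr_eq0; lia.
  by rewrite -expiX (_ : expi _ = 1) ?expr1n// mulr_natl /expi cos2pi sin2pi.
(* The exponents run over [0..N-1] and over [1..N]; orthogonality keeps only [0] and [N], and
   [z^N = 1]. *)
have mT : zmean N T = 1 + (r ^+ N)%:C.
  rewrite (@eq_zmean _ _ (fun j => \sum_(i < N) r%:C ^+ i * expi (i%:Z%:~R * angle N j) +
      \sum_(i < N) r%:C ^+ i.+1 * expi (i.+1%:Z%:~R * angle N j))); last first.
    move=> j; rewrite /T mulrDl mul1r mulr_sumr; congr (_ + _).
      by apply: eq_bigr => i _; rewrite exprMn zX.
    by apply: eq_bigr => i _; rewrite -exprS exprMn zX.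
  rewrite zmeanD !zmean_sum; congr (_ + _).
    case: N N0 {rN1 z T zX zN} => // n _; rewrite big_ord_recl big1 ?addr0.
      by rewrite zmeanZ expr0 mul1r (@zmean_expi _ 0).
    by move=> i _; rewrite zmeanZ zmean_expi ?mulr0//=; have := ltn_ord i; rewrite /bump; lia.
  case: N N0 {rN1 T} z zX zN => // n _ z zX zN; rewrite big_ord_recr big1 ?add0r/=.
    rewrite zmeanZ add0r rmorphXn -[RHS]mulr1; congr (_ * _).
    by rewrite -(@zmean1 n.+1)//; apply: eq_zmean => j; rewrite -(zX j n.+1) zN.
  by move=> i _; rewrite zmeanZ zmean_expi ?mulr0//=; have := ltn_ord i; lia.
have TE j : complex.Re (T j) = (1 - r ^+ N) *
    ((1 - r ^+ 2) / (1 - 2 * r * cos (angle N j) + r ^+ 2)).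
  have : (T j) * (1 - r%:C * z j) * (1 - r%:C * (z j)^*%C) =
      (1 - (r ^+ N)%:C) * ((1 + r%:C * z j) * (1 - r%:C * (z j)^*%C)).
    rewrite /T; set S := \sum_(i < N) _.
    have SE : S * (1 - r%:C * z j) = 1 - (r ^+ N)%:C.
      by rewrite mulrC -opprB mulNr -subrX1 opprB exprMn zN mulr1 rmorphXn.
    transitivity ((1 + r%:C * z j) * (S * (1 - r%:C * z j)) * (1 - r%:C * (z j)^*%C)).
      by ring.
    by rewrite SE; ring.
  have := cos2Dsin2 (angle N j).
  case: (T j) => u v; rewrite /z /expi /=; set c := cos _; set s := sin _ => cs.
  move=> /eqP; rewrite eq_complex /= => /andP[/eqP E _].
  have D0 : 1 - 2 * r * c + r ^+ 2 != 0.
    have : `|r * c| < 1.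
      rewrite normrM; apply: le_lt_trans r1; rewrite ler_piMr//.
      by rewrite ler_norml cos_geN1 cos_le1.
    rewrite ltr_norml => /andP[? rc]; rewrite gt_eqF//.
    have : (r * c) ^+ 2 <= r ^+ 2.
      rewrite exprMn ler_piMr ?sqr_ge0//.
      by have := sqr_ge0 s; lra.
    have : 0 < (1 - r * c) ^+ 2 by rewrite exprn_gt0; lra.
    by rewrite sqrrB; lra.
  apply: (mulIf D0); rewrite -mulrA mulrA -[RHS]mulrA mulfVK//.
  have -> : 1 - 2 * r * c + r ^+ 2 = 1 - 2 * r * c + r ^+ 2 * (c ^+ 2 + s ^+ 2) by rewrite cs mulr1.
  have -> : 1 - r ^+ 2 = 1 - r ^+ 2 * (c ^+ 2 + s ^+ 2) by rewrite cs mulr1.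
  by move: E; move: (r ^+ N) => q E; lra.
have := @zmean_Re N T (fun c => (1 - r ^+ N) * ((1 - r ^+ 2) / (1 - 2 * r * c + r ^+ 2))) TE.
rewrite mT meanZ /= => E.
by apply: (mulfI rN1); rewrite -E mulrCA mulfV ?mulr1.
Qed.


End RootsOfUnity.

(** * Constant coefficients *)

Section PoissonLimit.
Variable R : realType.
Local Notation C := R[i].
Implicit Types (A B t x : R).

Lemma mean_poisson_cvg A B : `|B| < A ->
  mean N (fun c => (A - B * c)^-1) @[N --> \oo] --> (Num.sqrt (A ^+ 2 - B ^+ 2))^-1.
Proof.
move=> BA; have A0 : 0 < A by exact: le_lt_trans BA.
have BA2 : B ^+ 2 < A ^+ 2.
  by rewrite -(real_normK (num_real B)) ltr_sqr ?nnegrE ?normr_ge0// ltW.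
set k := Num.sqrt _; have k0 : 0 < k by rewrite sqrtr_gt0 subr_gt0.
have k2 : k ^+ 2 = A ^+ 2 - B ^+ 2 by rewrite sqr_sqrtr// subr_ge0 ltW.
have Ak : A + k != 0 by rewrite gt_eqF// addr_gt0.
(* The root inside the unit disc of [B r^2 - 2 A r + B], which makes [A - B c] proportional to
   [1 - 2 r c + r^2]; in this form it also covers [B = 0]. *)
pose r := B / (A + k).
have r1 : `|r| < 1.
  rewrite normrM normfV (gtr0_norm (addr_gt0 A0 k0)) ltr_pdivrMr ?addr_gt0// mul1r.
  by apply: lt_trans BA _; rewrite ltrDl.
have rE : r * (A + k) = B by rewrite /r mulfVK.
have rB : r * B = A - k.
  by apply: (mulIf Ak); rewrite mulrAC rE; rewrite -subr_sqr k2; ring.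
have E c : -1 <= c <= 1 ->
    (A - B * c)^-1 = k^-1 * ((1 - r ^+ 2) / (1 - 2 * r * c + r ^+ 2)).
  move=> c1; have D0 : A - B * c != 0.
    have : `|B * c| <= `|B| by rewrite normrM ler_piMr// ler_norml.
    by move=> Bc; rewrite gt_eqF// subr_gt0; apply: le_lt_trans (ler_norm _) (le_lt_trans Bc BA).
  have D : (A + k) * (1 - 2 * r * c + r ^+ 2) = 2 * (A - B * c).
    transitivity (A + k - 2 * (r * (A + k)) * c + r * (r * (A + k))); first by ring.
    by rewrite rE rB; ring.
  have M : (A + k) * (1 - r ^+ 2) = 2 * k.
    transitivity (A + k - r * (r * (A + k))); first by ring.
    by rewrite rE rB; ring.
  have D1 : 1 - 2 * r * c + r ^+ 2 != 0.
    by apply: contraNneq D0 => E0; move: D; rewrite E0 mulr0 => /esym/eqP; rewrite mulf_eq0 pnatr_eq0.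
  have -> : 1 - r ^+ 2 = 2 * k / (A + k) by apply: (mulIf Ak); rewrite mulfVK// mulrC.
  have -> : 1 - 2 * r * c + r ^+ 2 = 2 * (A - B * c) / (A + k) by apply: (mulIf Ak); rewrite mulfVK// mulrC.
  by field; rewrite D0 Ak gt_eqF.
have rN : r ^+ N @[N --> \oo] --> 0 by exact: cvg_expr.
have lim1 : k^-1 * ((1 + r ^+ N) / (1 - r ^+ N)) @[N --> \oo] --> k^-1.
  rewrite -[X in _ --> X](_ : k^-1 * ((1 + 0) / (1 - 0)) = _); last first.
    by rewrite addr0 subr0 divr1 mulr1.
  apply: cvgM; first exact: cvg_cst.
  apply: cvgM; first by apply: cvgD => //; exact: cvg_cst.
  by apply: cvgV; [rewrite subr0 oner_eq0|apply: cvgB => //; exact: cvg_cst].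
apply: cvg_trans lim1; apply: near_eq_cvg; near=> N.
rewrite (eq_mean N E) meanZ mean_poisson_rho//.
by near: N; exact: nbhs_infty_gt.
Unshelve. all: by end_near. Qed.

Definition hat (N : nat) (F : nat -> C) (x : int) : C :=
  zmean N (fun j => F j * expi (x%:~R * angle R N j)).

Definition symbol (N : nat) (a b c : R) (j : nat) : C :=
  a%:C * expi (angle R N j) + b%:C + c%:C * (expi (angle R N j))^*%C.

(** [hat] is [N]-periodic whereas the sequences have finite support, so they are compared only for
    [|x| + l < N], and each use of [tri] costs one site. The condition [k.*2.+2 < N] of
    [flux_limit_mean] comes from here. *)
Lemma hat_tri N l a b c (u : int -> R) F :
  (forall x : int, (absz x + l < N)%N -> (u x)%:C = hat N F x) ->
  forall x : int, (absz x + l.+1 < N)%N ->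
  (tri (fun=> a) (fun=> b) (fun=> c) u x)%:C = hat N (fun j => symbol N a b c j * F j) x.
Proof.
move=> uF x xl; rewrite /tri !rmorphD !rmorphM/= !uF; try lia.
rewrite /hat -!zmeanZ -!zmeanD; apply: eq_zmean => j.
have -> : (x + 1)%:~R = x%:~R + 1 :> R by rewrite intrD.
have -> : (x - 1)%:~R = x%:~R - 1 :> R by rewrite intrB.
by rewrite /symbol mulrDl mulrBl mul1r !expiD expiN; ring.
Qed.

Lemma symbol_conj N a b c j : symbol N c b a j = (symbol N a b c j)^*%C.
Proof. by rewrite /symbol !conjcD !conjcM !conjcK !conjc_real; ring. Qed.

(** The squared modulus of the symbol as a polynomial in the cosine [x], the squared sine being
    eliminated. *)
Definition sqmod_symbol (a b c x : R) : R :=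
  ((a + c) * x + b) ^+ 2 + (a - c) ^+ 2 * (1 - x ^+ 2).

Lemma sqmod_symbolE N a b c j : (symbol N a b c j)^*%C * symbol N a b c j =
  (sqmod_symbol a b c (cos (angle R N j)))%:C.
Proof.
rewrite /symbol /expi /sqmod_symbol; have := cos2Dsin2 (angle R N j).
move: (cos _) (sin _) => x s /(canRL (addKr _)) s2.
apply/eqP; rewrite eq_complex /=; apply/andP; split; apply/eqP; last by ring.
transitivity (((a + c) * x + b) ^+ 2 + (a - c) ^+ 2 * s ^+ 2); first by ring.
by rewrite s2; ring.
Qed.

Lemma hat_odd_pow N l a b c k (u : int -> R) F :
  (forall x : int, (absz x + l < N)%N -> (u x)%:C = hat N F x) ->
  forall x : int, (absz x + (l + k.*2.+1) < N)%N ->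
  (odd_pow (fun=> a) (fun=> b) (fun=> c) k u x)%:C =
  hat N (fun j => (sqmod_symbol a b c (cos (angle R N j)) ^+ k)%:C * (symbol N a b c j * F j)) x.
Proof.
move=> uF.
have it : forall x : int, (absz x + (l + k.*2) < N)%N ->
  (iter k (trit (fun=> a) (fun=> b) (fun=> c) \o tri (fun=> a) (fun=> b) (fun=> c)) u x)%:C =
  hat N (fun j => (sqmod_symbol a b c (cos (angle R N j)) ^+ k)%:C * F j) x.
  elim: k => [|k IHk] x xk.
    rewrite /= uF; last by move: xk; lia.
    by apply: eq_zmean => j; rewrite expr0 mul1r.
  have S1 := hat_tri a b c IHk.
  have := hat_tri c b a S1 => S2.
  rewrite iterS -[LHS]/((tri (fun=> c) (fun=> b) (fun=> a) (tri (fun=> a) (fun=> b) (fun=> c)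
    (iter k (trit (fun=> a) (fun=> b) (fun=> c) \o tri (fun=> a) (fun=> b) (fun=> c)) u)) x)%:C).
  rewrite S2; last by move: xk; lia.
  apply: eq_zmean => j; congr (_ * _).
  rewrite mulrA symbol_conj sqmod_symbolE exprS rmorphM; ring.
move=> x xk; rewrite /odd_pow -[LHS]/((tri (fun=> a) (fun=> b) (fun=> c) (iter k _ u) x)%:C).
rewrite (hat_tri a b c it); last by move: xk; lia.
by apply: eq_zmean => j; congr (_ * _); ring.
Qed.

Lemma flux_limit_mean N a b c k : (k.*2.+2 < N)%N ->
  flux_limit a b c k.+1 =
  mean N (fun x => sqmod_symbol a b c x ^+ k * ((c - a) * ((a + c) + b * x))).
Proof.
move=> kN.
have H0 : forall x : int, (absz x + 0 < N)%N -> (dirac_seq R 0 x)%:C = hat N (fun=> 1) x.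
  move=> x xN; rewrite /hat (@eq_zmean _ _ _ (fun j => expi (x%:~R * angle R N j))).
    by rewrite zmean_expi ?rmorph_nat//; lia.
  by move=> j; rewrite mul1r.
have H1 : forall x : int, (absz x + 1 < N)%N ->
    (dirac_seq R 1 x)%:C = hat N (fun j => (expi (angle R N j))^*%C) x.
  move=> x xN; rewrite /hat (@eq_zmean _ _ _ (fun j => expi ((x - 1)%:~R * angle R N j))).
    by rewrite zmean_expi ?subr_eq0 ?rmorph_nat//; lia.
  move=> j; have -> : (x - 1)%:~R = x%:~R - 1 :> R by rewrite intrB.
  by rewrite mulrBl mul1r expiD expiN mulrC.
have E0 := @hat_odd_pow N 0 a b c k _ _ H0 1; have E1 := @hat_odd_pow N 1 a b c k _ _ H1 0.
(* The flux is real, so only the real part of the integrand counts; the second harmonics contribute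
   only to the imaginary part, and a function of the cosine remains. *)
rewrite -(@zmean_Re R N (fun j => (sqmod_symbol a b c (cos (angle R N j)) ^+ k)%:C *
  (symbol N a b c j * (c%:C * expi (angle R N j) - a%:C * (expi (angle R N j))^*%C)))); last first.
  move=> j; rewrite /symbol /expi; have := cos2Dsin2 (angle R N j).
  move: (cos _) (sin _) => x s /(canRL (addKr _)) s2.
  move: (sqmod_symbol _ _ _ _ ^+ k) => g /=.
  transitivity (g * ((c - a) * ((a + c) * x ^+ 2 + b * x + (a + c) * s ^+ 2))); first by ring.
  by rewrite s2; ring.
rewrite -[LHS]/(complex.Re (flux_limit a b c k.+1)%:C); congr complex.Re.
rewrite /flux_limit /flux add0r rmorphB !rmorphM/= E0 ?E1; try (move: kN; lia).
rewrite /hat -!zmeanZ -mulN1r -zmeanZ -zmeanD; apply: eq_zmean => j.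
by rewrite mul0r expi0 mul1r -[cos _ -i* sin _]/((expi (angle R N j))^*%C); ring.
Qed.

End PoissonLimit.

(** * The limit of large times *)

Section HeatLimit.
Variable R : realType.
Implicit Types (t g x h : R).

(** Inside [exp_psum], index [k + 1] yields [- (- t)^(k+1) g^k / (k+1)!], the Taylor terms of
    [(1 - exp (- t g)) / g]. *)
Definition expcoef g (j : nat) : R := if j is k.+1 then - g ^+ k else 0.

(* [(1 - exp (- t g)) / g], extended by continuity to [g = 0] *)
Definition heat_quot t g : R := exp_series t (expcoef g).

Lemma expcoef_le g j : 0 <= g <= 1 -> `|expcoef g j| <= 1 * 1 ^+ j.
Proof.
move=> /andP[g0 g1]; rewrite expr1n mulr1; case: j => [|k] /=; first by rewrite normr0.
by rewrite normrN normrX ger0_norm// exprn_ile1.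
Qed.

Lemma heat_quot_dist t g n : 0 <= g <= 1 ->
  `|heat_quot t g - exp_psum t (expcoef g) n| <= exp_tail `|t| n.
Proof.
move=> g01; have := @exp_series_dist R t (expcoef g) 1 1 n ler01 (fun j => expcoef_le j g01).
by rewrite mul1r mulr1.
Qed.

(** Multiplication by [g] restores the powers of the exponential series without its constant term;
    the product form holds at [g = 0] too. *)
Lemma mul_heat_quot t g : 0 <= g <= 1 -> g * heat_quot t g = 1 - expR (- (t * g)).
Proof.
move=> g01.
have c1 : exp_psum t (expcoef g) n @[n --> \oo] --> heat_quot t g.
  apply/cvg_distP; apply: squeeze_cvgr (@exp_tail_cvg R `|t|); last exact: cvg_cst.
  by near=> n; rewrite normr_ge0 distrC heat_quot_dist.
have c2 : g * exp_psum t (expcoef g) n @[n --> \oo] --> 1 - expR (- (t * g)).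
  rewrite -cvg_shiftS.
  have : 1 - series (exp_coeff (- (t * g))) n.+1 @[n --> \oo] --> 1 - expR (- (t * g)).
    rewrite (cvg_shiftS (fun n => 1 - series (exp_coeff (- (t * g))) n)).
    by apply: cvgB; [exact: cvg_cst|exact: is_cvg_series_exp_coeff].
  apply: cvg_trans; apply: near_eq_cvg; near=> n.
  rewrite /series /exp_psum /exp_coeff /= big_mkord !big_ord_recl /= mulr0 add0r.
  rewrite expr0 fact0 divr1 opprD addrA subrr add0r mulr_sumr -sumrN.
  apply: eq_bigr => i _; rewrite /bump /= add1n.
  by rewrite -(mulNr t g) exprMn [g ^+ _.+1]exprS; ring.
exact: cvg_unique (cvgM (cvg_cst g) c1) c2.
Unshelve. all: by end_near. Qed.

Lemma expRN_le x : 0 <= x -> expR (- x) <= (1 + x)^-1.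
Proof.
by move=> x0; rewrite expRN lef_pV2 ?posrE ?expR_gt0 ?expR_ge1Dx//; lra.
Qed.

Lemma cvg_sqrtV (u : R) : 0 < u -> (Num.sqrt (1 + u * t))^-1 @[t --> +oo] --> 0.
Proof.
move=> u0; apply/cvgrPdist_le => e e0; near=> t.
have e2 : 0 < e ^- 2 by rewrite invr_gt0 exprn_gt0.
have te : e ^- 2 / u <= t by near: t; apply: nbhs_pinfty_ge; rewrite num_real.
have ut : e ^- 2 <= 1 + u * t.
  by move: te; rewrite ler_pdivrMr// mulrC => ?; lra.
have s0 : 0 < Num.sqrt (1 + u * t) by rewrite sqrtr_gt0; lra.
rewrite sub0r normrN ger0_norm ?invr_ge0 ?sqrtr_ge0//.
rewrite invf_ple ?posrE//.
rewrite -(ger0_norm (ltW (_ : 0 < e^-1))) ?invr_gt0// -sqrtr_sqr exprVn ler_sqrt//.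
by lra.
Unshelve. all: by end_near. Qed.

(* The partial fraction [q / (1 - h)], to be used with [q = p - a] and
   [h = p a + m n x], then with [q = p + a] and [- h]. *)
Lemma mean_partial_fraction (A0 B0 q : R) :
  0 <= 1 - A0 -> 0 < 1 + A0 -> `|B0| <= 1 + A0 -> (1 - A0) ^+ 2 - B0 ^+ 2 = q ^+ 2 ->
  exists r : R -> R, r t @[t --> +oo] --> 0 /\
  forall t, 0 <= t -> exists y z : nat -> R,
  [/\ y @ \oo --> Num.sg q, z @ \oo --> r t & forall N,
    `|q * mean N (fun x => (1 + (A0 + B0 * x)) * heat_quot t (1 - (A0 + B0 * x) ^+ 2)) - y N|
      <= z N].
Proof.
move=> Am Ap BA qE; have [->|q0] := eqVneq q 0.
  (* Here [1 - h] may vanish on the circle, but the term carries the factor [q = 0] and agrees with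
     [sg 0 = 0]. *)
  exists (fun=> 0); split=> [|t t0]; first exact: cvg_cst.
  exists (fun=> 0), (fun=> 0); split=> [||N]; rewrite ?sgr0; try exact: cvg_cst.
  by rewrite mul0r subrr normr0.
(* A nonzero [q] opens a gap: [1 - h] stays above [d]. *)
have BAm : `|B0| < 1 - A0.
  rewrite -ltr_sqr ?nnegrE// real_normK ?num_real// -subr_gt0 qE.
  by rewrite lt_neqAle sqr_ge0 eq_sym sqrf_eq0 q0.
pose d := 1 - A0 - `|B0|; have d0 : 0 < d by rewrite subr_gt0.
have B2 : B0 ^+ 2 <= (1 + A0) ^+ 2.
  by rewrite -[B0 ^+ 2]real_normK ?num_real// ler_sqr ?nnegrE// ltW.
(* The Poisson limit of the bound on the remainder. If [|B0| = 1 + A0] the quadratic terms in [t]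
   cancel and the linear one, [2 d (1 + A0) t], still forces decay. *)
pose r t := `|q| * d^-1 * (Num.sqrt ((1 + t * d * (1 + A0)) ^+ 2 - (- (t * d * B0)) ^+ 2))^-1.
exists r; split.
  have c0 : `|q| * d^-1 * (Num.sqrt (1 + (2 * d * (1 + A0)) * t))^-1 @[t --> +oo] --> 0.
    rewrite -[X in _ --> X](mulr0 (`|q| * d^-1)); apply: cvgM; first exact: cvg_cst.
    by apply: cvg_sqrtV; rewrite !mulr_gt0.
  apply: squeeze_cvgr c0; [near=> t|exact: cvg_cst].
  have t0 : 0 <= t by near: t; apply: nbhs_pinfty_ge; rewrite num_real.
  rewrite /r !mulr_ge0 ?invr_ge0 ?sqrtr_ge0 ?(ltW d0)//=.
  rewrite ler_wpM2l ?mulr_ge0 ?invr_ge0 ?(ltW d0)//.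
  have b0 : 1 + 2 * d * (1 + A0) * t <= (1 + t * d * (1 + A0)) ^+ 2 - (- (t * d * B0)) ^+ 2.
    rewrite -subr_ge0 [leRHS](_ : _ = (t * d) ^+ 2 * ((1 + A0) ^+ 2 - B0 ^+ 2)); last by ring.
    by rewrite mulr_ge0 ?sqr_ge0// subr_ge0.
  have b1 : 0 < 1 + 2 * d * (1 + A0) * t.
    have : 0 <= 2 * d * (1 + A0) * t by rewrite !mulr_ge0 ?(ltW d0) ?(ltW Ap).
    lra.
  by rewrite lef_pV2 ?posrE ?sqrtr_gt0 ?(lt_le_trans b1 b0)// ler_sqrt// (le_trans (ltW b1) b0).
move=> t t0; have td0 : 0 <= t * d by rewrite mulr_ge0// ltW.
(* Without the exponential the integrand is [q / (1 - h)], whose means tend to [q / |q|]. *)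
exists (fun N => q * mean N (fun x => (1 - A0 - B0 * x)^-1)).
exists (fun N => `|q| * d^-1 * mean N (fun x => (1 + t * d * (1 + A0) - - (t * d * B0) * x)^-1)).
split=> [||N].
- rewrite [X in _ --> X](_ : _ = q * (Num.sqrt ((1 - A0) ^+ 2 - B0 ^+ 2))^-1).
    by apply: cvgM; [exact: cvg_cst|exact: mean_poisson_cvg].
  rewrite qE sqrtr_sqr; apply: (mulIf (_ : `|q| != 0)); first by rewrite normr_eq0.
  by rewrite mulfVK ?normr_eq0// -numEsg.
- apply: cvgM; [exact: cvg_cst|apply: mean_poisson_cvg].
  rewrite normrN normrM ger0_norm//.
  by have := ler_wpM2l td0 BA; lra.
rewrite -mulrBr normrM -mulrA ler_wpM2l// -meanB -meanZ.
apply: le_trans (_ : _ <= mean N (fun x => `|(1 + (A0 + B0 * x)) *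
    heat_quot t (1 - (A0 + B0 * x) ^+ 2) - (1 - A0 - B0 * x)^-1|)) _.
  rewrite /mean normrM ger0_norm ?invr_ge0// ler_wpM2l ?invr_ge0//.
  exact: ler_norm_sum.
apply: ler_mean => x x1; set h := A0 + B0 * x.
have Bx : `|B0 * x| <= `|B0| by rewrite normrM ler_piMr// ler_norml.
have [Bx1 Bx2] : - `|B0| <= B0 * x /\ B0 * x <= `|B0| by apply/andP; rewrite -ler_norml.
have hd : d <= 1 - h by rewrite /d /h; lra.
have h1 : 0 <= 1 + h by rewrite /h; lra.
have h0 : 1 - h != 0 by rewrite gt_eqF//; lra.
have gE : 1 - h ^+ 2 = (1 - h) * (1 + h) by ring.
have g01 : 0 <= 1 - h ^+ 2 <= 1.
  by rewrite gE mulr_ge0 -?gE ?gerDl ?oppr_le0 ?sqr_ge0//; lra.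
have -> : 1 - A0 - B0 * x = 1 - h by rewrite /h; ring.
have -> : (1 + h) * heat_quot t (1 - h ^+ 2) - (1 - h)^-1 =
    - ((1 - h)^-1 * expR (- (t * (1 - h ^+ 2)))).
  apply: (mulfI h0); rewrite mulrBr mulrA -gE mul_heat_quot// mulrN mulrA mulfV// mul1r.
  by rewrite addrAC subrr add0r.
have -> : 1 + t * d * (1 + A0) - - (t * d * B0) * x = 1 + t * d * (1 + h) by rewrite /h; ring.
rewrite normrN ger0_norm; last by rewrite mulr_ge0 ?expR_ge0// invr_ge0; lra.
apply: ler_pM; rewrite ?expR_ge0// ?invr_ge0; first by lra.
  by rewrite lef_pV2 ?posrE//; lra.
(* Replacing [1 - h] by [d] makes the exponent affine in [x], so that [expRN_le] produces a Poisson
   integrand. *)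
apply: le_trans (_ : _ <= expR (- (t * d * (1 + h)))) _.
  by rewrite ler_expR lerN2 -mulrA gE ler_wpM2l// ler_wpM2r.
by rewrite expRN_le// mulr_ge0.
Unshelve. all: by end_near. Qed.

(** * The constant-coefficient operator at one end *)

Section Coefficients.
Variables (a p m n : R).
Hypotheses (am : a ^+ 2 + m ^+ 2 = 1) (pn : p ^+ 2 + n ^+ 2 = 1) (m0 : 0 <= m) (n0 : 0 <= n).

(** [al], [be], [ga] are the limits of the upper, diagonal and lower coefficients of the real
    matrix, with [m = |b|] and [n = |q|]. *)
Let al : R := (1 + p) * m / 2.
Let be : R := - (n * a).
Let ga : R := - ((1 - p) * m / 2).
Let h x : R := p * a + m * n * x.

Let m2E : m ^+ 2 = 1 - a ^+ 2. Proof. by rewrite -am; ring. Qed.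
Let n2E : n ^+ 2 = 1 - p ^+ 2. Proof. by rewrite -pn; ring. Qed.

Lemma sqmod_symbol_h x : sqmod_symbol al be ga x = 1 - h x ^+ 2.
Proof.
rewrite /sqmod_symbol /al /be /ga /h.
transitivity (p ^+ 2 * m ^+ 2 * x ^+ 2 - 2 * p * m * n * a * x + n ^+ 2 * a ^+ 2 +
   m ^+ 2 * (1 - x ^+ 2)); first by field.
transitivity (1 - (p ^+ 2 * a ^+ 2 + 2 * p * m * n * a * x + m ^+ 2 * n ^+ 2 * x ^+ 2)).
  by rewrite m2E n2E; ring.
by ring.
Qed.

Let psi x : R := p - a * h x.

(** The factor appearing in [flux_limit_mean]; its minus sign is the one built into [expcoef]. *)
Lemma winding_h x : (ga - al) * ((al + ga) + be * x) = - psi x.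
Proof.
rewrite /psi /al /be /ga /h.
transitivity (- (p * m ^+ 2 - m * n * a * x)); first by field.
by rewrite m2E; ring.
Qed.

Let a1 : -1 <= a <= 1.
Proof. by rewrite -ler_norml -(@expr_le1 _ 2)// real_normK ?num_real// -am lerDl sqr_ge0. Qed.

Let p1 : -1 <= p <= 1.
Proof. by rewrite -ler_norml -(@expr_le1 _ 2)// real_normK ?num_real// -pn lerDl sqr_ge0. Qed.

Let pa1 : -1 <= p * a <= 1.
Proof. by rewrite -ler_norml normrM mulr_ile1// ler_norml. Qed.

Let mn0 : 0 <= m * n. Proof. exact: mulr_ge0. Qed.

(** Squared, the two sides differ by [(p - a)^2]; the companion bound has [(p + a)^2], and together
    they confine [h] to [[-1, 1]]. *)
Let mn_le1 : m * n <= 1 - p * a.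
Proof.
have /andP[_ pa] := pa1; rewrite -ler_sqr ?nnegrE ?subr_ge0// -subr_ge0.
rewrite (_ : _ - _ = (p - a) ^+ 2) ?sqr_ge0// exprMn m2E n2E; ring.
Qed.

Let mn_le2 : m * n <= 1 + p * a.
Proof.
have /andP[pa _] := pa1; rewrite -ler_sqr ?nnegrE//; last by lra.
rewrite -subr_ge0 (_ : _ - _ = (p + a) ^+ 2) ?sqr_ge0// exprMn m2E n2E; ring.
Qed.

Let h1 x : -1 <= x <= 1 -> -1 <= h x <= 1.
Proof.
move=> x1; have : `|m * n * x| <= m * n.
  by rewrite normrM ger0_norm// ler_piMr// ler_norml.
rewrite ler_norml /h => /andP[? ?].
by have := mn_le1; have := mn_le2; move=> *; apply/andP; split; lra.
Qed.

Let g01 x : -1 <= x <= 1 -> 0 <= 1 - h x ^+ 2 <= 1.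
Proof.
move=> /h1/andP[? ?]; rewrite gerDl oppr_le0 sqr_ge0 andbT.
have -> : 1 - h x ^+ 2 = (1 - h x) * (1 + h x) by ring.
by apply: mulr_ge0; lra.
Qed.

Let psi2 x : -1 <= x <= 1 -> `|psi x| <= 2.
Proof.
move=> /h1 hx; have : `|a * h x| <= 1 by rewrite normrM mulr_ile1// ler_norml.
by rewrite !ler_norml /psi => /andP[? ?]; have /andP[? ?] := p1; apply/andP; split; lra.
Qed.

Local Notation J := (flux_limit al be ga).

Let J_mean N j : (j.*2 < N)%N -> J j = mean N (fun x => psi x * expcoef (1 - h x ^+ 2) j).
Proof.
case: j => [|k] jN.
  rewrite (@eq_mean _ _ _ (fun=> 0 * 0)) => [|x _]; last by rewrite mulr0 mul0r.
  by rewrite meanZ mul0r.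
rewrite (flux_limit_mean _ _ _ (jN : (k.*2.+2 < N)%N)).
by apply: eq_mean => x _; rewrite sqmod_symbol_h winding_h mulrN mulrC mulrN.
Qed.

Let J_le j : `|J j| <= 2 * 1 ^+ j.
Proof.
rewrite expr1n mulr1 (@J_mean (j.*2.+1))//; apply: mean_norm_le => // x x1.
rewrite normrM -[2]mulr1 ler_pM ?psi2//.
by have := expcoef_le j (g01 x1); rewrite expr1n mulr1.
Qed.

(** At a fixed truncation [k] the means are exact for large [N], while both truncation errors are at
    most [2 * exp_tail |t| k] uniformly in [N]; hence the [e / 4]. *)
Lemma mean_heat_cvg t :
  mean N (fun x => psi x * heat_quot t (1 - h x ^+ 2)) @[N --> \oo] --> exp_series t J.
Proof.
apply/cvgrPdist_le => e e0.
have e4 : 0 < e / 4 by rewrite divr_gt0.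
have /cvgrPdist_le/(_ _ e4)[k _ /(_ k (leqnn k))] := @exp_tail_cvg R `|t|.
rewrite sub0r normrN => /(le_trans (ler_norm _)) ne.
exists k.*2.+2 => // N /= nN.
have E1 : `|exp_series t J - exp_psum t J k| <= 2 * exp_tail `|t| k.
  by have := @exp_series_dist R t J 2 1 k ler01 J_le; rewrite mulr1.
have E2 : exp_psum t J k = mean N (fun x => psi x * exp_psum t (expcoef (1 - h x ^+ 2)) k).
  under [RHS]eq_mean => x _ do rewrite /exp_psum mulr_sumr.
  rewrite mean_sum; apply: eq_bigr => j _.
  rewrite (@J_mean N); last first.
    by rewrite (leq_trans _ nN)// ltnS leqW// leq_double ltnW.
  by rewrite -meanZ; apply: eq_mean => x _; rewrite mulrCA.
have E3 : `|exp_psum t J k - mean N (fun x => psi x * heat_quot t (1 - h x ^+ 2))| <=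
    2 * exp_tail `|t| k.
  rewrite E2 -meanB; apply: mean_norm_le => [|x x1].
    by rewrite mulr_ge0//; have := exp_tail_dist (normr_ge0 t) (leqnn k); rewrite big_geq.
  rewrite -mulrBr normrM ler_pM ?psi2// distrC.
  exact: heat_quot_dist (g01 x1).
have := le_trans (ler_distD (exp_psum t J k) _ _) (lerD E1 E3).
by move/le_trans; apply; lra.
Qed.

Lemma exp_series_flux_limit_cvg : exp_series t J @[t --> +oo] --> W a p.
Proof.
rewrite /W; case: ifPn => [/andP[/eqP a_1 /eqP p_1]|ap1].
  (* No hopping is left in this case: [m = 0] makes [al] and [ga] vanish, and every flux with
     them. *)
  have mz : m = 0.
    have a2 : a ^+ 2 = 1 by rewrite -(real_normK (num_real a)) a_1 expr1n.
    by apply/eqP; rewrite -sqrf_eq0; apply/eqP; move: am; rewrite a2; lra.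
  have J0 j : J j = 0.
    case: j => // k; rewrite (@flux_limit_mean _ k.*2.+3)//.
    rewrite (@eq_mean _ _ _ (fun=> 0 * 0)) => [|x _]; first by rewrite meanZ mul0r.
    have -> : ga - al = 0 by rewrite /ga /al mz; ring.
    by rewrite !mul0r mulr0.
  rewrite (_ : (fun t => exp_series t J) = (fun=> 0)); first exact: cvg_cst.
  apply/funext => t; apply/cvg_lim => //.
  rewrite (_ : exp_psum t J = fun=> 0); first exact: cvg_cst.
  by apply/funext => k; rewrite /exp_psum big1// => j _; rewrite J0 mulr0.
have /andP[pa_1 pa_2] := pa1.
(* Outside the excluded case [|p a| < 1], which provides the strict hypothesis [0 < 1 + A0] for both
   signs. *)
have paN1 : p * a != - 1 /\ p * a != 1.
  have a1' : `|a| <= 1 by rewrite ler_norml.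
  have p1' : `|p| <= 1 by rewrite ler_norml.
  suff pa : `|p * a| != 1 by split; apply: contraNneq pa => ->; rewrite ?normrN normr1.
  apply: contraNneq ap1 => /esym E; rewrite normrM in E.
  rewrite !eq_le a1' p1' /=; apply/andP; split; rewrite E.
    by rewrite ler_piMl.
  by rewrite ler_piMr.
have [paN pa'] := paN1.
have pa_gt : 0 < 1 + p * a by rewrite lt_neqAle; apply/andP; split; [apply: contraNneq paN; lra|lra].
have pa_lt : 0 < 1 - p * a by rewrite lt_neqAle; apply/andP; split; [apply: contraNneq pa'; lra|lra].
have nmn : `|m * n| = m * n by rewrite ger0_norm.
have [||||r1 [r10 H1]] := @mean_partial_fraction (p * a) (m * n) (p - a).
- exact: ltW.
- exact: pa_gt.
- by rewrite nmn.
- by rewrite exprMn m2E n2E; ring.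
have [||||r2 [r20 H2]] := @mean_partial_fraction (- (p * a)) (- (m * n)) (p + a).
- by rewrite opprK ltW.
- exact: pa_lt.
- by rewrite normrN nmn.
- by rewrite sqrrN exprMn m2E n2E; ring.
have WE : (Num.sg (a + p) - Num.sg (a - p)) / 2 = (Num.sg (p - a) + Num.sg (p + a)) / 2.
  by rewrite -[p - a]opprB sgrN (addrC p); ring.
rewrite WE; apply/cvg_distP.
have r12 : (r1 t + r2 t) / 2 @[t --> +oo] --> (0 : R).
  rewrite -[X in _ --> X](mul0r (2^-1)) -[X in X * _](addr0 0).
  by apply: cvgM; [exact: cvgD|exact: cvg_cst].
apply: squeeze_cvgr r12; [near=> t|exact: cvg_cst].
have t0 : 0 <= t by near: t; apply: nbhs_pinfty_ge; rewrite num_real.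
rewrite normr_ge0 /=.
have [y1 [z1 [y1s z1r D1]]] := H1 t t0; have [y2 [z2 [y2s z2r D2]]] := H2 t t0.
have cl : `|mean N (fun x => psi x * heat_quot t (1 - h x ^+ 2)) - (y1 N + y2 N) / 2|
    @[N --> \oo] --> `|exp_series t J - (Num.sg (p - a) + Num.sg (p + a)) / 2|.
  apply: cvg_norm; apply: cvgB; first exact: mean_heat_cvg.
  by apply: cvgM; [exact: cvgD|exact: cvg_cst].
have cr : (z1 N + z2 N) / 2 @[N --> \oo] --> (r1 t + r2 t) / 2.
  by apply: cvgM; [exact: cvgD|exact: cvg_cst].
apply: (ler_cvg_to cl cr); apply: nearW => N.
have -> : mean N (fun x => psi x * heat_quot t (1 - h x ^+ 2)) =
  ((p - a) * mean N (fun x => (1 + (p * a + m * n * x)) *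
      heat_quot t (1 - (p * a + m * n * x) ^+ 2)) +
   (p + a) * mean N (fun x => (1 + (- (p * a) + - (m * n) * x)) *
      heat_quot t (1 - (- (p * a) + - (m * n) * x) ^+ 2))) / 2.
  rewrite -!meanZ -meanD mulrC -meanZ; apply: eq_mean => x _.
  have -> : - (p * a) + - (m * n) * x = - (p * a + m * n * x) by ring.
  by rewrite sqrrN /psi -/(h x); field.
have := D1 N; have := D2 N.
rewrite !ler_norml => /andP[? ?] /andP[? ?]; apply/andP; split; lra.
Unshelve. all: by end_near. Qed.

End Coefficients.
End HeatLimit.

(** * Sequences with summable limits *)

Section SummableLimits.
Variable R : realType.
Local Notation C := R[i].
Implicit Types (f h : int -> R) (l r : R).

Definition step l r (x : int) : R := if 0 <= x then r else l.

(** Subtracting a step treats both ends in one sum; the step takes the right value at [0], in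
    accordance with the pairs [k], [- k - 1] of [wsum]. *)
Definition l1_limits f l r := absummable (fun x => f x - step l r x).

Lemma absummable_delta (x : int) (c : R) : absummable (fun y => (y == x)%:R * c).
Proof.
exists `|c| => n; under eq_wsum do rewrite normrM normr_nat.
by rewrite (wsum_delta (fun=> `|c|)); case: ifP.
Qed.

Lemma absummable_ext f h : (forall x, f x = h x) -> absummable f -> absummable h.
Proof. by move=> /funext ->. Qed.

Lemma absummableN f : absummable f -> absummable (fun x => - f x).
Proof. by apply: absummable_dom => x; rewrite normrN. Qed.

Lemma absummable_bounded f : absummable f -> exists M, forall x, `|f x| <= M.
Proof.
move=> [M fM]; exists M => x; have [n] := le_wsum_at x (fun x => normr_ge0 (f x)).
by move/le_trans; apply.
Qed.

Lemma l1_limits_bounded f l r : l1_limits f l r -> exists M, forall x, `|f x| <= M.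
Proof.
move=> /absummable_bounded[M fM]; exists (M + (`|l| + `|r|)) => x.
rewrite -[f x](subrK (step l r x)); apply: le_trans (ler_normD _ _) (lerD (fM x) _).
by rewrite /step; case: ifP; rewrite ?lerDl ?lerDr.
Qed.

Lemma l1_limits_cst l : l1_limits (fun=> l) l l.
Proof.
exists 0 => n; rewrite (@eq_wsum _ _ (fun=> 0)).
  by rewrite /wsum big1// => k _; rewrite addr0.
by move=> x; rewrite /step if_same subrr normr0.
Qed.

Lemma l1_limitsD f h l r l' r' : l1_limits f l r -> l1_limits h l' r' ->
  l1_limits (fun x => f x + h x) (l + l') (r + r').
Proof.
move=> fs hs; apply: absummable_ext (absummableD fs hs) => x.
by rewrite /step; case: ifP => _; ring.
Qed.

Lemma l1_limitsM f h l r l' r' : l1_limits f l r -> l1_limits h l' r' ->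
  l1_limits (fun x => f x * h x) (l * l') (r * r').
Proof.
move=> fs hs; have [M fM] := l1_limits_bounded fs.
have M0 : 0 <= M by exact: le_trans (fM 0).
have s1 : absummable (fun x => f x * (h x - step l' r' x)).
  apply: absummable_dom (absummableZ M hs) => x.
  by rewrite !normrM (ger0_norm M0) ler_wpM2r.
have s2 : absummable (fun x => step l' r' x * (f x - step l r x)).
  apply: absummable_dom (absummableZ (`|l'| + `|r'|) fs) => x.
  rewrite !normrM (ger0_norm (addr_ge0 (normr_ge0 l') (normr_ge0 r'))) ler_wpM2r//.
  by rewrite /step; case: ifP; rewrite ?lerDl ?lerDr.
apply: absummable_ext (absummableD s1 s2) => x.
by rewrite /step; case: ifP => _; ring.
Qed.

Lemma l1_limitsN f l r : l1_limits f l r -> l1_limits (fun x => - f x) (- l) (- r).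
Proof.
move=> fs; apply: absummable_ext (absummableN fs) => x.
by rewrite /step; case: ifP => _; ring.
Qed.

Lemma l1_limitsB f h l r l' r' : l1_limits f l r -> l1_limits h l' r' ->
  l1_limits (fun x => f x - h x) (l - l') (r - r').
Proof. by move=> fs /l1_limitsN; exact: l1_limitsD. Qed.

Lemma l1_limits_ext f h l r l' r' : l1_limits f l r -> (forall x, f x = h x) -> l = l' -> r = r' ->
  l1_limits h l' r'.
Proof. by move=> fs /funext <- <- <-. Qed.

(** The shift moves the jump of [step] from [0] to [-1]; the two steps differ at one site, which the
    delta corrects. *)
Lemma l1_limits_shift1 f l r : l1_limits f l r -> l1_limits (fun x => f (x + 1)) l r.
Proof.
move=> fs.
apply: absummable_ext (absummableD (absummable_shiftr fs) (absummable_delta (-1) (r - l))) => x.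
rewrite /step; case: eqVneq => [->|xN1].
  by rewrite addNr lexx (_ : (0 <= -1 :> int) = false)//=; ring.
by rewrite (_ : (0 <= x + 1) = (0 <= x)) ?mul0r ?addr0//; lia.
Qed.

Lemma l1_limits_shiftN1 f l r : l1_limits f l r -> l1_limits (fun x => f (x - 1)) l r.
Proof.
move=> fs.
apply: absummable_ext (absummableD (absummable_shiftl fs) (absummable_delta 0 (l - r))) => x.
rewrite /step; case: eqVneq => [->|xN1].
  by rewrite sub0r lexx (_ : (0 <= -1 :> int) = false)//=; ring.
by rewrite (_ : (0 <= x - 1) = (0 <= x)) ?mul0r ?addr0//; lia.
Qed.

Lemma l1_limits_shift f l r (d : int) : l1_limits f l r -> l1_limits (fun x => f (x + d)) l r.
Proof.
move=> fs; elim/int_ind: d => [|n IHn|n IHn].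
- by apply: l1_limits_ext fs _ _ _ => // x; rewrite addr0.
- by apply: l1_limits_ext (l1_limits_shift1 IHn) _ _ _ => // x; congr f; lia.
- by apply: l1_limits_ext (l1_limits_shiftN1 IHn) _ _ _ => // x; congr f; lia.
Qed.

Lemma l1_limits_cvg f l r : l1_limits f l r ->
  cvg_along (fun n => - n%:Z - 1) f l /\ cvg_along (fun n => n%:Z - 1) f r.
Proof.
move=> fs; split=> d; have [F1 F2] := absummable_boundary (l1_limits_shift d fs).
  rewrite -[X in _ --> X]add0r; apply: cvg_trans (cvgD F2 (cvg_cst l)).
  apply: near_eq_cvg; near=> n.
  by rewrite -[LHS]/(_ - step l r (- n%:Z - 1) + l) /step ifF ?subrK//; lia.
rewrite -[X in _ --> X]add0r; apply: cvg_trans (cvgD F1 (cvg_cst r)).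
apply: near_eq_cvg; near=> n.
rewrite -[LHS]/(_ - step l r (n%:Z - 1) + r) /step ifT ?subrK//.
have : (0 < n)%N by near: n; exact: nbhs_infty_gt.
by lia.
Unshelve. all: by end_near. Qed.

Lemma cvg_along_unique (s : nat -> int) f l r : cvg_along s f l -> cvg_along s f r -> l = r.
Proof. by move=> /(_ 0) fl /(_ 0); exact: cvg_unique. Qed.

Lemma l1_limits_unique f l r l' r' : l1_limits f l r -> l1_limits f l' r' -> l = l' /\ r = r'.
Proof.
move=> /l1_limits_cvg[fl fr] /l1_limits_cvg[fl' fr'].
by split; [exact: cvg_along_unique fl fl'|exact: cvg_along_unique fr fr'].
Qed.

Lemma l1_limits_dom f h l r l' r' k l0 r0 (K : R) : l1_limits h l' r' -> l1_limits k l0 r0 ->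
  (forall x, `|f x - step l r x| <= K * (`|h x - step l' r' x| + `|k x - step l0 r0 x|)) ->
  l1_limits f l r.
Proof.
move=> hs ks le.
have ab (u : int -> R) : absummable u -> absummable (fun x => `|u x|).
  by apply: absummable_dom => x; rewrite normr_id.
apply: absummable_dom (absummableZ K (absummableD (ab _ hs) (ab _ ks))) => x.
exact: le_trans (le x) (ler_norm _).
Qed.

(** The series in the hypothesis pairs [n] with [- n - 1], so its partial sums are exactly window
    sums. *)
Lemma summable_limits_l1 f l r : summable_limits f l r -> l1_limits f l r.
Proof.
move=> [_ _ /cvg_seq_bounded[M [_ fM]]]; exists (M + 1) => n.
have E : series (fun n : nat => `|f n%:Z - r| + `|f (- n%:Z - 1) - l|) n =
    wsum (fun x => `|f x - step l r x|) n.
  rewrite /series/= big_mkord; apply: eq_bigr => k _; rewrite /step /=.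
  by rewrite (_ : - k%:Z - 1 = - k.+1%:Z); last by lia.
have := fM (M + 1) _ n; rewrite ltrDl ltr01 => /(_ isT I) /=; rewrite E.
exact: le_trans (ler_norm _).
Qed.

Lemma cvgn_dist (K : numFieldType) (s : nat -> K) : cvgn s ->
  exists z, forall e : K, 0 < e -> \forall n \near \oo, `|z - s n| < e.
Proof. by move=> /cvg_ex[z /cvgrPdist_lt sz]; exists z => e e0; exact: sz. Qed.

(** Once the phases are gauged away only moduli remain. Their deviations are controlled by the
    reverse triangle inequality, and boundedness of the partial sums is enough, whence the single
    epsilon [1]. *)
Lemma summable_limits_normc (f : int -> C) (l r : C) : summable_limits f l r ->
  l1_limits (fun x => normc (f x)) (normc l) (normc r).
Proof.
move=> [_ _ /cvgn_dist[z /(_ 1 ltr01)[N _ NP]]].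
pose S n := \sum_(k < n) (normc (f k%:Z - r) + normc (f (- k%:Z - 1) - l)).
have SC n : series (fun n : nat => `|f n%:Z - r| + `|f (- n%:Z - 1) - l|) n = (S n)%:C.
  rewrite /series/= big_mkord rmorph_sum; apply: eq_bigr => k _.
  by rewrite !normcRE -rmorphD.
have Smono : {homo S : m n / (m <= n)%N >-> m <= n}.
  apply: homo_leq => [//|i j k|k]; first exact: le_trans.
  by rewrite /S big_ord_recr lerDl addr_ge0 ?normc_ge0.
exists (normc z + 1) => n; apply: (@le_trans _ _ (S (maxn n N))); last first.
  have := NP (maxn n N) (leq_maxr n N); rewrite SC normcRE ltcR.
  have := ler_normcD (z - (S (maxn n N))%:C) (- z); rewrite addrAC subrr add0r !normcN normcR.
  rewrite -[X in X <= _]/(_) => h1 h2.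
  have := ler_norm (S (maxn n N)); lra.
apply: le_trans (Smono _ _ (leq_maxl n N)).
apply: ler_sum => k _; rewrite /step /= (_ : - k%:Z - 1 = - k.+1%:Z); last by lia.
have aux (u v : C) : `|normc u - normc v| <= normc (u - v).
  rewrite ler_norml; have := ler_normcD (u - v) v; rewrite subrK.
  have := ler_normcD (v - u) u; rewrite subrK (normcB v) => *.
  by apply/andP; split; lra.
by apply: lerD; exact: aux.
Qed.

(* The square root is not Lipschitz at [0], but if [1 + p0 = 0] then the bound
   comes from [n ^ 2 = (1 - p) (1 + p)] and [n0 = 0]. *)
Lemma sqrt_lipschitz (p0 n0 : R) : p0 ^+ 2 + n0 ^+ 2 = 1 -> 0 <= n0 ->
  exists2 K, 0 <= K & forall p n, p ^+ 2 + n ^+ 2 = 1 -> 0 <= n ->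
  `|Num.sqrt (1 + p) - Num.sqrt (1 + p0)| <= K * (`|p - p0| + `|n - n0|).
Proof.
have bd (p n : R) : p ^+ 2 + n ^+ 2 = 1 -> -1 <= p <= 1.
  by move=> pn; rewrite -ler_norml -(@expr_le1 _ 2)// real_normK ?num_real// -pn lerDl sqr_ge0.
move=> pn0 n00; have /andP[p0m p0M] := bd _ _ pn0.
have [p0N|p0N] := eqVneq (1 + p0) 0.
  have p0E : p0 = -1 by lra.
  have n0E : n0 = 0.
    by apply/eqP; rewrite -sqrf_eq0; apply/eqP; move: pn0; rewrite p0E sqrrN expr1n; lra.
  exists 2 => // p n pn n1; have /andP[pm pM] := bd _ _ pn.
  rewrite p0N sqrtr0 subr0 ger0_norm ?sqrtr_ge0// p0E n0E subr0 opprK (ger0_norm n1).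
  rewrite (addrC p) (ger0_norm (_ : 0 <= 1 + p)); last by lra.
  rewrite -[leRHS]ger0_norm; last by rewrite mulr_ge0// addr_ge0//; lra.
  rewrite -sqrtr_sqr ler_sqrt ?sqr_ge0//.
  have -> : (2 * (1 + p + n)) ^+ 2 = 4 * (1 + p) ^+ 2 + 8 * (n * (1 + p)) + 4 * n ^+ 2 by ring.
  have n2 : n ^+ 2 = (1 - p) * (1 + p).
    by rewrite (_ : n ^+ 2 = 1 - p ^+ 2); [ring|move: pn; lra].
  have : 0 <= n * (1 + p) by rewrite mulr_ge0//; lra.
  (* On the circle [(1 + p)^2 + n^2 = 2 (1 + p)], so the constant [2] is enough. *)
  have : 1 + p <= 4 * ((1 + p) ^+ 2 + n ^+ 2) by rewrite n2; nra.
  by have := sqr_ge0 (1 + p); have := sqr_ge0 n; lra.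
have p0p : 0 < 1 + p0 by rewrite lt_neqAle eq_sym p0N; lra.
pose s0 := Num.sqrt (1 + p0); have s00 : 0 < s0 by rewrite sqrtr_gt0.
exists s0^-1 => [|p n pn n1]; first by rewrite invr_ge0 ltW.
have /andP[pm pM] := bd _ _ pn.
apply: (@le_trans _ _ (s0^-1 * `|p - p0|)); last first.
  by rewrite ler_wpM2l ?invr_ge0 ?(ltW s00)// lerDl.
rewrite ler_pdivlMl//.
have -> : p - p0 = (Num.sqrt (1 + p) - s0) * (Num.sqrt (1 + p) + s0).
  by rewrite -subr_sqr !sqr_sqrtr; lra.
rewrite normrM mulrC ler_wpM2l// ger0_norm ?addr_ge0 ?sqrtr_ge0// lerDr.
exact: sqrtr_ge0.
Qed.

Lemma l1_limits_sqrt (p n : int -> R) pl pr nl nr : (forall x, p x ^+ 2 + n x ^+ 2 = 1) ->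
  (forall x, 0 <= n x) -> l1_limits p pl pr -> l1_limits n nl nr ->
  pl ^+ 2 + nl ^+ 2 = 1 -> pr ^+ 2 + nr ^+ 2 = 1 -> 0 <= nl -> 0 <= nr ->
  l1_limits (fun x => Num.sqrt (1 + p x)) (Num.sqrt (1 + pl)) (Num.sqrt (1 + pr)).
Proof.
move=> pn n0 ps ns pnl pnr nl0 nr0.
have [K1 K10 H1] := sqrt_lipschitz pnl nl0; have [K2 K20 H2] := sqrt_lipschitz pnr nr0.
apply: (l1_limits_dom (K := K1 + K2) ps ns) => x.
rewrite /step; case: ifP => _.
  by apply: le_trans (H2 _ _ (pn x) (n0 x)) _; rewrite ler_wpM2r ?addr_ge0// lerDr.
by apply: le_trans (H1 _ _ (pn x) (n0 x)) _; rewrite ler_wpM2r ?addr_ge0// lerDl.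
Qed.

(** Constant-coefficient tridiagonal matrices commute with their transposes, so each diagonal, a
    polynomial in shifted coefficients, has both limits zero. *)
Lemma self_commutator_absummable (a b c : int -> R) (al bl cl ar br cr : R) d :
  l1_limits a al ar -> l1_limits b bl br -> l1_limits c cl cr -> absummable (self_commutator a b c d).
Proof.
move=> sa sb sc.
have s0 f l r : l1_limits f l r -> l = 0 -> r = 0 -> absummable f.
  move=> fs l0 r0; apply: absummable_ext fs => x.
  by rewrite /step l0 r0 if_same subr0.
have aS e := l1_limits_shift e sa; have bS e := l1_limits_shift e sb; have cS e := l1_limits_shift e sc.
rewrite /self_commutator; case: (d == 2).
  by apply: s0 (l1_limitsB (l1_limitsM (cS 1) (aS 1)) (l1_limitsM sa (cS 2))) _ _; ring.
case: (d == 1).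
  by apply: s0 (l1_limitsB (l1_limitsB (l1_limitsD (l1_limitsM (cS 1) (bS 1)) (l1_limitsM sb sa))
    (l1_limitsM sa (bS 1))) (l1_limitsM sb (cS 1))) _ _; ring.
case: (d == 0).
  by apply: s0 (l1_limitsB (l1_limitsB (l1_limitsD (l1_limitsM (cS 1) (cS 1)) (l1_limitsM (aS (-1)) (aS (-1))))
    (l1_limitsM sa sa)) (l1_limitsM sc sc)) _ _; ring.
case: (d == - 1).
  by apply: s0 (l1_limitsB (l1_limitsB (l1_limitsD (l1_limitsM sb sc) (l1_limitsM (aS (-1)) (bS (-1))))
    (l1_limitsM sb (aS (-1)))) (l1_limitsM sc (bS (-1)))) _ _; ring.
case: (d == - 2).
  by apply: s0 (l1_limitsB (l1_limitsM (aS (-1)) (cS (-1))) (l1_limitsM sc (aS (-2)))) _ _; ring.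
exact: s0 (l1_limits_cst 0) _ _.
Qed.

End SummableLimits.

(** * The operator Q_eps0 *)

Section Assembly.
Variable R : realType.
Local Notation C := R[i].
Local Notation H := (l2 R).

(** Solved from [g 0 = 1] in both directions; going backwards, division by the unimodular [w] is
    multiplication by its conjugate. *)
Lemma gauge_exists (w : int -> C) : (forall x, normc (w x) = 1) ->
  exists g : int -> C, (forall x, normc (g x) = 1) /\ forall x, g (x + 1) = g x * w x.
Proof.
move=> w1.
pose gp := fix gp (n : nat) : C := if n is k.+1 then gp k * w k%:Z else 1.
pose gn := fix gn (n : nat) : C := if n is k.+1 then gn k * (w (- k.+1%:Z))^*%C else 1.
pose g (x : int) := match x with Posz n => gp n | Negz n => gn n.+1 end.
have gp1 n : normc (gp n) = 1 by elim: n => [|n IHn]; rewrite ?normc1//= normcM IHn w1 mulr1.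
have gn1 n : normc (gn n) = 1.
  by elim: n => [|n IHn]; rewrite ?normc1//= normcM IHn normc_conj w1 mulr1.
exists g; split; first by case=> n; [exact: gp1|exact: gn1].
case=> n; first by rewrite (_ : n%:Z + 1 = n.+1%:Z) //=; lia.
have -> : Negz n + 1 = - n%:Z by lia.
have -> : g (- n%:Z) = gn n by case: n => //= n; rewrite -NegzE.
rewrite [g (Negz n)]/= NegzE -mulrA conj_mulE w1 expr1n mulr1; by [].
Qed.

Lemma phase_exists (z : C) : exists w : C, normc w = 1 /\ z = (normc z)%:C * w.
Proof.
have [->|z0] := eqVneq z 0; first by exists 1; rewrite normc0 normc1 mul0r.
have nz : normc z != 0 by rewrite normc_sub0.
exists (z / (normc z)%:C); split.
  by rewrite normcM normcV normcR ger0_norm ?normc_ge0// mulfV.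
by rewrite mulrCA mulfV ?mulr1// -[0]/(0%:C) (inj_eq (@complexI R)).
Qed.

Lemma coef_le_shift (s : C) (s' : C) : normc s <= 1 -> normc s' <= 1 ->
  coef_le (1 : R) (fun=> s) (fun=> 0) (fun=> s').
Proof. by move=> s1 s'1 x; rewrite normc0; split. Qed.

Lemma adjoint_left_shiftE (u : H) x : adjoint (@left_shift R) u x = u (x - 1).
Proof.
have c1 : coef_le (1 : R) (fun=> 1 : C) (fun=> 0) (fun=> 0).
  by apply: coef_le_shift; rewrite ?normc0 ?normc1.
have c2 : coef_le (1 : R) (fun=> 0 : C) (fun=> 0) (fun=> 1).
  by apply: coef_le_shift; rewrite ?normc0 ?normc1.
have LE : @left_shift R = triop (fun=> 1) (fun=> 0) (fun=> 0).
  apply/funext => v; apply: l2P => y.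
  by rewrite (triopE v y c1) left_shiftE /tri mul1r !mul0r !addr0.
have -> : adjoint (@left_shift R) = triop (fun=> 0) (fun=> 0) (fun=> 1).
  rewrite LE; apply: adjointE; apply: triop_adj c1 c2 _ => y.
  by rewrite conjc0 conjc1.
by rewrite (triopE u x c2) /tri !mul0r mul1r !add0r.
Qed.

Variables (a p : int -> R) (b q : int -> C) (theta : int -> R).
Hypotheses (ab1 : forall x, ((a x)%:C) ^+ 2 + `|b x| ^+ 2 = 1)
           (pq1 : forall x, ((p x)%:C) ^+ 2 + `|q x| ^+ 2 = 1).

Let am x : a x ^+ 2 + normc (b x) ^+ 2 = 1.
Proof.
by apply: complexI; rewrite rmorphD !rmorphXn/= -normcRE ab1.
Qed.

Let pn x : p x ^+ 2 + normc (q x) ^+ 2 = 1.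
Proof. by apply: complexI; rewrite rmorphD !rmorphXn/= -normcRE pq1. Qed.

Lemma sqr_sum_le1 (y z : R) : y ^+ 2 + z ^+ 2 = 1 -> `|y| <= 1.
Proof.
by move=> yz; rewrite -(@expr_le1 _ 2)// real_normK ?num_real// -yz lerDl sqr_ge0.
Qed.

Let a_le1 x : `|a x| <= 1. Proof. exact: sqr_sum_le1 (am x). Qed.
Let p_le1 x : `|p x| <= 1. Proof. exact: sqr_sum_le1 (pn x). Qed.
Let b_le1 x : normc (b x) <= 1.
Proof. by rewrite -[normc _]ger0_norm ?normc_ge0//; apply: (@sqr_sum_le1 _ (a x)); rewrite addrC. Qed.
Let q_le1 x : normc (q x) <= 1.
Proof. by rewrite -[normc _]ger0_norm ?normc_ge0//; apply: (@sqr_sum_le1 _ (p x)); rewrite addrC. Qed.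

Let sp x := Num.sqrt (1 + p x).
Let sm x := Num.sqrt (1 - p x).

Let sqrt_le2 (y : R) : `|y| <= 1 -> `|Num.sqrt (1 + y)| <= 2.
Proof.
rewrite ler_norml => /andP[y1 y2]; rewrite ger0_norm ?sqrtr_ge0//.
rewrite -[leRHS]ger0_norm// -sqrtr_sqr ler_sqrt ?sqr_ge0//; lra.
Qed.

Let sp_le2 x : `|sp x| <= 2. Proof. exact: sqrt_le2. Qed.
Let sm_le2 x : `|sm x| <= 2. Proof. by apply: sqrt_le2; rewrite normrN. Qed.

(** Factors to the right of [L] are read at [x + 1] and those to the right of [L^*] at [x - 1], so
    [b] is taken at [x + 1] above the diagonal but at [x] below it. *)
Definition Q_upper x : R := sp x * sp (x + 1) * normc (b (x + 1)) / 2.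
Definition Q_diag x : R := - (normc (q x) * (a x + a (x + 1)) / 2).
Definition Q_lower x : R := - (sm x * sm (x - 1) * normc (b x) / 2).

Lemma Q_seq_le : seq_le 2 Q_upper Q_diag Q_lower.
Proof.
have aux (s s' m : R) : `|s| <= 2 -> `|s'| <= 2 -> `|m| <= 1 -> `|s * s' * m / 2| <= 2.
  move=> s2 s'2 m1; rewrite normrM [`|2^-1|]ger0_norm ?invr_ge0// ler_pdivrMr// !normrM.
  rewrite -[2 * 2]mulr1; by apply: ler_pM; rewrite ?mulr_ge0//; exact: ler_pM.
have nb x : `|normc (b x)| <= 1 by rewrite ger0_norm ?normc_ge0.
move=> x; split; rewrite /Q_upper /Q_diag /Q_lower ?normrN; try exact: aux.
rewrite normrM [`|2^-1|]ger0_norm ?invr_ge0// ler_pdivrMr// normrM ger0_norm ?normc_ge0//.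
apply: (@le_trans _ _ (1 * 2)); last by lra.
apply: ler_pM; rewrite ?normc_ge0//.
by apply: le_trans (ler_normD _ _) _; have := a_le1 x; have := a_le1 (x + 1); lra.
Qed.

(* The recursion [g (x + 1) = g x * exp (i theta x) * phase (conj b (x + 1))]
   absorbs at once the phases of the [L] term and of the [L^*] term. *)
Lemma Q_eps0_gauged : exists g, (forall x, normc (g x) = 1) /\
  Q_eps0 a p b q theta = gauged_op g Q_upper Q_diag Q_lower.
Proof.
have /choice[e eP] : forall x, exists w : C, normc w = 1 /\ (b x)^*%C = (normc (b x))%:C * w.
  by move=> x; rewrite -normc_conj; exact: phase_exists.
have e1 x : normc (e x) = 1 by have [] := eP x.
have bE x : b x = (normc (b x))%:C * (e x)^*%C.
  by have [_ /(congr1 conjc)] := eP x; rewrite conjcK conjcM conjc_real.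
have [g [g1 gS]] := @gauge_exists (fun x => expi (theta x) * e (x + 1))
  (fun x => etrans (normcM _ _) (etrans (congr2 *%R (normc_expi _) (e1 _)) (mulr1 1))).
have gK x : (g x)^*%C * g x = 1 by rewrite conj_mulE g1 expr1n.
exists g; split=> //; apply/funext => u; apply: l2P => x.
have i1 : normc ('i : C) = 1 by rewrite /normc/= expr0n add0r expr1n sqrtr1.
rewrite /gauged_op /gauged (triopE u x (gauged_coef_le g1 i1 Q_seq_le)) /tri.
have spE := @mul_opE R (fun x => (sp x)%:C) 2 (fun x => eq_ind_r (fun z => z <= 2) (sp_le2 x) (normcR _)).
have smE := @mul_opE R (fun x => (sm x)%:C) 2 (fun x => eq_ind_r (fun z => z <= 2) (sm_le2 x) (normcR _)).
have thE (th : int -> R) := @mul_opE R (fun x => expi (th x)) 1 (fun x => eq_ind_r (fun z => z <= 1) (lexx _) (normc_expi _)).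
have bsE := @mul_opE R (fun x => (b x)^*%C) 1 (fun x => eq_ind_r (fun z => z <= 1) (b_le1 x) (normc_conj _)).
have bE' := @mul_opE R b 1 b_le1.
have qE := @mul_opE R (fun x => `|q x| * (a x + a (x + 1))%:C) 2.
rewrite /Q_eps0 -/sp -/sm.
rewrite -[LHS]/('i%C / 2 * (mul_op (fun x => (sp x)%:C) (mul_op (fun x => expi (theta x))
  (left_shift (mul_op (fun x => (b x)^*%C) (mul_op (fun x => (sp x)%:C) u)))) x
  - mul_op (fun x => (sm x)%:C) (mul_op b (adjoint (@left_shift R)
     (mul_op (fun x => expi (- theta x)) (mul_op (fun x => (sm x)%:C) u)))) x
  - mul_op (fun x => `|q x| * (a x + a (x + 1))%:C) u x)).
rewrite spE thE left_shiftE bsE spE smE bE' adjoint_left_shiftE (thE (fun x => - theta x)) smE.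
rewrite qE; last first.
  move=> y; rewrite normcM normcRE !normcR ger0_norm ?normc_ge0//.
  apply: (@le_trans _ _ (1 * 2)); last by lra.
  apply: ler_pM; rewrite ?normc_ge0//.
  by apply: le_trans (ler_normD _ _) _; have := a_le1 y; have := a_le1 (y + 1); lra.
have gS' : g x = g (x - 1) * (expi (theta (x - 1)) * e x) by have := gS (x - 1); rewrite subrK.
have ei : expi (- theta (x - 1)) * expi (theta (x - 1)) = 1 by rewrite -expiD addNr expi0.
have bs : (b (x + 1))^*%C = (normc (b (x + 1)))%:C * e (x + 1) by have [] := eP (x + 1).
(* The recursion inverted; it yields exactly the phase of the [L^*] term. *)
have -> : g (x - 1) = g x * (expi (- theta (x - 1)) * (e x)^*%C).
  rewrite gS' -mulrA [X in _ = _ * X]mulrACA -[X in _ = _ * X]mulrC.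
  by rewrite (mulrC (expi _)) ei mulr1 (mulrC (e x)) conj_mulE e1 expr1n mulr1.
rewrite gS /Q_upper /Q_diag /Q_lower.
transitivity ('i%C * (((sp x)%:C * (sp (x + 1))%:C * (normc (b (x + 1)))%:C / 2) *
   ((g x)^*%C * g x) * (expi (theta x) * e (x + 1)) * u (x + 1)
   - (normc (q x))%:C * ((a x)%:C + (a (x + 1))%:C) / 2 * u x
   - ((sm x)%:C * (sm (x - 1))%:C * (normc (b x))%:C / 2) *
   ((g x)^*%C * g x) * (expi (- theta (x - 1)) * (e x)^*%C) * u (x - 1))).
  rewrite gK bs normcRE (rmorphD (real_complex R)); have := bE x; set nb := normc (b x) => ->.
  by field.
rewrite !(rmorphN (real_complex R)) !(rmorphM (real_complex R)) (rmorphD (real_complex R)).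
by rewrite !(fmorphV (real_complex R)) !(rmorph_nat (real_complex R)); ring.
Qed.

End Assembly.

(** * Putting the two ends together *)

Lemma flux_limit_le (R : realType) (a b c : R) :
  exists2 L, 0 <= L & forall j, `|flux_limit a b c j| <= 1 * L ^+ j.
Proof.
pose K := `|a| + `|b| + `|c|; have K0 : 0 <= K by rewrite !addr_ge0.
have aK : `|a| <= K by rewrite /K -addrA lerDl addr_ge0.
have bK : `|b| <= K by rewrite /K addrAC lerDr addr_ge0.
have cK : `|c| <= K by rewrite /K lerDr addr_ge0.
exists (3 * K * (3 * K)) => [|j]; first by rewrite !mulr_ge0.
rewrite mul1r; case: j => [|k]; first by rewrite normr0.
exact: flux_bound.
Qed.

Lemma exp_series_cvg (R : realType) (t : R) x c L : 0 <= L -> (forall j, `|x j| <= c * L ^+ j) ->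
  exp_psum t x @ \oo --> exp_series t x.
Proof.
move=> L0 xL; apply/cvg_distP.
have e0 : c * exp_tail (`|t| * L) n @[n --> \oo] --> 0.
  by rewrite -[X in _ --> X](mulr0 c); apply: cvgM; [exact: cvg_cst|exact: exp_tail_cvg].
apply: squeeze_cvgr e0; last exact: cvg_cst.
by near=> n; rewrite normr_ge0 distrC exp_series_dist.
Unshelve. all: by end_near. Qed.

(** Separates the two ends, so that the limit in [t] can be taken at each of them. *)
Lemma exp_seriesB (R : realType) (t : R) x y c L c' L' :
  0 <= L -> (forall j, `|x j| <= c * L ^+ j) ->
  0 <= L' -> (forall j, `|y j| <= c' * L' ^+ j) ->
  exp_series t (fun j => x j - y j) = exp_series t x - exp_series t y.
Proof.
move=> L0 xL L'0 yL; apply/cvg_lim => //.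
have -> : exp_psum t (fun j => x j - y j) = (fun n => exp_psum t x n - exp_psum t y n).
  by apply/funext => n; rewrite /exp_psum -sumrB; apply: eq_bigr => j _; rewrite mulrBr.
by apply: cvgB; [exact: exp_series_cvg xL|exact: exp_series_cvg yL].
Qed.

Theorem theorem1p3 (R : realType)
    (a p : int -> R) (b q : int -> R[i]) (theta : int -> R)
    (am ap pm pp : R) (bm bp qm qp : R[i])
    (ab1 : forall x, ((a x)%:C) ^+ 2 + `|b x| ^+ 2 = 1)
    (pq1 : forall x, ((p x)%:C) ^+ 2 + `|q x| ^+ 2 = 1)
    (q_theta : forall x, q x = `|q x| * expi (theta x))
    (a_lim : summable_limits a am ap)
    (b_lim : summable_limits b bm bp)
    (p_lim : summable_limits p pm pp)
    (q_lim : summable_limits q qm qp) :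
  has_witten_index (Q_eps0 a p b q theta) (W ap pp - W am pm).
Proof.
have as_ := summable_limits_l1 a_lim; have ps := summable_limits_l1 p_lim.
have bs := summable_limits_normc b_lim; have qs := summable_limits_normc q_lim.
(* By uniqueness of limits the normalisations hold at both ends, as the analysis of the constant
   coefficients requires. *)
have unit (f h : int -> R) l r l' r' : l1_limits f l r -> l1_limits h l' r' ->
    (forall x, f x ^+ 2 + h x ^+ 2 = 1) -> l ^+ 2 + l' ^+ 2 = 1 /\ r ^+ 2 + r' ^+ 2 = 1.
  move=> fs hs fh; apply: (l1_limits_unique (l1_limitsD (l1_limitsM fs fs) (l1_limitsM hs hs))).
  by apply: l1_limits_ext (l1_limits_cst 1) _ _ _ => [x|//|//]; rewrite -(fh x).
have am1 x : a x ^+ 2 + normc (b x) ^+ 2 = 1.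
  by apply: complexI; rewrite rmorphD !rmorphXn/= -normcRE ab1.
have pn1 x : p x ^+ 2 + normc (q x) ^+ 2 = 1.
  by apply: complexI; rewrite rmorphD !rmorphXn/= -normcRE pq1.
have [aml amr] := unit _ _ _ _ _ _ as_ bs am1.
have [pnl pnr] := unit _ _ _ _ _ _ ps qs pn1.
have sps := l1_limits_sqrt pn1 (fun=> normc_ge0 _) ps qs pnl pnr (normc_ge0 _) (normc_ge0 _).
have sms : l1_limits (fun x => Num.sqrt (1 - p x)) (Num.sqrt (1 - pm)) (Num.sqrt (1 - pp)).
  by apply: l1_limits_sqrt (l1_limitsN ps) qs _ _ _ _ => [x|x|||//|//]; rewrite ?sqrrN ?normc_ge0.
(* Two square roots at neighbouring sites share their limit, so their product becomes [1 + p] or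
   [1 - p] at each end. *)
have sq (y z : R) : y ^+ 2 + z ^+ 2 = 1 ->
    Num.sqrt (1 + y) * Num.sqrt (1 + y) = 1 + y /\ Num.sqrt (1 - y) * Num.sqrt (1 - y) = 1 - y.
  move=> /sqr_sum_le1; rewrite ler_norml => /andP[y1 y2].
  by rewrite -!expr2 !sqr_sqrtr//; lra.
have [[sl sl'] [sr sr']] := (sq _ _ pnl, sq _ _ pnr).
have half : l1_limits (fun=> 2^-1 : R) 2^-1 2^-1 by exact: l1_limits_cst.
have Qas : l1_limits (Q_upper p b) ((1 + pm) * normc bm / 2) ((1 + pp) * normc bp / 2).
  apply: l1_limits_ext (l1_limitsM (l1_limitsM (l1_limitsM sps (l1_limits_shift 1 sps)) (l1_limits_shift 1 bs)) half) _ _ _ => //.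
  - by rewrite sl.
  - by rewrite sr.
have Qbs : l1_limits (Q_diag a q) (- (normc qm * am)) (- (normc qp * ap)).
  apply: l1_limits_ext (l1_limitsN (l1_limitsM (l1_limitsM qs (l1_limitsD as_ (l1_limits_shift 1 as_))) half)) _ _ _ => //.
  - by field.
  - by field.
have Qcs : l1_limits (Q_lower p b) (- ((1 - pm) * normc bm / 2)) (- ((1 - pp) * normc bp / 2)).
  apply: l1_limits_ext (l1_limitsN (l1_limitsM (l1_limitsM (l1_limitsM sms (l1_limits_shift (-1) sms)) bs) half)) _ _ _ => //.
  - by rewrite sl'.
  - by rewrite sr'.
have Q2 := Q_seq_le ab1 pq1.
have [g [g1 ->]] := Q_eps0_gauged theta ab1 pq1.
have ss d := self_commutator_absummable d Qas Qbs Qcs.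
have K1 : 1 <= 2 :> R by rewrite ler1n.
split.
- exact: op_le_bounded (gauged_op_le g1 Q2).
- exact: (gauged_commutator_trace_class g1 K1 Q2 ss).
- by move=> t _; exact: (gauged_heat_trace_class g1 K1 Q2 ss t).
have [Qal Qar] := l1_limits_cvg Qas; have [Qbl Qbr] := l1_limits_cvg Qbs; have [Qcl Qcr] := l1_limits_cvg Qcs.
have wE t := gauged_witten_ind g1 K1 Q2 t Qal Qbl Qcl Qar Qbr Qcr.
set Jr := flux_limit _ _ _ in wE; set Jl := flux_limit _ _ _ in wE.
have {}wE t : witten_ind (gauged_op g (Q_upper p b) (Q_diag a q) (Q_lower p b)) t =
    (exp_series t Jr - exp_series t Jl)%:C.
  rewrite wE; congr (_%:C).
  have [Lr Lr0 Br] : exists2 L, 0 <= L & forall j, `|Jr j| <= 1 * L ^+ j by exact: flux_limit_le.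
  have [Ll Ll0 Bl] : exists2 L, 0 <= L & forall j, `|Jl j| <= 1 * L ^+ j by exact: flux_limit_le.
  exact: exp_seriesB Lr0 Br Ll0 Bl.
have lim : exp_series t Jr - exp_series t Jl @[t --> +oo] --> W ap pp - W am pm.
  by apply: cvgB; apply: exp_series_flux_limit_cvg => //; exact: normc_ge0.
(* The limit lives in [R[i]]; it is reduced to the real modulus of the difference. *)
apply/cvgrPdist_lt; apply: ccvg_dist.
under eq_cvg do rewrite wE normc_realB.
exact: (cvg_distP _ _ _).1 lim.
Qed.
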